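(* Let $\mathcal V\subset L^2([0,1],\mathbb{R}^k)$ be a closed finite codimension subspace and let $K$ be a Hilbert–Schmidt operator of the form $K(v)(t)=\int_0^tV(t,\tau)v(\tau)\,d\tau$ (with $V(t,\tau)$ a $k\times k$ matrix with $L^2$ entries) such that $\langle u,Kv\rangle=\langle Ku,v\rangle$ for all $u,v\in\mathcal V$. Let $\mathcal A=\frac12(K-K^* )$ be its skew-symmetric part. Then: (1) $(K,\mathcal V)$ can be realized as the (compact part of the) second variation of an optimal control problem at a strictly normal regular extremal. (2) To $(K,\mathcal V)$ one can associate a triple $((\Sigma,\sigma),\Pi,Z)$ consisting of a finite dimensional symplectic space $(\Sigma,\sigma)$, a Lagrangian subspace $\Pi\subset\Sigma$, and a bounded linear map $Z:L^2([0,1],\mathbb{R}^k)\to\Sigma$ whose image is transversal to $\Pi$ (i.e. $\mathrm{Im}(Z)+\Pi=\Sigma$), such that $$\langle\mathcal Au,v\rangle=\sigma(Zu,Zv)\quad\forall\,u,v\in L^2([0,1],\mathbb{R}^k),\qquad\mathcal V=Z^{-1}(\Pi).$$ This triple is unique up to the action of $\mathrm{stab}_\Pi(\Sigma,\sigma)$, the group of linear symplectic transformations of $(\Sigma,\sigma)$ that map $\Pi$ to itself: (up to symplectic isomorphism of the pair $((\Sigma,\sigma),\Pi)$) any other such triple is $((\Sigma,\sigma),\Pi,\Phi\circ Z)$ with $\Phi\in\mathrm{stab}_\Pi(\Sigma,\sigma)$. (3) Vice versa, any triple $((\Sigma,\sigma),\Pi,Z)$ consisting of a finite dimensional symplectic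 space $(\Sigma,\sigma)$, a Lagrangian subspace $\Pi\subset\Sigma$, and a bounded linear map $Z:L^2([0,1],\mathbb{R}^k)\to\Sigma$ with $\mathrm{Im}(Z)+\Pi=\Sigma$ determines a couple $(K,\mathcal V)$, where $\mathcal V\subset L^2([0,1],\mathbb{R}^k)$ is a closed finite codimension subspace and $K$ is a Hilbert–Schmidt operator of the form $K(v)(t)=\int_0^tV(t,\tau)v(\tau)\,d\tau$ (with $V(t,\tau)$ a $k\times k$ matrix with $L^2$ entries) such that $\langle u,Kv\rangle=\langle Ku,v\rangle$ for all $u,v\in\mathcal V$: the skew-symmetric part $\mathcal A$ of $K$ is defined by $\langle\mathcal Au,v\rangle=\sigma(Zu,Zv)$ for all $u,v\in L^2([0,1],\mathbb{R}^k)$, $\mathcal A$ determines the whole operator $K$, and $\mathcal V=Z^{-1}(\Pi)$.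
   Context: Optimal control problem (fixed endpoints): a smooth manifold $M$, an open set $U\subset\mathbb{R}^k$, a family of vector fields $f_u=f_u^t$ on $M$ and a Lagrangian $\varphi(u,q)=\varphi^t(u,q)$, smooth in $(u,q)$ and possibly time dependent (square integrable in $t$). For a control $u\in L^\infty([0,1],U)$ let $\gamma_u$ solve $\dot q=f_{u(t)}(q)$, $q(0)=q_0$; $u$ is admissible if $\gamma_u$ is defined on $[0,1]$. One minimizes $\mathcal J(u)=\int_0^1\varphi(u(t),\gamma_u(t))dt$ over admissible $u$ with $\gamma_u(1)=q_1$. The endpoint map is $E^1(u)=\gamma_u(1)$. Symplectic conventions: $T^*M$, with projection $\pi$, carries the symplectic form $\sigma=ds$, where $s$ is the tautological form; the Hamiltonian field $\vec h$ is defined by $\sigma(X,\vec h)=dh(X)$. Put $h_u(\lambda)=\langle\lambda,f_u\rangle-\varphi(u,\pi(\lambda))$. A normal extremal is a pair $(\lambda(t),\tilde u)$ with $\dot\lambda=\vec h_{\tilde u(t)}(\lambda)$, $\pi(\lambda(t))=\gamma_{\tilde u}(t)$ and $h_{\tilde u(t)}(\lambda(t))=\max_{u\in U}h_u(\lambda(t))$ for a.e. $t$. It is strictly normal if $d_{\tilde u}E^1$ is surjective. Let $\tilde\Phi_t$ be the flow of $\vec h_{\tilde u(t)}$ with $\tilde\Phi_0=Id$, let $\lambda_0=\lambda(0)$ and $b_u^t=(h_u^t-h_{\tilde u(t)}^t)\circ\tilde\Phi_t$. Set $$Z_t=\partial_u\vec b_u^t(\lambda_0)|_{u=\tilde u(t)}:\mathbb{R}^k\to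 T_{\lambda_0}(T^*M),\qquad H_t=\partial_u^2b_u^t(\lambda_0)|_{u=\tilde u(t)}:\mathbb{R}^k\to\mathbb{R}^k .$$ The extremal is regular if $H_t$ is strictly negative definite with uniformly bounded inverse. Let $\Pi=\ker\pi_*\subset T_{\lambda_0}(T^*M)$. At a strictly normal extremal the second variation of $\mathcal J$ is $$d^2_{\tilde u}\mathcal J(u,v)=-\int_0^1\langle H_tu_t,v_t\rangle dt-\int_0^1\int_0^t\sigma(Z_\tau u_\tau,Z_tv_t)\,d\tau\,dt$$ on the space of $u$ with $\int_0^1Z_tu_tdt\in\Pi$. $(K,\mathcal V)$ is realized as the second variation if, for some such problem and strictly normal regular extremal, $\mathcal V=\{v\in L^2([0,1],\mathbb{R}^k):\int_0^1Z_tv_tdt\in\Pi\}$ and $K$ is the compact part, i.e. $\langle Kv,u\rangle=-\int_0^1\int_0^t\sigma(Z_\tau v_\tau,Z_tu_t)\,d\tau\,dt$ for all $u,v\in L^2([0,1],\mathbb{R}^k)$. *)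

(* Defs.v *)
From HB Require Import structures.
From mathcomp Require Import all_boot all_order all_algebra.
From mathcomp Require Import all_classical all_reals all_analysis.

Set Implicit Arguments.
Unset Strict Implicit.
Unset Printing Implicit Defensive.

Import Order.TTheory GRing.Theory Num.Theory.
Import numFieldNormedType.Exports.

Local Open Scope classical_set_scope.
Local Open Scope ring_scope.

(* Vectors are row vectors.  Functions of time are total functions on R, of
   which only the restriction to [0, 1] matters. *)

Definition I01 {R : realType} : set R := `[0, 1]%classic.

Definition dot {R : realType} {k : nat} (v w : 'rV[R]_k) : R :=
  \sum_i v 0 i * w 0 i.

(** * The space L^2([0,1], R^k) *)

Section L2.
Context {R : realType}.
Notation mu := (@lebesgue_measure R).

Definition sqint (f : R -> R) : Prop :=
  measurable_fun I01 f /\ mu.-integrable I01 (fun t => (f t ^+ 2)%:E).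

(* Square integrable functions, not classes: a statement about L^2 quantifies
   over [L2] and compares values with [ae_eq mu I01]. *)
Definition L2 {k : nat} : set (R -> 'rV[R]_k) :=
  [set u | forall i, sqint (fun t => u t 0 i)].

Context {k : nat}.
Implicit Types (u v : R -> 'rV[R]_k) (V : set (R -> 'rV[R]_k))
  (K : (R -> 'rV[R]_k) -> (R -> 'rV[R]_k)).

Definition ip u v : R := \int[mu]_(t in I01) dot (u t) (v t).

Definition normL2 u : R := Num.sqrt (ip u u).

(* Closedness makes V invariant under almost everywhere equality: take a
   constant sequence. *)
Record closed_fincodim V : Prop := ClosedFincodim {
  cf_sub : V `<=` L2;
  cf_zero : V 0;
  cf_lin : forall (a : R) u v, V u -> V v -> V (a *: u + v);
  cf_closed : forall (w : nat -> R -> 'rV[R]_k) u, (forall m, V (w m)) -> L2 u ->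
    (fun m => normL2 (w m - u)) @ \oo --> (0 : R) -> V u;
  cf_fincodim : exists (m : nat) (w : 'I_m -> R -> 'rV[R]_k),
    (forall j, L2 (w j)) /\
    forall u, L2 u -> exists c : 'I_m -> R, V (u - \sum_j c j *: w j) }.

Definition L2_kernel (N : R -> R -> 'M[R]_k) : Prop :=
  forall i j,
    measurable_fun (I01 `*` I01) (fun z : R * R => N z.1 z.2 i j) /\
    (mu \x mu)%E.-integrable (I01 `*` I01)
      (fun z : R * R => (N z.1 z.2 i j ^+ 2)%:E).

(* Hilbert-Schmidt operators K(v)(t) = int_0^t N(t,tau) v(tau) dtau. *)
Definition volterra_HS K : Prop :=
  (forall v, L2 v -> L2 (K v)) /\
  exists2 N, L2_kernel N &
    forall v, L2 v -> ae_eq mu I01 (K v) (fun t =>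
      \row_i \int[mu]_(tau in `[0, t]) (N t tau *m (v tau)^T) i 0).

Definition symmetric_on V K : Prop :=
  forall u v, V u -> V v -> ip u (K v) = ip (K u) v.

Definition is_adjoint K K' : Prop :=
  (forall v, L2 v -> L2 (K' v)) /\
  forall u v, L2 u -> L2 v -> ip (K u) v = ip u (K' v).

(* Determined on L2 up to almost everywhere equality. *)
Definition adjoint K : (R -> 'rV[R]_k) -> (R -> 'rV[R]_k) :=
  xget (fun=> 0) [set K' | is_adjoint K K'].

Definition skew_part K : (R -> 'rV[R]_k) -> (R -> 'rV[R]_k) :=
  fun u => 2^-1 *: (K u - adjoint K u).

End L2.

(** * Triples ((Sigma, sigma), Pi, Z) *)

Section Triples.
Context {R : realType}.

Definition symplectic_form (S : vectType R) (s : S -> S -> R) : Prop :=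
  [/\ forall x, scalar (s x), forall y, scalar (fun x => s x y),
      forall x, s x x = 0
    & forall x, (forall y, s x y = 0) -> x = 0].

Definition lagrangian (S : vectType R) (s : S -> S -> R) (P : {vspace S}) : Prop :=
  forall x, x \in P <-> forall y, y \in P -> s x y = 0.

Record lagrangian_pair := LagrangianPair {
  lspace :> vectType R;
  lform : lspace -> lspace -> R;
  lplane : {vspace lspace};
  lform_symplectic : symplectic_form lform;
  lplane_lagrangian : lagrangian lform lplane }.

Definition pair_iso (S S' : lagrangian_pair) (Psi : 'Hom(S, S')) : Prop :=
  [/\ bijective Psi,
      forall x y, lform (Psi x) (Psi y) = lform x y
    & (Psi @: lplane S)%VS = lplane S'].

Definition stab (S : lagrangian_pair) : set 'Hom(S, S) := [set Phi | pair_iso Phi].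

Context {k : nat}.

(* A finite dimensional space has a single vector topology; a linear map into
   it is bounded iff its composition with every linear form is. *)
Definition bounded_linear (S : vectType R) (Z : (R -> 'rV[R]_k) -> S) : Prop :=
  (forall (a : R) u v, L2 u -> L2 v -> Z (a *: u + v) = a *: Z u + Z v) /\
  forall l : S -> R, scalar l ->
    exists C : R, forall u, L2 u -> `|l (Z u)| <= C * normL2 u.

Definition is_triple (S : lagrangian_pair) (Z : (R -> 'rV[R]_k) -> S) : Prop :=
  bounded_linear Z /\
  forall x : S, exists u p, [/\ L2 u, p \in lplane S & x = Z u + p].

Definition represents (S : lagrangian_pair) (Z : (R -> 'rV[R]_k) -> S)
    (K : (R -> 'rV[R]_k) -> (R -> 'rV[R]_k)) (V : set (R -> 'rV[R]_k)) : Prop :=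
  (forall u v, L2 u -> L2 v -> ip (skew_part K u) v = lform (Z u) (Z v)) /\
  (forall u, V u <-> L2 u /\ Z u \in lplane S).

End Triples.
Arguments lagrangian_pair : clear implicits.
Arguments pair_iso {R} S S' Psi.
Arguments stab {R} S.
Arguments is_triple {R k} S Z.
Arguments represents {R k} S Z K V.

(** * Smooth manifolds and their cotangent bundle *)

Section Smooth.
Context {R : realType}.

(* To be used with D open. *)
Fixpoint Cm {E F : normedModType R} (m : nat) (D : set E) (f : E -> F) : Prop :=
  match m with
  | 0 => forall x, D x -> {for x, continuous f}
  | m'.+1 => (forall x, D x -> differentiable f x) /\
             forall v : E, Cm m' D ('D_v f)
  end.

Definition smooth_on {E F : normedModType R} (D : set E) (f : E -> F) : Prop :=
  forall m, Cm m D f.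

Definition iter_derive {E F : normedModType R} (s : seq E) (f : E -> F) : E -> F :=
  foldr (fun v g => 'D_v g) f s.

(* Smooth for each time, square integrable in time: each derivative is bounded,
   locally uniformly, by a square integrable function of time. *)
Definition L2_smooth {E : normedModType R} (D : set E) (g : R -> E -> R) : Prop :=
  [/\ forall t, I01 t -> smooth_on D (g t),
      forall x, D x -> measurable_fun I01 (fun t => g t x)
    & forall (s : seq E) x, D x -> exists2 r : R -> R, sqint r &
        \forall y \near x, forall t, I01 t -> `|iter_derive s (g t) y| <= r t].

End Smooth.

(* chart_at selects a preferred chart around each point, in which tangent
   vectors and covectors at that point are written. *)
Record manifold (R : realType) (n : nat) := Manifold {
  mpoint :> topologicalType;
  mchart : Type;
  mdom : mchart -> set mpoint;
  mcoord : mchart -> mpoint -> 'rV[R]_n;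
  mpar : mchart -> 'rV[R]_n -> mpoint;
  chart_at : mpoint -> mchart;
  mdom_chart_at : forall q, mdom (chart_at q) q;
  mdom_open : forall i, open (mdom i);
  mimg_open : forall i, open (mcoord i @` mdom i);
  mcoordK : forall i q, mdom i q -> mpar i (mcoord i q) = q;
  mcoord_continuous : forall i q, mdom i q -> {for q, continuous (mcoord i)};
  mpar_continuous : forall i x, (mcoord i @` mdom i) x ->
    {for x, continuous (mpar i)};
  mtransition_smooth : forall i j,
    smooth_on (mcoord i @` (mdom i `&` mdom j)) (mcoord j \o mpar i);
  mhausdorff : hausdorff_space mpoint;
  msecond_countable : @second_countable mpoint }.

Section Cotangent.
Context {R : realType} {n : nat} (M : manifold R n).

(* (q, p) is the covector at q whose components in the chart chart_at q are p;
   T_qM is likewise 'rV_n.  The product topology is not the one of T*M, which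
   is only accessed through charts. *)
Definition cotangent : Type := (M * 'rV[R]_n)%type.

(* Components in the chart i of the tangent vector v at q. *)
Definition vec_coord (i : mchart M) (q : M) (v : 'rV[R]_n) : 'rV[R]_n :=
  v *m 'J (mcoord i \o mpar (chart_at q)) (mcoord (chart_at q) q).

(* The canonical coordinates (position, momentum) of T*M over the chart i, and
   the inverse map. *)
Definition ct_coord (i : mchart M) (l : cotangent) : 'rV[R]_n * 'rV[R]_n :=
  (mcoord i l.1,
   l.2 *m ('J (mcoord (chart_at l.1) \o mpar i) (mcoord i l.1))^T).

Definition ct_par (i : mchart M) (x : 'rV[R]_n * 'rV[R]_n) : cotangent :=
  let q := mpar i x.1 in
  (q, x.2 *m ('J (mcoord i \o mpar (chart_at q)) (mcoord (chart_at q) q))^T).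

(* sigma = dp /\ dq in canonical coordinates, as s = p dq. *)
Definition sigma (X Y : 'rV[R]_n * 'rV[R]_n) : R := dot X.2 Y.1 - dot X.1 Y.2.

(* The field vec h with sigma(X, vec h) = dh(X): (dh/dp, - dh/dq). *)
Definition ham_vec (h : 'rV[R]_n * 'rV[R]_n -> R) (x : 'rV[R]_n * 'rV[R]_n) :
    'rV[R]_n * 'rV[R]_n :=
  (\row_a 'D_((0, delta_mx 0 a) : 'rV[R]_n * 'rV[R]_n) h x,
   - \row_a 'D_((delta_mx 0 a, 0) : 'rV[R]_n * 'rV[R]_n) h x).

Notation mu := (@lebesgue_measure R).

(* x' = X almost everywhere, x absolutely continuous on [a, b], in integral
   form. *)
Definition primitive_on (a b : R) (X x : R -> 'rV[R]_n) : Prop :=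
  forall j, mu.-integrable `[a, b] (fun t => (X t 0 j)%:E) /\
    forall c, a <= c <= b ->
      x c 0 j - x a 0 j = \int[mu]_(t in `[a, c]) X t 0 j.

(* Caratheodory solutions on [0, 1] of lambda' = vec h_t(lambda), tested in
   each chart on each time interval spent there. *)
Definition ham_curve (h : R -> cotangent -> R) (l : R -> cotangent) : Prop :=
  {within I01, continuous (fun t => (l t).1)} /\
  forall (i : mchart M) (a b : R), 0 <= a -> a <= b -> b <= 1 ->
    (forall t, a <= t <= b -> mdom i (l t).1) ->
    let x t := ct_coord i (l t) in
    let X t := ham_vec (h t \o ct_par i) (x t) in
    primitive_on a b (fun t => (X t).1) (fun t => (x t).1) /\
    primitive_on a b (fun t => (X t).2) (fun t => (x t).2).

(* Phi t is defined near l0 at least; it is Id for t = 0. *)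
Definition ham_flow_near (h : R -> cotangent -> R) (l0 : cotangent)
    (Phi : R -> cotangent -> cotangent) : Prop :=
  let i := chart_at l0.1 in
  \forall x \near ct_coord i l0,
    ham_curve h (fun t => Phi t (ct_par i x)) /\
    Phi 0 (ct_par i x) = ct_par i x.

End Cotangent.

(** * Optimal control problems *)

Record control_problem (R : realType) (k : nat) := ControlProblem {
  cdim : nat;
  cman : manifold R cdim;
  cset : set 'rV[R]_k;
  cfield : R -> 'rV[R]_k -> cman -> 'rV[R]_cdim;
  clagr : R -> 'rV[R]_k -> cman -> R;
  cstart : cman;
  cend : cman;
  cset_open : open cset;
  cfield_smooth : forall (i : mchart cman) (a : 'I_cdim),
    L2_smooth (cset `*` (mcoord i @` mdom i))
      (fun t (y : 'rV[R]_k * 'rV[R]_cdim) =>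
        vec_coord i (mpar i y.2) (cfield t y.1 (mpar i y.2)) 0 a);
  clagr_smooth : forall i : mchart cman,
    L2_smooth (cset `*` (mcoord i @` mdom i))
      (fun t (y : 'rV[R]_k * 'rV[R]_cdim) => clagr t y.1 (mpar i y.2)) }.

Section SecondVariation.
Context {R : realType} {k : nat}.
Notation mu := (@lebesgue_measure R).

Definition ess_le (v : R -> 'rV[R]_k) (r : R) : Prop :=
  {ae mu, forall t, I01 t -> `|v t| <= r}.

Definition Linfty : set (R -> 'rV[R]_k) :=
  [set v : R -> 'rV[R]_k | (forall i, measurable_fun I01 (fun t => v t 0 i)) /\
           exists r : R, ess_le v r].

Context (P : control_problem R k).
Notation M := (cman P).
Notation n := (cdim P).

Definition control (u : R -> 'rV[R]_k) : Prop :=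
  Linfty u /\ {ae mu, forall t, I01 t -> cset P (u t)}.

Definition trajectory (u : R -> 'rV[R]_k) (gam : R -> M) : Prop :=
  [/\ gam 0 = cstart P,
      {within I01, continuous gam}
    & forall (i : mchart M) (a b : R), 0 <= a -> a <= b -> b <= 1 ->
        (forall t, a <= t <= b -> mdom i (gam t)) ->
        primitive_on a b
          (fun t => vec_coord i (gam t) (cfield t (u t) (gam t)))
          (fun t => mcoord i (gam t))].

(* The graph of the endpoint map E^1, on the admissible controls. *)
Definition endpoint (u : R -> 'rV[R]_k) (q : M) : Prop :=
  control u /\ exists2 gam, trajectory u gam & gam 1 = q.

(* E^1 is defined on an L^infty-neighbourhood of u, is Frechet differentiable
   at u and its differential there is L, T_{cend}M being written in the chart
   chart_at (cend P). *)
Definition endpoint_differential (u : R -> 'rV[R]_k)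
    (L : (R -> 'rV[R]_k) -> 'rV[R]_n) : Prop :=
  let i := chart_at (cend P) in
  [/\ endpoint u (cend P),
      forall (a : R) v w, Linfty v -> Linfty w -> L (a *: v + w) = a *: L v + L w,
      exists C : R, forall (v : R -> 'rV[R]_k) (r : R), Linfty v -> ess_le v r -> `|L v| <= C * r
    & forall e : R, 0 < e -> exists2 d : R, 0 < d &
        forall (v : R -> 'rV[R]_k) (r : R), Linfty v -> ess_le v r -> r < d ->
          (exists q, endpoint (u + v) q) /\
          forall q, endpoint (u + v) q -> mdom i q /\
            `|mcoord i q - mcoord i (cend P) - L v| <= e * r].

Definition strictly_normal (u : R -> 'rV[R]_k) : Prop :=
  exists2 L, endpoint_differential u L &
    forall y, exists2 v, Linfty v & L v = y.

(* h_u^t(lambda) = <lambda, f_u^t> - phi^t(u, pi(lambda)) *)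
Definition ham (t : R) (u : 'rV[R]_k) (l : cotangent M) : R :=
  dot l.2 (cfield t u l.1) - clagr t u l.1.

Definition normal_extremal (u : R -> 'rV[R]_k) (l : R -> cotangent M) : Prop :=
  [/\ control u,
      trajectory u (fun t => (l t).1),
      (l 1).1 = cend P,
      ham_curve (fun t => ham t (u t)) l
    & {ae mu, forall t, I01 t -> forall w, cset P w ->
        ham t w (l t) <= ham t (u t) (l t)}].

Section AlongExtremal.
Variables (u : R -> 'rV[R]_k) (l0 : cotangent M)
  (Phi : R -> cotangent M -> cotangent M).
Let i0 : mchart M := chart_at l0.1.

(* b_w^t in the canonical coordinates of T*M over i0, in which T_{l0}(T*M) is
   'rV_n * 'rV_n with the form sigma. *)
Definition b_fun (t : R) (w : 'rV[R]_k) (x : 'rV[R]_n * 'rV[R]_n) : R :=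
  ham t w (Phi t (ct_par i0 x)) - ham t (u t) (Phi t (ct_par i0 x)).

Definition Z_map (t : R) (v : 'rV[R]_k) : 'rV[R]_n * 'rV[R]_n :=
  'D_v (fun w => ham_vec (b_fun t w) (ct_coord i0 l0)) (u t).

Definition H_mx (t : R) : 'M[R]_k :=
  \matrix_(a, b) 'D_(delta_mx 0 a)
    ('D_(delta_mx 0 b) (fun w => b_fun t w (ct_coord i0 l0))) (u t).

Definition regular : Prop :=
  exists C : R, {ae mu, forall t, I01 t ->
    (forall v, v != 0 -> dot (v *m H_mx t) v < 0) /\ `|invmx (H_mx t)| <= C}.

Definition Z_int (v : R -> 'rV[R]_k) : 'rV[R]_n * 'rV[R]_n :=
  (\row_a \int[mu]_(t in I01) (Z_map t (v t)).1 0 a,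
   \row_a \int[mu]_(t in I01) (Z_map t (v t)).2 0 a).

End AlongExtremal.

(* ker pi_* *)
Definition vertical : set ('rV[R]_n * 'rV[R]_n) := [set X | X.1 = 0].

End SecondVariation.

Definition realized {R : realType} {k : nat}
    (K : (R -> 'rV[R]_k) -> (R -> 'rV[R]_k)) (V : set (R -> 'rV[R]_k)) : Prop :=
  exists (P : control_problem R k) (u : R -> 'rV[R]_k)
    (l : R -> cotangent (cman P))
    (Phi : R -> cotangent (cman P) -> cotangent (cman P)),
  [/\ normal_extremal u l,
      strictly_normal P u,
      ham_flow_near (fun t => ham t (u t)) (l 0) Phi
    & regular u (l 0) Phi] /\
  let Z := Z_map u (l 0) Phi in
  (forall v, V v <-> L2 v /\ vertical (Z_int u (l 0) Phi v)) /\
  (forall v w, L2 v -> L2 w ->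
    ip (K v) w = - \int[@lebesgue_measure R]_(t in I01)
      \int[@lebesgue_measure R]_(tau in `[0, t])
        sigma (Z tau (v tau)) (Z t (w t))).

(* Main.v *)
Require Import Defs.
From HB Require Import structures.
From mathcomp Require Import all_boot all_order all_algebra.
From mathcomp Require Import all_classical all_reals all_analysis.
From mathcomp Require Import measurable_realfun.
From mathcomp Require Import ring lra.
Import Order.TTheory GRing.Theory Num.Theory.
Import numFieldNormedType.Exports.
Local Open Scope classical_set_scope.
Local Open Scope ring_scope.

(* Let A be the skew part of K and w an orthonormal basis of the orthogonal
   complement of V.  Since <Au, v> vanishes on V x V, there are y_i in L^2 with
   <Au, v> = sum_i <y_i, u><w_i, v> - <w_i, u><y_i, v>, that is, the map
   Zu = (<w_i, u>, <y_i, u>)_i into R^m x R^m with its standard symplectic form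
   and Pi = {0} x R^m represents (K, V).

   Two triples representing the same couple are related by Z u + p |-> Z' u + p',
   where p' in Pi' pairs with Z' as p in Pi pairs with Z; nondegeneracy makes
   this relation a symplectic isomorphism.

   A Volterra operator is determined by its skew part: the difference D of two
   candidates has a symmetric form, hence maps functions supported in [0, a] to
   functions vanishing on ]a, 1], and (Dv)(t) = 0 follows as a increases to t.
   Conversely, by Riesz a triple gives A a kernel of finite rank, and twice its
   restriction to tau < t is the kernel of K (Fubini on the triangle).

   For the realization take M = R^m, f_u = X_t u and
   phi = |u|^2 / 2 + <q, Y_t u>, with X_t and Y_t the maps of rows w_i(t) and
   - 2 y_i(t), along the zero extremal: then Z_t = (X_t, Y_t) and H_t = - 1. *)

(** * Square integrable functions *)

(** Elements of L^2 are functions, not classes, so an operator is known, and is linear, only almost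
    everywhere; completeness, projection and Riesz are proved in that setting, and null functions
    are absorbed by the closedness of V.

    The obstacle to uniqueness of a Volterra operator is that the exceptional null set depends on
    the function to which it is applied. Only countably many truncations can be compared at once:
    rational ones, completed by continuity of the indefinite integral.

    Orthonormality of the w_i serves twice: for transversality of the standard triple and for strict
    normality. The latter is harder, as the differential of the endpoint map must be onto already
    from bounded controls.

    The constants come from one computation: for a skew kernel, K uses one triangle of the square
    and A averages both, so K carries twice the kernel of A. With the sign of the second variation,
    the compact part has skew form - sigma(int Z u, int Z v) / 2; hence the factor - 2 on y_i. In
    the realization K is not constructed: the compact part of the problem has the same skew part, so
    uniqueness identifies it with K. *)

Section SquareIntegrable.
Set Implicit Arguments.
Unset Strict Implicit.
Context {R : realType}.
Notation mu := (@lebesgue_measure R).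
Implicit Types f g : R -> R.
Notation rint D f := (mu.-integrable D (EFin \o (f : R -> R))).

Lemma measurable_I01 : measurable (@I01 R).
Proof. exact: measurable_itv. Qed.

Hint Extern 0 (measurable _) => solve [exact: measurable_I01] : core.

Lemma mu_I01 : mu (@I01 R) = 1%E.
Proof. by rewrite /I01 lebesgue_measure_itv/= lte_fin ltr01 oppr0 adde0. Qed.

Lemma ae_imply (D : set R) (P Q : R -> Prop) : (forall t, D t -> P t -> Q t) ->
  {ae mu, forall t, D t -> P t} -> {ae mu, forall t, D t -> Q t}.
Proof.
move=> PQ; apply: (@filterS _ _ (ae_filter_ringOfSetsType mu)) => t Pt Dt.
exact: PQ (Pt Dt).
Qed.

Lemma ae_and (D : set R) (P Q : R -> Prop) : {ae mu, forall t, D t -> P t} ->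
  {ae mu, forall t, D t -> Q t} -> {ae mu, forall t, D t -> P t /\ Q t}.
Proof.
apply: (@filterS2 _ _ (ae_filter_ringOfSetsType mu)) => t Pt Qt Dt.
by split; [exact: Pt|exact: Qt].
Qed.

Lemma ae_forallnat (D : set R) (P : nat -> R -> Prop) :
  (forall n, {ae mu, forall t, D t -> P n t}) ->
  {ae mu, forall t, D t -> forall n, P n t}.
Proof.
move=> H; have := @ae_foralln _ _ _ mu (fun n t => D t -> P n t) H.
by apply: (@filterS _ _ (ae_filter_ringOfSetsType mu)) => t Pt Dt n; exact: Pt.
Qed.

Lemma ae_forallfin (I : finType) (D : set R) (P : I -> R -> Prop) :
  (forall i, {ae mu, forall t, D t -> P i t}) ->
  {ae mu, forall t, D t -> forall i, P i t}.
Proof.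
move=> H; have := @filter_forall _ I (fun i t => D t -> P i t) (almost_everywhere mu)
  (ae_filter_ringOfSetsType mu) H.
by apply: (@filterS _ _ (ae_filter_ringOfSetsType mu)) => t Pt Dt n; exact: Pt.
Qed.

Lemma aeT (D : set R) (P : R -> Prop) : (forall t, D t -> P t) ->
  {ae mu, forall t, D t -> P t}.
Proof. by move=> H; apply: aeW. Qed.

Section Integrable.
Variables (D : set R) (mD : measurable D).

Lemma rint_eq f g : (forall t, D t -> f t = g t) -> rint D f -> rint D g.
Proof.
by move=> fg; apply: eq_integrable => // t /set_mem Dt /=; rewrite fg.
Qed.

Lemma rint_le f g : measurable_fun D f -> (forall t, D t -> `|f t| <= g t) ->
  rint D g -> rint D f.
Proof.
move=> mf fg; apply: le_integrable => //; first exact/measurable_EFinP.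
by move=> t Dt /=; rewrite lee_fin (le_trans (fg _ Dt))// ler_norm.
Qed.

Lemma rintD f g : rint D f -> rint D g -> rint D (fun t => f t + g t).
Proof. by move=> iF iG; exact: (@integrableD _ _ _ mu D mD _ _ iF iG). Qed.

Lemma rintZ (c : R) f : rint D f -> rint D (fun t => c * f t).
Proof. by move=> iF; exact: (@integrableZl _ _ _ mu D mD c _ iF). Qed.

Lemma rint_norm f : rint D f -> rint D (fun t => `|f t|).
Proof. by move=> iF; apply: (integrable_abse iF). Qed.

Lemma rint_sum (I : Type) (s : seq I) (h : I -> R -> R) :
  (forall i, rint D (h i)) -> rint D (fun t => \sum_(i <- s) h i t).
Proof.
move=> ih; have := @integrable_sum _ _ _ mu D mD _ s xpredT
  (fun i => EFin \o h i) (fun i _ => ih i).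
by apply: eq_integrable => // t _ /=; rewrite sumEFin.
Qed.

Lemma rint_meas f : rint D f -> measurable_fun D f.
Proof. by move/(measurable_int mu)/measurable_EFinP. Qed.

Lemma Rintegral_sum (I : Type) (s : seq I) (h : I -> R -> R) :
  (forall i, rint D (h i)) ->
  \int[mu]_(t in D) (\sum_(i <- s) h i t) = \sum_(i <- s) \int[mu]_(t in D) h i t.
Proof.
move=> ih; elim: s => [|i s IH].
  rewrite big_nil; under eq_Rintegral do rewrite big_nil.
  by rewrite Rintegral_cst// mul0r.
under eq_Rintegral do rewrite big_cons.
by rewrite RintegralD// ?IH ?big_cons//; exact: rint_sum.
Qed.

Lemma RintegralZ (c : R) f : rint D f ->
  \int[mu]_(t in D) (c * f t) = c * \int[mu]_(t in D) f t.
Proof. by move=> iF; rewrite RintegralZl. Qed.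

Lemma rint_ae f g : measurable_fun D g -> ae_eq mu D f g -> rint D f -> rint D g.
Proof.
move=> mg fg iF; have mf := rint_meas iF.
case/integrableP: iF => _ If; apply/integrableP; split.
  exact/measurable_EFinP.
apply: le_lt_trans If.
rewrite le_eqVlt; apply/orP; left; apply/eqP; apply: ae_eq_integral => //.
- by apply/measurable_EFinP; apply: measurableT_comp.
- by apply/measurable_EFinP; apply: measurableT_comp.
- by apply: filterS fg => t fg Dt; rewrite /= fg.
Qed.

Lemma Rintegral_ae f g : measurable_fun D f ->
  measurable_fun D g -> ae_eq mu D f g ->
  \int[mu]_(t in D) f t = \int[mu]_(t in D) g t.
Proof.
move=> mf mg fg; congr fine; apply: ae_eq_integral => //.
- exact/measurable_EFinP.
- exact/measurable_EFinP.
- by apply: filterS fg => t fg Dt; rewrite fg.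
Qed.

Lemma Rintegral_ge0_eq0 f :
  rint D f -> (forall t, D t -> 0 <= f t) ->
  \int[mu]_(t in D) f t = 0 -> ae_eq mu D f (fun=> 0).
Proof.
move=> iF f0 I0.
have If0 : (\int[mu]_(t in D) `|(EFin \o f) t| = 0)%E.
  transitivity (\int[mu]_(t in D) (f t)%:E)%E.
    by apply: eq_integral => t /set_mem /f0 ft0; rewrite /= ger0_norm.
  by rewrite -[LHS]fineK ?integrable_fin_num// -[fine _]/(Rintegral _ _ _) I0.
have [+ _] := ae_eq_integral_abs mu mD (measurable_int _ iF).
by move=> /(_ If0); apply: filterS => t h Dt; have /= := h Dt; case.
Qed.

End Integrable.

Lemma rint01_cst (c : R) : rint I01 (fun=> c).
Proof.
apply: measurable_bounded_integrable => //.
  by rewrite [X in (X < _)%E]mu_I01 ltry.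
by exists `|c|; split; [exact: num_real|move=> x cx y _; exact: ltW].
Qed.

(** The product is dominated by f^2 + g^2. *)
Lemma sqint_mul f g : sqint f -> sqint g -> rint I01 (fun t => f t * g t).
Proof.
move=> [mf if2] [mg ig2].
apply: (rint_le measurable_I01 _ _ (rintD measurable_I01 if2 ig2)).
  exact: measurable_funM.
move=> t _; rewrite normrM.
rewrite -(real_normK (num_real (f t))) -(real_normK (num_real (g t))).
have := normr_ge0 (f t); have := normr_ge0 (g t); nra.
Qed.

Lemma sqint_measurable f : sqint f -> measurable_fun I01 f.
Proof. by case. Qed.

Lemma sqint_cst c : sqint (fun=> c : R).
Proof. by split; [exact: measurable_cst|exact: rint01_cst]. Qed.

Lemma sqint_integrable f : sqint f -> rint I01 f.
Proof.
move=> sf; apply: (rint_eq measurable_I01 _ (sqint_mul sf (sqint_cst 1))) => t _.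
by rewrite mulr1.
Qed.

Lemma sqintZ c f : sqint f -> sqint (fun t => c * f t).
Proof.
move=> sf; split; first by apply: measurable_funM => //; case: sf.
apply: (rint_eq measurable_I01 _
  (rintZ measurable_I01 (c ^+ 2) (sqint_mul sf sf))) => t _.
by ring.
Qed.

Lemma sqintD f g : sqint f -> sqint g -> sqint (fun t => f t + g t).
Proof.
move=> sf sg; split; first by apply: measurable_funD; [case: sf|case: sg].
have fg := sqint_mul sf sg.
have ff := sqint_mul sf sf; have gg := sqint_mul sg sg.
have h := rintD measurable_I01
  (rintD measurable_I01 ff gg) (rintD measurable_I01 fg fg).
by apply: (rint_eq measurable_I01 _ h) => t _; ring.
Qed.

Lemma sqintN f : sqint f -> sqint (fun t => - f t).
Proof. by move/(sqintZ (-1)); under eq_fun do rewrite mulN1r. Qed.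

Lemma sqintB f g : sqint f -> sqint g -> sqint (fun t => f t - g t).
Proof. by move=> sf sg; apply: sqintD => //; apply: sqintN. Qed.

Lemma sqint_sum (I : Type) (s : seq I) (h : I -> R -> R) :
  (forall i, sqint (h i)) -> sqint (fun t => \sum_(i <- s) h i t).
Proof.
move=> sh; elim: s => [|i s IH].
  by under eq_fun do rewrite big_nil; exact: sqint_cst.
by under eq_fun do rewrite big_cons; exact: sqintD.
Qed.

Lemma sqint_norm f : sqint f -> sqint (fun t => `|f t|).
Proof.
move=> [mf sf]; split; first exact: measurableT_comp.
by apply: (rint_eq measurable_I01 _ sf) => t _; rewrite real_normK ?num_real.
Qed.

Lemma sqint_le f g : measurable_fun I01 f -> sqint g ->
  (forall t, I01 t -> `|f t| <= `|g t|) -> sqint f.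
Proof.
move=> mf [mg sg] fg; split => //.
apply: (rint_le measurable_I01 _ _ sg) => //; first exact: measurable_funX.
move=> t t01; rewrite normrX -(real_normK (num_real (g t))).
by rewrite lerXn2r ?nnegrE// fg.
Qed.

End SquareIntegrable.
#[export] Hint Extern 0 (measurable _) => solve [exact: measurable_I01] : core.

Section DotProduct.
Set Implicit Arguments.
Unset Strict Implicit.
Context {R : realType} {k : nat}.
Implicit Types x y z : 'rV[R]_k.

Lemma dotC x y : dot x y = dot y x.
Proof. by apply: eq_bigr => i _; rewrite mulrC. Qed.

Lemma dotDl x y z : dot (x + y) z = dot x z + dot y z.
Proof. by rewrite -big_split; apply: eq_bigr => i _; rewrite mxE mulrDl. Qed.

Lemma dotZl (a : R) x y : dot (a *: x) y = a * dot x y.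
Proof. by rewrite mulr_sumr; apply: eq_bigr => i _; rewrite mxE mulrA. Qed.

Lemma dotNl x y : dot (- x) y = - dot x y.
Proof. by rewrite -scaleN1r dotZl mulN1r. Qed.

Lemma dotDr x y z : dot x (y + z) = dot x y + dot x z.
Proof. by rewrite dotC dotDl !(dotC x). Qed.

Lemma dotZr (a : R) x y : dot x (a *: y) = a * dot x y.
Proof. by rewrite dotC dotZl dotC. Qed.

Lemma dot0l x : dot 0 x = 0.
Proof. by rewrite /dot big1// => i _; rewrite mxE mul0r. Qed.

Lemma dot0r x : dot x 0 = 0.
Proof. by rewrite dotC dot0l. Qed.

Lemma dot_suml (I : Type) (s : seq I) (P : pred I) (F : I -> 'rV[R]_k) y :
  dot (\sum_(i <- s | P i) F i) y = \sum_(i <- s | P i) dot (F i) y.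
Proof.
elim/big_ind2: _ => [|a b c d <- <-|//]; last by rewrite dotDl.
by rewrite dot0l.
Qed.

Lemma dot_ge0 x : 0 <= dot x x.
Proof. by apply: sumr_ge0 => i _; rewrite -expr2 sqr_ge0. Qed.

Lemma dot_eq0 x : dot x x = 0 -> x = 0.
Proof.
move/eqP; rewrite psumr_eq0 => [/allP x0|i _]; last by rewrite -expr2 sqr_ge0.
apply/rowP => i; have := x0 i (mem_index_enum _).
by rewrite mulf_eq0 orbb mxE => /eqP.
Qed.

Lemma dot_delta x i : dot x (delta_mx 0 i) = x 0 i.
Proof.
rewrite /dot (bigD1 i)//= mxE !eqxx mulr1 big1 ?addr0// => j /negPf ji.
by rewrite mxE ji andbF mulr0.
Qed.

End DotProduct.

(** * The inner product of L^2 and the Cauchy-Schwarz inequality *)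

Section InnerProduct.
Set Implicit Arguments.
Unset Strict Implicit.
Context {R : realType} {k : nat}.
Notation mu := (@lebesgue_measure R).
Notation rint D f := (mu.-integrable D (EFin \o (f : R -> R))).
Implicit Types u v w : R -> 'rV[R]_k.

Lemma L2_lin (a : R) u v : L2 u -> L2 v -> L2 (a *: u + v).
Proof.
move=> Lu Lv i; have := sqintD (sqintZ a (Lu i)) (Lv i).
by congr sqint; apply/funext => t; rewrite !mxE.
Qed.

Lemma L2_0 : L2 (0 : R -> 'rV[R]_k).
Proof.
by move=> i; have := @sqint_cst R 0; congr sqint; apply/funext => t; rewrite mxE.
Qed.

Lemma L2D u v : L2 u -> L2 v -> L2 (u + v).
Proof. by move=> Lu Lv; rewrite -[u]scale1r; apply: L2_lin. Qed.

Lemma L2Z (a : R) u : L2 u -> L2 (a *: u).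
Proof. by move=> Lu; rewrite -[_ *: _]addr0; apply: L2_lin => //; apply: L2_0. Qed.

Lemma L2N u : L2 u -> L2 (- u).
Proof. by move=> Lu; rewrite -scaleN1r; apply: L2Z. Qed.

Lemma L2B u v : L2 u -> L2 v -> L2 (u - v).
Proof. by move=> Lu Lv; apply: L2D => //; apply: L2N. Qed.

Lemma L2_sum (I : Type) (s : seq I) (F : I -> R -> 'rV[R]_k) :
  (forall i, L2 (F i)) -> L2 (\sum_(i <- s) F i).
Proof.
by move=> LF; elim/big_ind: _ => //; [exact: L2_0|exact: L2D].
Qed.

Lemma rint_dot u v : L2 u -> L2 v -> rint I01 (fun t => dot (u t) (v t)).
Proof.
by move=> Lu Lv; apply: rint_sum => // i; apply: sqint_mul; [exact: Lu|exact: Lv].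
Qed.

Lemma ipC u v : ip u v = ip v u.
Proof. by apply: eq_Rintegral => t _; rewrite dotC. Qed.

Lemma ip_linl (a : R) u v w : L2 u -> L2 v -> L2 w ->
  ip (a *: u + v) w = a * ip u w + ip v w.
Proof.
move=> Lu Lv Lw; rewrite /ip -RintegralZ//; last exact: rint_dot.
have uw := rint_dot Lu Lw; have vw := rint_dot Lv Lw.
have auw := rintZ measurable_I01 a uw.
rewrite -RintegralD//.
by apply: eq_Rintegral => t _; rewrite -dotZl -dotDl.
Qed.

Lemma ip0l w : ip 0 w = 0.
Proof.
transitivity (\int[mu]_(t in @I01 R) (0 : R)).
  by apply: eq_Rintegral => t _; rewrite dot0l.
by rewrite Rintegral_cst ?mul0r//.
Qed.

Lemma ipDl u v w : L2 u -> L2 v -> L2 w -> ip (u + v) w = ip u w + ip v w.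
Proof. by move=> ? ? ?; rewrite -[u in LHS]scale1r ip_linl// mul1r. Qed.

Lemma ipZl (a : R) u w : L2 u -> L2 w -> ip (a *: u) w = a * ip u w.
Proof.
move=> ? ?; rewrite -[_ *: _]addr0 ip_linl// ?ip0l ?addr0//; exact: L2_0.
Qed.

Lemma ipNl u w : L2 u -> L2 w -> ip (- u) w = - ip u w.
Proof. by move=> ? ?; rewrite -scaleN1r ipZl// mulN1r. Qed.

Lemma ipBl u v w : L2 u -> L2 v -> L2 w -> ip (u - v) w = ip u w - ip v w.
Proof. by move=> ? Lv ?; rewrite ipDl ?ipNl//; exact: L2N. Qed.

Lemma ip_suml (I : Type) (s : seq I) (F : I -> R -> 'rV[R]_k) w :
  (forall i, L2 (F i)) -> L2 w ->
  ip (\sum_(i <- s) F i) w = \sum_(i <- s) ip (F i) w.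
Proof.
move=> LF Lw; elim: s => [|i s IH]; first by rewrite !big_nil ip0l.
by rewrite !big_cons ipDl ?IH//; exact: L2_sum.
Qed.

Lemma ip0r w : ip w 0 = 0. Proof. by rewrite ipC ip0l. Qed.

Lemma ipDr u v w : L2 u -> L2 v -> L2 w -> ip w (u + v) = ip w u + ip w v.
Proof. by move=> ? ? ?; rewrite ipC ipDl// !(ipC w). Qed.

Lemma ipZr (a : R) u w : L2 u -> L2 w -> ip w (a *: u) = a * ip w u.
Proof. by move=> ? ?; rewrite ipC ipZl// ipC. Qed.

Lemma ipBr u v w : L2 u -> L2 v -> L2 w -> ip w (u - v) = ip w u - ip w v.
Proof. by move=> ? Lv ?; rewrite ipC ipBl// !(ipC w). Qed.

Lemma ip_sumr (I : Type) (s : seq I) (F : I -> R -> 'rV[R]_k) w :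
  (forall i, L2 (F i)) -> L2 w ->
  ip w (\sum_(i <- s) F i) = \sum_(i <- s) ip w (F i).
Proof.
by move=> LF Lw; rewrite ipC ip_suml//; apply: eq_bigr => i _; rewrite ipC.
Qed.

Lemma ip_ge0 u : 0 <= ip u u.
Proof. by apply: Rintegral_ge0 => t _; apply: dot_ge0. Qed.

Lemma ip_eq0 u : L2 u -> ip u u = 0 -> ae_eq mu I01 u 0.
Proof.
move=> Lu u0; have := Rintegral_ge0_eq0 measurable_I01 (rint_dot Lu Lu) _ u0.
move=> /(_ (fun t _ => dot_ge0 (u t))); apply: filterS => t u0t /u0t.
exact: dot_eq0.
Qed.

Lemma measurable_dot (D : set R) u v : measurable D ->
  (forall i, measurable_fun D (fun t => u t 0 i)) ->
  (forall i, measurable_fun D (fun t => v t 0 i)) ->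
  measurable_fun D (fun t => dot (u t) (v t)).
Proof.
by move=> mD mf mg; apply: measurable_sum => i; apply: measurable_funM.
Qed.

Lemma L2_measurable u i : L2 u -> measurable_fun I01 (fun t => u t 0 i).
Proof. by move=> /(_ i) /sqint_measurable. Qed.

Lemma ip_ael u v w : L2 u -> L2 v -> L2 w -> ae_eq mu I01 u v -> ip u w = ip v w.
Proof.
move=> Lu Lv Lw uv; apply: Rintegral_ae => //.
- by apply: measurable_dot => // i; exact: L2_measurable.
- by apply: measurable_dot => // i; exact: L2_measurable.
- by apply: filterS uv => t uv /uv ->.
Qed.

Lemma ip_aer u v w : L2 u -> L2 v -> L2 w -> ae_eq mu I01 u v -> ip w u = ip w v.
Proof. by move=> Lu Lv Lw uv; rewrite !(ipC w) (ip_ael Lu Lv Lw uv). Qed.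

Lemma ip_quad (s : R) u v : L2 u -> L2 v ->
  ip (u - s *: v) (u - s *: v) = ip u u - 2 * s * ip u v + s ^+ 2 * ip v v.
Proof.
move=> Lu Lv; have Lsv := L2Z s Lv; have L := L2B Lu Lsv.
rewrite ipBl// !ipBr// !ipZl// !ipZr// (ipC v u); ring.
Qed.

Lemma ip_CS u v : L2 u -> L2 v -> ip u v ^+ 2 <= ip u u * ip v v.
Proof.
move=> Lu Lv.
have H s : 0 <= ip u u - 2 * s * ip u v + s ^+ 2 * ip v v.
  by rewrite -ip_quad// ip_ge0.
have [v0|v0] := eqVneq (ip v v) 0.
  rewrite v0 mulr0.
  have -> : ip u v = 0; last by rewrite expr0n.
  (* A [v] of zero norm need not be 0; it is null almost everywhere, which is enough. *)
  by rewrite (ip_aer Lv L2_0 Lu) ?ip0r//; apply: ip_eq0.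
have vp : 0 < ip v v by rewrite lt_neqAle eq_sym v0 ip_ge0.
(* The value of [s] that minimizes the quadratic polynomial of [H]. *)
have := H (ip u v / ip v v).
rewrite -(ler_pM2r vp) mul0r.
suff -> : (ip u u - 2 * (ip u v / ip v v) * ip u v +
    (ip u v / ip v v) ^+ 2 * ip v v) * ip v v = ip u u * ip v v - ip u v ^+ 2.
  by rewrite subr_ge0.
by field.
Qed.

Lemma normL2_ge0 u : 0 <= normL2 u.
Proof. exact: sqrtr_ge0. Qed.

Lemma normL2_sqr u : normL2 u ^+ 2 = ip u u.
Proof. by rewrite sqr_sqrtr// ip_ge0. Qed.

Lemma ip_le u v : L2 u -> L2 v -> `|ip u v| <= normL2 u * normL2 v.
Proof.
move=> Lu Lv; rewrite -(@ler_pXn2r _ 2) ?nnegrE ?mulr_ge0 ?normL2_ge0//.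
by rewrite real_normK ?num_real// exprMn !normL2_sqr ip_CS.
Qed.

Lemma normL2_le u (C : R) : 0 <= C -> ip u u <= C ^+ 2 -> normL2 u <= C.
Proof.
move=> C0 uC; rewrite -(@ler_pXn2r _ 2) ?nnegrE ?normL2_ge0//.
by rewrite normL2_sqr.
Qed.

Lemma ip_coord u v : L2 u -> L2 v ->
  ip u v = \sum_i \int[mu]_(t in I01) (u t 0 i * v t 0 i).
Proof.
move=> Lu Lv; rewrite /ip /dot Rintegral_sum// => i.
exact: sqint_mul (Lu i) (Lv i).
Qed.

End InnerProduct.

(** * Completeness and orthogonal projection *)

Section Completeness.
Set Implicit Arguments.
Unset Strict Implicit.
Context {R : realType}.
Notation mu := (@lebesgue_measure R).
Notation rint D f := (mu.-integrable D (EFin \o (f : R -> R))).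

Lemma rint_EFin (D : set R) (f : R -> R) : measurable D -> rint D f ->
  (\int[mu]_(t in D) (f t)%:E)%E = (\int[mu]_(t in D) f t)%:E.
Proof. by move=> mD iF; rewrite fineK// integrable_fin_num. Qed.

Lemma sum_half n : \sum_(i < n) (2^-1 : R) ^+ i <= 2.
Proof.
suff -> : \sum_(i < n) (2^-1 : R) ^+ i = 2 - 2 * 2^-1 ^+ n.
  by rewrite gerBl mulr_ge0// exprn_ge0.
elim: n => [|n IH]; first by rewrite big_ord0 expr0 mulr1 subrr.
by rewrite big_ord_recr/= IH exprS; field.
Qed.

(* The increments are summable in L^1, hence the sequence converges almost
   everywhere; Fatou's lemma then bounds the distance to the limit. *)
Lemma sqint_complete (c : R) (f : nat -> R -> R) : 0 < c ->
  (forall n, sqint (f n)) ->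
  (forall n m, (n <= m)%N ->
    \int[mu]_(t in I01) ((f m t - f n t) ^+ 2) <= (c * 2^-1 ^+ n) ^+ 2) ->
  exists2 g, sqint g &
    forall n, \int[mu]_(t in I01) ((g t - f n t) ^+ 2) <= (c * 2^-1 ^+ n) ^+ 2.
Proof.
move=> c0 sf cf.
pose d n t := f n.+1 t - f n t.
have sd n : sqint (d n) by apply: sqintB.
have s0 n : 0 < c * 2^-1 ^+ n by rewrite mulr_gt0// exprn_gt0// invr_gt0.
(* The L^1 norm is bounded by the L^2 bound s through x <= x^2 / (2 s) + s / 2, as [0, 1] has
   measure 1. *)
have Hd n : (\int[mu]_(t in I01) `|d n t|%:E <= (c * 2^-1 ^+ n)%:E)%E.
  set s := c * _; have s_gt0 : 0 < s by exact: s0.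
  have id1 := rint_norm (sqint_integrable (sd n)).
  have id2 := rintZ measurable_I01 ((2 * s)^-1) (sd n).2.
  have ic := rint01_cst (s / 2).
  rewrite rint_EFin// lee_fin.
  apply: (@le_trans _ _ (\int[mu]_(t in I01) ((2 * s)^-1 * d n t ^+ 2 + s / 2))).
    apply: le_Rintegral => //; first exact: rintD.
    move=> t _; rewrite -(real_normK (num_real (d n t))).
    set x := `|_|; rewrite -subr_ge0.
    have -> : (2 * s)^-1 * x ^+ 2 + s / 2 - x = (2 * s)^-1 * (x - s) ^+ 2.
      by field; rewrite gt_eqF.
    by rewrite mulr_ge0 ?sqr_ge0// invr_ge0 mulr_ge0// ltW.
  have iZ := RintegralZ measurable_I01 ((2 * s)^-1) (sd n).2.
  rewrite RintegralD// iZ.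
  rewrite Rintegral_cst// [X in fine X]mu_I01 mulr1.
  apply: (@le_trans _ _ ((2 * s)^-1 * s ^+ 2 + s / 2)).
    rewrite lerD2r ler_pM2l ?invr_gt0 ?mulr_gt0//; exact: cf.
  by rewrite le_eqVlt; apply/orP; left; apply/eqP; field; rewrite gt_eqF.
have md n : measurable_fun I01 (fun t => `|d n t|%:E).
  by apply/measurable_EFinP; apply: measurableT_comp => //; case: (sd n).
have Sd : (\int[mu]_(t in I01) (\sum_(n <oo) `|d n t|%:E) < +oo)%E.
  rewrite integral_nneseries//.
  apply: (@le_lt_trans _ _ (c * 2)%:E); last exact: ltry.
  apply: lime_le.
    by apply: is_cvg_nneseries => n _ _; apply: integral_ge0.
  near=> n; apply: (@le_trans _ _ (\sum_(0 <= i < n) (c * 2^-1 ^+ i)%:E)%E).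
    exact: lee_sum.
  rewrite sumEFin lee_fin big_mkord -mulr_sumr ler_pM2l//.
  exact: sum_half.
have ae : {ae mu, forall t, I01 t -> cvgn (fun n => f n t)}.
  have iS : mu.-integrable I01 (fun t => \sum_(n <oo) `|d n t|%:E)%E.
    apply/integrableP; split.
      have md' k : xpredT k -> measurable_fun I01 (fun t => `|d k t|%:E) by [].
      have d0 (k : nat) t : I01 t -> xpredT k -> (0 <= `|d k t|%:E)%E by [].
      exact: (ge0_emeasurable_sum d0 md').
    apply: le_lt_trans Sd; rewrite le_eqVlt; apply/orP; left; apply/eqP.
    by apply: eq_integral => t _; rewrite gee0_abs//; apply: nneseries_ge0.
  have := @integrable_ae _ _ _ mu I01 measurable_I01 _ iS.
  apply: ae_imply => t t01 fint.
  have cs : cvgn (series (d ^~ t)).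
    apply: normed_cvg; apply: nondecreasing_is_cvgn.
      by move=> m n mn; rewrite [leRHS](@big_cat_nat _ _ _ m)//= lerDl sumr_ge0.
    exists (fine (\sum_(n <oo) `|d n t|%:E)%E) => _ [n _ <-].
    rewrite -lee_fin fineK//= /series/= -sumEFin.
    exact: nneseries_lim_ge.
  have -> : (fun n => f n t) = (fun n => f 0%N t + series (d ^~ t) n).
    apply/funext => n; rewrite /series/= /d (@telescope_sumr _ 0%N n (f ^~ t))//.
    by rewrite addrC subrK.
  by apply: is_cvgD => //; exact: is_cvg_cst.
(* The upper limit is defined and measurable everywhere and is the limit wherever the sequence
   converges; [fine] makes it real elsewhere. *)
pose g t := fine (limn_esup (fun n => (f n t)%:E)).
have mg : measurable_fun I01 g.
  apply: (measurableT_comp _) => //.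
  by apply: measurable_fun_limn_esup => n; apply/measurable_EFinP; case: (sf n).
have gcv : {ae mu, forall t, I01 t -> (fun n => f n t) @ \oo --> g t}.
  move: ae; apply: ae_imply => t t01 cvt.
  rewrite /g; have /cvg_limn_einf_sup[_ ->] : (fun n => (f n t)%:E) @ \oo -->
      (limn (fun n => f n t))%:E by apply: cvg_EFin => //; exact: nearW.
  exact: cvt.
have Fat n : (\int[mu]_(t in I01) ((g t - f n t) ^+ 2)%:E <=
    ((c * 2^-1 ^+ n) ^+ 2)%:E)%E.
  (* Indices are shifted by n, so that every term given to Fatou's lemma obeys the bound of index
     n. *)
  pose h m t := ((f (n + m)%N t - f n t) ^+ 2)%:E.
  have mh m : measurable_fun I01 (h m).
    apply/measurable_EFinP; apply: measurable_funX.
    by apply: measurable_funB; [case: (sf (n + m)%N)|case: (sf n)].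
  have -> : (\int[mu]_(t in I01) ((g t - f n t) ^+ 2)%:E =
      \int[mu]_(t in I01) limn_einf (h ^~ t))%E.
    apply: ae_eq_integral => //.
    - apply/measurable_EFinP; apply: measurable_funX.
      by apply: measurable_funB => //; case: (sf n).
    - have mNh : measurable_fun I01 (fun t => limn_esup (fun m => - h m t)%E).
        by apply: measurable_fun_limn_esup => m; apply: measurableT_comp (mh m).
      exact: measurableT_comp mNh.
    - move: gcv; apply: ae_imply => t t01 cvt.
      suff /cvg_limn_einf_sup[-> _] :
        h ^~ t @ \oo --> ((g t - f n t) ^+ 2)%:E by [].
      apply: cvg_EFin; first exact: nearW.
      have {}cvt : (fun m => f (n + m)%N t) @ \oo --> g t.
        exact: cvg_comp (cvg_addnl n) cvt.
      have cvb : (fun m => f (n + m)%N t - f n t) @ \oo --> g t - f n t.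
        by apply: cvgB => //; exact: cvg_cst.
      exact: (cvgM cvb cvb).
  have h0 m t : I01 t -> (0 <= h m t)%E by rewrite lee_fin sqr_ge0.
  apply: (le_trans (@fatou _ _ _ mu I01 measurable_I01 h mh h0)).
  rewrite limn_einf_lim; apply: lime_le; first exact: is_cvg_einfs.
  near=> m.
  apply: (@le_trans _ _ (\int[mu]_(t in I01) h m t)%E).
    by apply: ereal_inf_lbound; exists m => //=.
  rewrite rint_EFin ?lee_fin//; first by apply: cf; rewrite leq_addr.
  exact: (sqintB (sf (n + m)%N) (sf n)).2.
have sgf n : sqint (fun t => g t - f n t).
  split; first by apply: measurable_funB => //; case: (sf n).
  apply/integrableP; split.
    apply/measurable_EFinP; apply: measurable_funX.
    by apply: measurable_funB => //; case: (sf n).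
  apply: le_lt_trans (ltry ((c * 2^-1 ^+ n) ^+ 2)).
  apply: le_trans (Fat n).
  rewrite le_eqVlt; apply/orP; left; apply/eqP; apply: eq_integral => t _.
  by rewrite gee0_abs// lee_fin sqr_ge0.
exists g.
  have := sqintD (sgf 0%N) (sf 0%N).
  by under eq_fun do rewrite subrK.
move=> n; rewrite -lee_fin -rint_EFin//; exact: (sgf n).2.
Unshelve. all: by end_near. Qed.

End Completeness.

Section Projection.
Set Implicit Arguments.
Unset Strict Implicit.
Context {R : realType} {k : nat}.
Notation mu := (@lebesgue_measure R).
Notation rint D f := (mu.-integrable D (EFin \o (f : R -> R))).
Implicit Types u v w : R -> 'rV[R]_k.

Lemma cst_cvg0_eq0 (x : R) (e : nat -> R) :
  (forall n, `|x| <= e n) -> e @ \oo --> (0 : R) -> x = 0.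
Proof.
move=> xe e0; apply/eqP; rewrite -normr_le0.
have : (fun _ : nat => `|x|) @ \oo --> `|x| by exact: cvg_cst.
by move=> /ler_cvg_to/(_ e0); apply; exact: nearW.
Qed.

Lemma cvg0_half (C : R) : (fun n => C * 2^-1 ^+ n) @ \oo --> (0 : R).
Proof.
rewrite -[X in _ --> X](mulr0 C); apply: cvgM; first exact: cvg_cst.
by apply: cvg_expr; rewrite ger0_norm ?invr_ge0// invf_lt1// ltr1n.
Qed.

Lemma L2_complete (c : R) (w : nat -> R -> 'rV[R]_k) : 0 < c ->
  (forall n, L2 (w n)) ->
  (forall n m, (n <= m)%N -> ip (w m - w n) (w m - w n) <= (c * 2^-1 ^+ n) ^+ 2) ->
  exists2 u, L2 u & (fun n => normL2 (w n - u)) @ \oo --> (0 : R).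
Proof.
move=> c0 Lw cw.
have coord i n m : (n <= m)%N ->
    \int[mu]_(t in I01) ((w m t 0 i - w n t 0 i) ^+ 2) <= (c * 2^-1 ^+ n) ^+ 2.
  move=> nm; apply: le_trans (cw _ _ nm).
  rewrite ip_coord; [|exact: L2B..].
  rewrite (bigD1 i)//= -[leLHS]addr0; apply: lerD.
    by rewrite le_eqVlt; apply/orP; left; apply/eqP; apply: eq_Rintegral => t _;
      rewrite !mxE expr2.
  apply: sumr_ge0 => j _; apply: Rintegral_ge0 => t _; rewrite -expr2; exact: sqr_ge0.
have /choice[g gP] : forall i, exists g, sqint g /\ forall n,
    \int[mu]_(t in I01) ((g t - w n t 0 i) ^+ 2) <= (c * 2^-1 ^+ n) ^+ 2.
  move=> i; have [g sg gP] := sqint_complete c0 (fun n => Lw n i) (coord i).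
  by exists g.
have Lg : L2 (fun t => \row_i g i t).
  move=> i; have [+ _] := gP i; congr sqint; apply/funext => t.
  by rewrite mxE.
exists (fun t => \row_i g i t) => //.
(* The k coordinates contribute k times the square of the bound, and k <= k^2 turns this into the
   square of k times the bound. *)
have kc n : normL2 (w n - (fun t => \row_i g i t)) <= k%:R * c * 2^-1 ^+ n.
  apply: normL2_le; first by rewrite !mulr_ge0// ?exprn_ge0 ?invr_ge0// ltW.
  rewrite ip_coord; [|exact: L2B..].
  apply: (@le_trans _ _ (\sum_(i < k) (c * 2^-1 ^+ n) ^+ 2)).
    apply: ler_sum => i _; apply: le_trans (proj2 (gP i) n).
    rewrite le_eqVlt; apply/orP; left; apply/eqP; apply: eq_Rintegral => t _.
    by rewrite !mxE; ring.
  rewrite sumr_const card_ord -[leLHS]mulr_natl -mulrA [leRHS]exprMn.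
  rewrite ler_wpM2r ?sqr_ge0// -natrX ler_nat.
  by case: (k) => // k'; rewrite -[leqLHS]expn1 leq_pexp2l.
apply: (@squeeze_cvgr _ _ _ _ (fun=> 0) (fun n => k%:R * c * 2^-1 ^+ n)).
- by apply: nearW => n; rewrite normL2_ge0 kc.
- exact: cvg_cst.
- exact: cvg0_half.
Qed.

Section Subspace.
Variable V : set (R -> 'rV[R]_k).
Hypotheses (VL2 : V `<=` L2) (V0 : V 0)
  (Vlin : forall (a : R) u v, V u -> V v -> V (a *: u + v))
  (Vclosed : forall (w : nat -> R -> 'rV[R]_k) u, (forall m, V (w m)) -> L2 u ->
    (fun m => normL2 (w m - u)) @ \oo --> (0 : R) -> V u).

Lemma subspaceZ (a : R) u : V u -> V (a *: u).
Proof. by move=> Vu; rewrite -[_ *: _]addr0; apply: Vlin. Qed.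

Lemma subspaceD u v : V u -> V v -> V (u + v).
Proof. by move=> Vu; rewrite -[u in V (u + _)]scale1r; apply: Vlin. Qed.

Lemma subspace_sum (I : Type) (s : seq I) (F : I -> R -> 'rV[R]_k) :
  (forall i, V (F i)) -> V (\sum_(i <- s) F i).
Proof. by move=> VF; elim/big_ind: _ => //; exact: subspaceD. Qed.

Lemma subspace_ae u v : V u -> L2 v -> ae_eq mu I01 u v -> V v.
Proof.
move=> Vu Lv uv; apply: (@Vclosed (fun=> u)) => //.
suff -> : normL2 (u - v) = 0 by exact: cvg_cst.
have Luv := L2B (VL2 Vu) Lv.
rewrite /normL2 (ip_ael Luv (@L2_0 R k) Luv) ?ip0l ?sqrtr0//.
by apply: ae_imply uv => t _ uvt; rewrite -[LHS]/(u t - v t) uvt subrr.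
Qed.

(** A minimizing sequence converges fast enough for [L2_complete] once its n-th error is 4^-n. It is
    stated for closed subspaces in general, to serve for V and for the kernel of a functional in
    [Riesz]. *)
Lemma projection w : L2 w -> exists2 p, V p & forall v, V v -> ip (w - p) v = 0.
Proof.
move=> Lw; pose S := [set ip (w - v) (w - v) | v in V].
have lS : lbound S 0 by move=> _ [v _ <-]; exact: ip_ge0.
have hS : has_inf S by split; [exists (ip (w - 0) (w - 0)), 0|exists 0].
pose d := inf S; pose e n : R := (2^-1 ^+ n) ^+ 2.
have e0 n : 0 < e n by rewrite exprn_gt0// exprn_gt0// invr_gt0.
have dle v : V v -> d <= ip (w - v) (w - v).
  by move=> Vv; apply: ge_inf; [exists 0|exists v].
have /choice[x xP] : forall n, exists v, V v /\ ip (w - v) (w - v) < d + e n.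
  by move=> n; have [_ [v Vv <-] vd] := inf_adherent (e0 n) hS; exists v.
have Vx n : V (x n) by have [] := xP n.
have Lx n : L2 (x n) := VL2 (Vx n).
have Lwx n : L2 (w - x n) by exact: L2B.
(* Parallelogram law, from [ip_quad] at 1 and - 1: the midpoint of x_n and x_m is in V, at squared
   distance at least d from w, so |x_m - x_n|^2 <= 2 (e_n + e_m) <= 4 e_n. *)
have cx n m : (n <= m)%N ->
    ip (x m - x n) (x m - x n) <= (2 * 2^-1 ^+ n) ^+ 2.
  move=> nm.
  have -> : x m - x n = (w - x n) - 1 *: (w - x m).
    by rewrite scale1r opprB [RHS]addrC addrA subrK.
  rewrite ip_quad//.
  have Vmid : V (2^-1 *: (x n + x m)) by apply: subspaceZ; exact: subspaceD.
  have := dle _ Vmid.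
  have -> : w - 2^-1 *: (x n + x m) = 2^-1 *: ((w - x n) - (- 1) *: (w - x m)).
    by apply/funext => t; apply/rowP => i; rewrite !mxE; field.
  have Ls : L2 (w - x n - -1 *: (w - x m)) by apply: L2B => //; apply: L2Z.
  rewrite ipZl// ?ipZr//; last exact: L2Z.
  rewrite ip_quad//.
  have [_ dn] := xP n; have [_ dm] := xP m.
  have emn : e m <= e n.
    by rewrite /e -!exprM ler_wiXn2l// ?invr_ge0// ?invf_le1// ?ler1n// leq_mul2r nm orbT.
  rewrite exprMn -/(e n); move: dn dm.
  set a := ip (w - x n) _; set b := ip (w - x m) _; set ab := ip (w - x n) _.
  move: emn; lra.
have [p Lp xp] := L2_complete (ltr0n R 2) Lx cx.
exists p; first exact: (@Vclosed x).
move=> v Vv; have Lv := VL2 Vv.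
pose N := ip v v; have N0 : 0 <= N by exact: ip_ge0.
(* Near-orthogonality of x_n: moving it by s v with s = <w - x_n, v> / (N + 1) cannot bring the
   squared distance below d. The denominator N + 1 in place of N avoids the case of a null v. *)
have bn n : `|ip (w - x n) v| <= (N + 1) * 2^-1 ^+ n.
  have N1 : 0 < N + 1 by lra.
  rewrite -(@ler_pXn2r _ 2) ?nnegrE// ?mulr_ge0 ?exprn_ge0 ?invr_ge0 ?(ltW N1)//.
  rewrite real_normK ?num_real// exprMn -/(e n).
  set b := ip _ v; pose s := b / (N + 1).
  have Vs : V (x n + s *: v) by rewrite addrC; exact: Vlin.
  have := dle _ Vs; rewrite opprD addrA ip_quad// -/N -/b.
  have [_ dn] := xP n => ds.
  have es : 0 <= e n - 2 * s * b + s ^+ 2 * N by move: ds dn; lra.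
  have sb : b = s * (N + 1) by rewrite /s divfK// gt_eqF.
  have s2N := mulr_ge0 (sqr_ge0 s) N0; have s2 := sqr_ge0 s.
  rewrite sb exprMn mulrC ler_wpM2l ?sqr_ge0//.
  by move: es; rewrite sb; move: s2N s2; lra.
apply: (@cst_cvg0_eq0 _
  (fun n => (N + 1) * 2^-1 ^+ n + normL2 (x n - p) * normL2 v)).
  move=> n; have -> : w - p = (w - x n) + (x n - p) by rewrite addrA subrK.
  rewrite ipDl//; last exact: L2B.
  apply: le_trans (ler_normD _ _) _; apply: lerD => //.
  by apply: ip_le => //; exact: L2B.
rewrite -[X in _ --> X]addr0 -[X in _ --> _ + X](mul0r (normL2 v)).
apply: cvgD; first exact: cvg0_half.
by apply: cvgM => //; exact: cvg_cst.
Qed.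

End Subspace.

(** The component z of some u0 with f u0 <> 0 orthogonal to the kernel of f represents f up to a
    factor, because u - (f u / f u0) z lies in that kernel. *)
Lemma Riesz (f : (R -> 'rV[R]_k) -> R) (C : R) :
  (forall (a : R) u v, L2 u -> L2 v -> f (a *: u + v) = a * f u + f v) ->
  (forall u, L2 u -> `|f u| <= C * normL2 u) ->
  exists2 z, L2 z & forall u, L2 u -> f u = ip z u.
Proof.
move=> flin fC.
have fD u v : L2 u -> L2 v -> f (u + v) = f u + f v.
  by move=> Lu Lv; rewrite -[u in LHS]scale1r flin// mul1r.
have f0 : f 0 = 0.
  have := flin 1 0 0 (@L2_0 R k) (@L2_0 R k).
  by rewrite scaler0 addr0 mul1r; lra.
have fZ a u : L2 u -> f (a *: u) = a * f u.
  by move=> Lu; rewrite -[_ *: _]addr0 flin// ?f0 ?addr0//; exact: L2_0.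
have fB u v : L2 u -> L2 v -> f (u - v) = f u - f v.
  by move=> Lu Lv; rewrite addrC -scaleN1r flin// mulN1r addrC.
have [[u0 Lu0 fu0]|nf] := pselect (exists2 u, L2 u & f u != 0); last first.
  exists 0; first exact: L2_0.
  move=> u Lu; rewrite ip0l; apply: contrapT => fu.
  by apply: nf; exists u => //; apply/eqP.
pose V := [set u | L2 u /\ f u = 0].
have [||||p [Lp fp] pP] := @projection V _ _ _ _ u0 Lu0.
- by move=> u [].
- by split; [exact: L2_0|].
- move=> a u v [Lu fu] [Lv fv]; split; first exact: L2_lin.
  by rewrite flin// fu fv mulr0 addr0.
- move=> w u Vw Lu wu; split => //.
  apply: (@cst_cvg0_eq0 _ (fun m => C * normL2 (w m - u))).
    move=> m; have [Lw fw] := Vw m; apply: le_trans (fC _ (L2B Lw Lu)).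
    by rewrite fB// fw sub0r normrN.
  rewrite -[X in _ --> X](mulr0 C); apply: cvgM => //; exact: cvg_cst.
pose z := u0 - p; have Lz : L2 z by exact: L2B.
have fz : f z = f u0 by rewrite fB// fp subr0.
(* The bound on f forces f to vanish on null functions, whereas f z = f u0 is nonzero. *)
have zz : ip z z != 0.
  apply/eqP => zz0; have zae := ip_eq0 Lz zz0; move/eqP : fu0; apply.
  rewrite -fz; apply/eqP; rewrite -normr_le0; apply: le_trans (fC _ Lz) _.
  by rewrite /normL2 zz0 sqrtr0 mulr0.
exists ((f u0 / ip z z) *: z); first exact: L2Z.
move=> u Lu; pose s := f u / f u0.
have : V (u - s *: z).
  split; first by apply: L2B => //; exact: L2Z.
  by rewrite fB ?fZ ?fz ?divfK ?subrr//; exact: L2Z.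
move=> /pP; rewrite -/z ipBr ?ipZr//; last exact: L2Z.
move/eqP; rewrite subr_eq0 => /eqP zu.
rewrite ipZl// zu /s; field; exact/andP.
Qed.

End Projection.

(** * Volterra operators *)

Section IteratedIntegrals.
Set Implicit Arguments.
Unset Strict Implicit.
Context {R : realType}.
Notation mu := (@lebesgue_measure R).
Notation rint D f := (mu.-integrable D (EFin \o (f : R -> R))).
Implicit Types f g al be : R -> R.

Lemma Rintegral_subset (B D : set R) f : B `<=` D ->
  \int[mu]_(t in B) f t = \int[mu]_(t in D) (\1_B t * f t).
Proof.
move=> BD; rewrite Rintegral_mkcond [RHS]Rintegral_mkcond.
apply: eq_Rintegral => t _; rewrite /patch indicE.
case: ifPn => tB; case: ifPn => tD; rewrite ?mul1r ?mul0r//.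
by move/negP : tD; case; apply/mem_set; apply: BD; exact: set_mem.
Qed.

Lemma rint_subset (B D : set R) f : measurable B -> measurable D -> B `<=` D ->
  rint D f -> rint B f.
Proof. by move=> mB mD BD; apply: integrableS. Qed.

Lemma rint_indic (B D : set R) f : measurable B -> measurable D ->
  rint D f -> rint D (fun t => \1_B t * f t).
Proof.
move=> mB mD iF; apply: (rint_le mD _ _ (rint_norm iF)).
  by apply: measurable_funM; [exact: measurable_indic|exact: rint_meas iF].
move=> t Dt; rewrite normrM indicE; case: (_ \in _); rewrite ?normr1 ?mul1r//.
by rewrite normr0 mul0r.
Qed.

Lemma itv0_sub (t : R) : I01 t -> `[0, t]%classic `<=` I01.
Proof.
rewrite /I01 /= in_itv/= => /andP[_ t1] x /=; rewrite !in_itv/= => /andP[-> xt].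
exact: le_trans xt t1.
Qed.

Lemma indefinite_continuous f : rint I01 f ->
  {within I01, continuous (fun t => \int[mu]_(tau in `[0, t]) f tau)}.
Proof. by move=> iF; apply: parameterized_integral_continuous. Qed.

Lemma indefinite_measurable f : rint I01 f ->
  measurable_fun I01 (fun t => \int[mu]_(tau in `[0, t]) f tau).
Proof.
move=> iF; apply: subspace_continuous_measurable_fun; first exact: measurable_I01.
exact: indefinite_continuous.
Qed.

Lemma indefinite_le f t : rint I01 f -> I01 t ->
  `|\int[mu]_(tau in `[0, t]) f tau| <= \int[mu]_(tau in I01) `|f tau|.
Proof.
move=> iF t01; have S := itv0_sub t01.
have iS := rint_subset (measurable_itv _) measurable_I01 S iF.
apply: le_trans (le_normr_Rintegral _ iS) _; first exact: measurable_itv.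
rewrite (Rintegral_subset _ S); apply: le_Rintegral => //.
- by apply: rint_indic; [exact: measurable_itv| |exact: rint_norm].
- exact: rint_norm.
- move=> x _; rewrite indicE; case: (_ \in _); rewrite ?mul1r ?mul0r//.
Qed.

Lemma RFubini (f : R * R -> R) :
  (mu \x mu)%E.-integrable setT (EFin \o f) ->
  (forall x, rint setT (fun y => f (x, y))) ->
  (forall y, rint setT (fun x => f (x, y))) ->
  \int[mu]_x \int[mu]_y f (x, y) = \int[mu]_y \int[mu]_x f (x, y).
Proof.
move=> iF f1 f2; congr fine.
under eq_integral do rewrite -rint_EFin//.
under [RHS]eq_integral do rewrite -rint_EFin//.
exact: (Fubini iF).
Qed.

Lemma integrable_tensor f g : rint setT f -> rint setT g ->
  (mu \x mu)%E.-integrable setT (EFin \o (fun z : R * R => f z.1 * g z.2)).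
Proof.
move=> iF iG; have mf := rint_meas iF; have mg := rint_meas iG.
apply/integrable12ltyP.
  apply/measurable_EFinP; apply: measurable_funM.
    exact: (measurableT_comp mf measurable_fst).
  exact: (measurableT_comp mg measurable_snd).
have iG' := rint_norm iG; have iF' := rint_norm iF.
pose G := \int[mu]_y `|g y|.
have E x : (\int[mu]_y `|(f x * g y)%:E| = (G * `|f x|)%:E)%E.
  transitivity (\int[mu]_y (`|f x| * `|g y|)%:E)%E.
    by apply: eq_integral => y _; rewrite /= normrM.
  rewrite rint_EFin//; last exact: rintZ.
  by rewrite RintegralZ// mulrC.
under eq_integral do rewrite /= E.
have i := rintZ measurableT G iF'.
by rewrite rint_EFin// ltry.
Qed.

Lemma rint_patch (D : set R) f : measurable D ->
  rint D f <-> rint setT (f \_ D).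
Proof.
move=> mD; rewrite (@integrable_mkcond _ _ _ mu D)//.
by rewrite restrict_EFin.
Qed.

Lemma integrable_tensor_le f g (h : R * R -> R) :
  rint setT f -> rint setT g -> measurable_fun setT h ->
  (forall z, `|h z| <= `|f z.1 * g z.2|) ->
  (mu \x mu)%E.-integrable setT (EFin \o h).
Proof.
move=> iF iG mh hle; apply: (le_integrable _ _ _ (integrable_tensor iF iG)) => //.
  exact/measurable_EFinP.
by move=> z _; rewrite /= lee_fin.
Qed.

Lemma measurable_triangle : measurable [set z : R * R | z.2 <= z.1].
Proof.
have -> : [set z : R * R | z.2 <= z.1] = (fun z => z.1 - z.2) @^-1` `[0, +oo[.
  by apply/seteqP; split => z /=; rewrite in_itv/= andbT subr_ge0.
rewrite -[X in measurable X]setTI.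
by apply: measurable_funB => //; exact: measurable_itv.
Qed.

(** The two terms integrate al(tau) be(t) over the two halves of the unit square cut along the
    diagonal. Fubini on the half tau <= t rewrites the first term with the integral of [be] over
    [t, 1]. *)
Lemma Rintegral_triangle al be : rint I01 al -> rint I01 be ->
  \int[mu]_(t in I01) (be t * \int[mu]_(tau in `[0, t]) al tau) +
  \int[mu]_(t in I01) (al t * \int[mu]_(tau in `[0, t]) be tau) =
  (\int[mu]_(t in I01) al t) * (\int[mu]_(t in I01) be t).
Proof.
move=> ia ib.
(* Extension by zero, since [RFubini] is stated on the whole plane. *)
pose a := al \_ I01; pose b := be \_ I01.
have iA : rint setT a by exact/(rint_patch al measurable_I01).
have iB : rint setT b by exact/(rint_patch be measurable_I01).
pose T := [set z : R * R | z.2 <= z.1].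
pose f z := \1_T z * (b z.1 * a z.2).
have mT : measurable T by exact: measurable_triangle.
have mf : measurable_fun setT f.
  apply: measurable_funM; first exact: measurable_indic.
  apply: measurable_funM.
    exact: (measurableT_comp (rint_meas iB) measurable_fst).
  exact: (measurableT_comp (rint_meas iA) measurable_snd).
have iF : (mu \x mu)%E.-integrable setT (EFin \o f).
  apply: (integrable_tensor_le iB iA mf) => z.
  rewrite /f normrM indicE; case: (_ \in _); rewrite ?normr1 ?mul1r//.
  by rewrite normr0 mul0r.
have Tx x y : ((x, y) \in T) = (y \in `]-oo, x]%classic).
  by apply/idP/idP => /set_mem xy; apply/mem_set; move: xy; rewrite /T /= in_itv.
have Ty x y : ((x, y) \in T) = (x \in `[y, +oo[%classic).
  apply/idP/idP => /set_mem xy; apply/mem_set; move: xy;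
    by rewrite /T /= in_itv/= andbT.
have fx x y : f (x, y) = b x * (\1_(`]-oo, x]) y * a y).
  by rewrite /f !indicE /= Tx mulrCA.
have fy x y : f (x, y) = a y * (\1_(`[y, +oo[) x * b x).
  by rewrite /f !indicE /= Ty (mulrC (b x)) mulrCA.
have ix x : rint setT (fun y => \1_(`]-oo, x]) y * a y).
  by apply: rint_indic => //; exact: measurable_itv.
have iy y : rint setT (fun x => \1_(`[y, +oo[) x * b x).
  by apply: rint_indic => //; exact: measurable_itv.
have f1 x : rint setT (fun y => f (x, y)).
  by under eq_fun do rewrite fx; exact: rintZ.
have f2 y : rint setT (fun x => f (x, y)).
  by under eq_fun do rewrite fy; exact: rintZ.
have := RFubini iF f1 f2.
have -> : \int[mu]_x \int[mu]_y f (x, y) =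
    \int[mu]_(t in I01) (be t * \int[mu]_(tau in `[0, t]) al tau).
  rewrite [RHS]Rintegral_mkcond; apply: eq_Rintegral => x _.
  under eq_Rintegral do rewrite fx.
  rewrite RintegralZ// /b /patch; case: ifPn => x01; last by rewrite mul0r.
  congr (_ * _); rewrite [RHS]Rintegral_mkcond; apply: eq_Rintegral => y _.
  rewrite /a /patch indicE; case: ifPn => y01; case: ifPn => y0x.
  - move/set_mem : y0x; rewrite /= in_itv/= => /andP[_ yx].
    by rewrite mem_set ?mul1r//= in_itv.
  - rewrite memNset ?mul0r//= in_itv/= => yx; move/negP : y0x; apply.
    apply/mem_set; rewrite /= in_itv/= yx andbT.
    by move/set_mem : y01; rewrite /I01/= in_itv/= => /andP[].
  - move/negP : y01; case; apply/mem_set; apply: (itv0_sub (set_mem x01)).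
    exact: set_mem.
  - by rewrite mulr0.
have -> : \int[mu]_y \int[mu]_x f (x, y) =
    \int[mu]_(t in I01) (al t * (\int[mu]_(tau in I01) be tau -
       \int[mu]_(tau in `[0, t]) be tau)).
  rewrite [RHS]Rintegral_mkcond; apply: eq_Rintegral => y _.
  under eq_Rintegral do rewrite fy.
  rewrite RintegralZ// /a /patch; case: ifPn => y01; last by rewrite mul0r.
  congr (_ * _); have := set_mem y01; rewrite /I01/= in_itv/= => /andP[y0 y1].
  rewrite Rintegral_itvB ?bnd_simp//.
  (* The difference of integrals gives ]y, 1], the triangle gives [y, 1]; the endpoint is
     negligible. *)
  rewrite Rintegral_itv_obnd_cbnd ?bnd_simp; last first.
    apply: (rint_subset (measurable_itv _) measurable_I01 _ ib).
    by move=> z/=; rewrite /I01/= !in_itv/= => /andP[yz ->]; rewrite andbT (le_trans y0)// ltW.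
  rewrite [RHS]Rintegral_mkcond; apply: eq_Rintegral => x _.
  rewrite /b /patch indicE; case: ifPn => x01; case: ifPn => xy1.
  - move/set_mem : xy1; rewrite /= in_itv/= => /andP[yx _].
    by rewrite mem_set ?mul1r//= in_itv/= yx.
  - rewrite memNset ?mul0r//= in_itv/= andbT => yx; move/negP : xy1; apply.
    apply/mem_set; rewrite /= in_itv/= yx.
    by move/set_mem : x01; rewrite /I01/= in_itv/= => /andP[].
  - move/negP : x01; case; apply/mem_set; move/set_mem : xy1.
    by rewrite /I01/= !in_itv/= => /andP[yx ->]; rewrite andbT (le_trans y0).
  - by rewrite mulr0.
move=> ->.
have iab : rint I01 (fun t => al t * \int[mu]_(tau in `[0, t]) be tau).
  apply: (rint_le measurable_I01 _ _
     (rintZ measurable_I01 (\int[mu]_(tau in I01) `|be tau|) (rint_norm ia))).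
    by apply: measurable_funM; [exact: rint_meas ia|exact: indefinite_measurable].
  by move=> t t01; rewrite normrM mulrC ler_wpM2r// indefinite_le.
have iba := rintZ measurable_I01 (\int[mu]_(tau in I01) be tau) ia.
under eq_Rintegral do rewrite mulrBr (mulrC (al _) (Rintegral mu I01 _)).
by rewrite RintegralB// RintegralZ// subrK mulrC.
Qed.

End IteratedIntegrals.

(** * Boundedness, adjoint and uniqueness of Volterra operators *)

Section VolterraOperators.
Set Implicit Arguments.
Unset Strict Implicit.
Context {R : realType}.
Notation mu := (@lebesgue_measure R).
Notation rint D f := (mu.-integrable D (EFin \o (f : R -> R))).

(** Replacing f by min(f, g), which equals it almost everywhere, makes the inequality hold
    everywhere and monotonicity applies. *)
Lemma ae_le_Rintegral (D : set R) (f g : R -> R) : measurable D ->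
  rint D f -> rint D g -> {ae mu, forall t, D t -> f t <= g t} ->
  \int[mu]_(t in D) f t <= \int[mu]_(t in D) g t.
Proof.
move=> mD iF iG fg; pose h t := Num.min (f t) (g t).
have mh : measurable_fun D h.
  by apply: measurable_minr; [exact: rint_meas iF|exact: rint_meas iG].
have fh : ae_eq mu D f h by apply: ae_imply fg => t _ ftg; rewrite /h min_l.
rewrite (Rintegral_ae mD (rint_meas iF) mh fh); apply: le_Rintegral => //.
  exact: rint_ae fh iF.
by move=> t _; rewrite /h ge_min lexx orbT.
Qed.

(** Fubini and Tonelli for the square of the kernel, extended by zero outside the unit square. *)
Lemma kernel_sections (g : R -> R -> R) :
  measurable_fun (I01 `*` I01) (fun z : R * R => g z.1 z.2) ->
  (mu \x mu)%E.-integrable (I01 `*` I01) (fun z : R * R => (g z.1 z.2 ^+ 2)%:E) ->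
  {ae mu, forall t, I01 t -> sqint (g t)} /\
  rint I01 (fun t => \int[mu]_(tau in I01) (g t tau ^+ 2)).
Proof.
move=> mg ig; pose Q : set (R * R) := I01 `*` I01.
have mQ : measurable Q by exact: measurableX.
pose h := (fun z : R * R => g z.1 z.2) \_ Q.
have mh : measurable_fun setT h by apply/(measurable_restrictT _ mQ).
pose h2 z := h z ^+ 2.
have hE x y : I01 x -> h (x, y) = (g x \_ I01) y.
  move=> x01; rewrite /h /patch; case: ifPn => xy; case: ifPn => y01 //.
    by move/negP : y01; case; move/set_mem : xy => [_ /mem_set].
  move/negP : xy; case; apply/mem_set; split => //; exact: set_mem.
have h2E x y : I01 x -> h2 (x, y) = ((fun tau => g x tau ^+ 2) \_ I01) y.
  by move=> x01; rewrite /h2 hE// /patch; case: ifP => //; rewrite expr0n.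
have ih2 : (mu \x mu)%E.-integrable setT (EFin \o h2).
  move/integrable_mkcond : ig => /(_ mQ); apply: eq_integrable => // z _.
  by rewrite /h2 /h /patch/=; case: ifP => //; rewrite expr0n.
split.
  have := ae_integrable1 ih2.
  apply: (@filterS _ _ (ae_filter_ringOfSetsType mu)) => t it t01; split.
    apply/(measurable_restrictT _ measurable_I01).
    have -> : g t \_ I01 = h \o pair t by apply/funext => y /=; rewrite hE.
    exact: (measurableT_comp mh (pair1_measurable t)).
  apply/(rint_patch _ measurable_I01); move: it; apply: eq_integrable => // y _.
  by rewrite /= h2E.
have iF := integrable_fubini_F ih2.
have iF01 : mu.-integrable I01 (fubini_F mu (EFin \o h2)).
  by apply: integrableS iF.
have E t : I01 t ->
    \int[mu]_(tau in I01) (g t tau ^+ 2) = fine (fubini_F mu (EFin \o h2) t).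
  move=> t01; rewrite /Rintegral integral_mkcond restrict_EFin.
  by congr fine; apply: eq_integral => y _; rewrite /= h2E.
(* The inner integral may be infinite on a null set of times; [fine] takes the same value there as
   the real-valued integral. *)
apply: (@rint_eq _ I01 measurable_I01 (fine \o fubini_F mu (EFin \o h2))).
  by move=> t /E ->.
apply: (le_integrable _ _ _ iF01) => //.
  apply/measurable_EFinP; apply: measurableT_comp => //.
  exact: measurable_int iF01.
move=> t _ /=; case: (fubini_F _ _ _) => [r| |] /=; first exact: lexx;
  by rewrite ?abse0 ?normr0 leey.
Qed.

Context {k : nat}.
Implicit Types (u v w : R -> 'rV[R]_k)
  (K : (R -> 'rV[R]_k) -> (R -> 'rV[R]_k)).

Definition cut (A : set R) u : R -> 'rV[R]_k := fun t => \1_A t *: u t.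

Lemma L2_cut A u : measurable A -> L2 u -> L2 (cut A u).
Proof.
move=> mA Lu i; apply: (sqint_le _ (Lu i)).
  have -> : (fun t => cut A u t 0 i) = (fun t => \1_A t * u t 0 i).
    by apply/funext => t; rewrite mxE.
  apply: measurable_funM; first exact: measurable_indic.
  by case: (Lu i).
move=> t _; rewrite mxE normrM indicE; case: (_ \in _).
  by rewrite normr1 mul1r.
by rewrite normr0 mul0r.
Qed.

Lemma cut_in A u t : A t -> cut A u t = u t.
Proof. by move=> At; rewrite /cut indicE mem_set// scale1r. Qed.

Lemma cut_out A u t : ~ A t -> cut A u t = 0.
Proof. by move=> At; rewrite /cut indicE memNset// scale0r. Qed.

Lemma cut_cut A B u : A `<=` B -> cut B (cut A u) = cut A u.
Proof.
move=> AB; apply/funext => t; have [At|At] := pselect (A t).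
  by rewrite cut_in//; apply: AB.
by rewrite {1}/cut cut_out// scaler0.
Qed.

Lemma cut_disj A B u : (forall t, A t -> B t -> False) -> cut B (cut A u) = 0.
Proof.
move=> AB; apply/funext => t; have [At|At] := pselect (A t).
  by rewrite cut_out// => Bt; exact: AB At Bt.
by rewrite /cut (_ : \1_A t = 0) ?scale0r ?scaler0//; rewrite indicE memNset.
Qed.

Lemma cut_lin A (a : R) u v : cut A (a *: u + v) = a *: cut A u + cut A v.
Proof.
apply/funext => t; rewrite -[RHS]/(a *: (\1_A t *: u t) + \1_A t *: v t).
by rewrite /cut scalerA mulrC -scalerA -scalerDr.
Qed.

Lemma ip_cut A u v : ip (cut A u) v = ip u (cut A v).
Proof. by apply: eq_Rintegral => t _; rewrite dotZl dotZr. Qed.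

Lemma ip_cut_le A u : measurable A -> L2 u -> ip (cut A u) (cut A u) <= ip u u.
Proof.
move=> mA Lu; apply: le_Rintegral => //.
- by apply: rint_dot; exact: L2_cut.
- exact: rint_dot.
- move=> t _; have [At|At] := pselect (A t); first by rewrite cut_in.
  by rewrite cut_out// dot0l dot_ge0.
Qed.

Lemma ip_cut_Rintegral (t : R) u v : I01 t ->
  ip u (cut `[0, t] v) = \int[mu]_(tau in `[0, t]) dot (u tau) (v tau).
Proof.
move=> t01; rewrite (Rintegral_subset _ (itv0_sub t01)).
by apply: eq_Rintegral => tau _; rewrite dotZr.
Qed.

(* [r t i] is the [i]-th row of the kernel at time [t]. *)
Lemma volterra_rows K : volterra_HS K ->
  exists (r : R -> 'I_k -> R -> 'rV[R]_k) (m : R -> R),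
  [/\ rint I01 m,
      {ae mu, forall t, I01 t -> (forall i, L2 (r t i)) /\
        \sum_i ip (r t i) (r t i) <= m t}
    & forall v, L2 v -> {ae mu, forall t, I01 t ->
        K v t = \row_i ip (r t i) (cut `[0, t] v)}].
Proof.
move=> [_ [N LN KN]].
pose r t i tau := row i (N t tau).
pose m t := \sum_i \sum_j \int[mu]_(tau in I01) (N t tau i j ^+ 2).
have sec i j := @kernel_sections (fun t tau => N t tau i j) (LN i j).1 (LN i j).2.
exists r, m; split.
- by do 2 (apply: rint_sum => // ?); exact: (sec _ _).2.
- have H i : {ae mu, forall t, I01 t -> forall j, sqint (fun tau => N t tau i j)}.
    by apply: ae_forallfin => j; exact: (sec i j).1.
  apply: ae_imply (ae_forallfin H) => t t01 sN.
  have Lr i : L2 (r t i).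
    by move=> j; have := sN i j; congr sqint; apply/funext => tau; rewrite mxE.
  split => //; apply: ler_sum => i _; rewrite ip_coord//; apply: ler_sum => j _.
  rewrite le_eqVlt; apply/orP; left; apply/eqP; apply: eq_Rintegral => tau _.
  by rewrite !mxE expr2.
- move=> v Lv; apply: ae_imply (KN v Lv) => t t01 ->.
  apply/rowP => i; rewrite !mxE ip_cut_Rintegral//; apply: eq_Rintegral => tau _.
  by rewrite !mxE; apply: eq_bigr => j _; rewrite !mxE.
Qed.

(** K agrees with an integral operator outside a null set that depends on the argument; three such
    sets are discarded here. *)
Lemma volterra_lin K (a : R) u v : volterra_HS K -> L2 u -> L2 v ->
  ae_eq mu I01 (K (a *: u + v)) (a *: K u + K v).
Proof.
move=> /volterra_rows[r [m [_ Lr Kr]]] Lu Lv.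
have := ae_and (ae_and Lr (Kr _ (L2_lin a Lu Lv))) (ae_and (Kr _ Lu) (Kr _ Lv)).
apply: ae_imply => t t01 [[[{}Lr _] ->] [Ku Kv]].
rewrite -[RHS]/(a *: K u t + K v t) Ku Kv; apply/rowP => i; rewrite !mxE cut_lin.
have mt : measurable `[0, t]%classic by exact: measurable_itv.
by rewrite ipDr ?ipZr//; [exact: L2_cut|apply: L2Z; exact: L2_cut|exact: L2_cut].
Qed.

Lemma volterra_bound K : volterra_HS K ->
  exists2 C : R, 0 <= C & forall v, L2 v -> normL2 (K v) <= C * normL2 v.
Proof.
move=> vK; have [r [m [im Lr Kr]]] := volterra_rows vK; have [LK _] := vK.
pose M := \int[mu]_(t in I01) m t.
(* M bounds the squared Hilbert-Schmidt norm, and M <= (|M| + 1)^2 spares a square root. *)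
exists (`|M| + 1) => [|v Lv]; first by rewrite addr_ge0.
apply: normL2_le; first by rewrite mulr_ge0 ?normL2_ge0// addr_ge0.
rewrite exprMn normL2_sqr; have v0 := ip_ge0 v.
apply: (@le_trans _ _ (M * ip v v)); last first.
  rewrite ler_wpM2r//; apply: le_trans (ler_norm M) _.
  have := normr_ge0 M; nra.
rewrite mulrC -RintegralZ//; apply: ae_le_Rintegral => //.
- by apply: rint_dot; exact: LK.
- exact: rintZ.
apply: ae_imply (ae_and Lr (Kr v Lv)) => t t01 [[{}Lr rm] ->].
apply: (@le_trans _ _ (\sum_i ip v v * ip (r t i) (r t i))); last first.
  by rewrite -mulr_sumr ler_wpM2l.
apply: ler_sum => i _; rewrite mxE -expr2.
have Lc : L2 (cut `[0, t] v) by apply: L2_cut => //; exact: measurable_itv.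
apply: le_trans (ip_CS (Lr i) Lc) _; rewrite mulrC ler_wpM2r ?ip_ge0//.
by apply: ip_cut_le => //; exact: measurable_itv.
Qed.

(** [adjoint] is a choice that is meaningful only if some adjoint exists: Riesz applied to u |->
    <Ku, v> provides one, with value 0 at v outside L^2. *)
Lemma volterra_adjoint K : volterra_HS K -> is_adjoint K (adjoint K).
Proof.
move=> vK; rewrite /adjoint; case: xgetP => [K' -> //|noadj].
have [C C0 KC] := volterra_bound vK; have [LK _] := vK.
suff /choice[K' K'P] : forall v, exists z, L2 v ->
    L2 z /\ forall u, L2 u -> ip (K u) v = ip z u.
  exfalso; apply: (noadj K'); split=> [v Lv|u v Lu Lv].
    by have [] := K'P v Lv.
  by have [_ ->//] := K'P v Lv; rewrite ipC.
move=> v; have [Lv|nLv] := pselect (L2 v); last by exists 0.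
have [||z Lz zP] := @Riesz R k (fun u => ip (K u) v) (C * normL2 v).
- move=> a u w Lu Lw; have aKL := L2_lin a (LK _ Lu) (LK _ Lw).
  rewrite (ip_ael (LK _ (L2_lin a Lu Lw)) aKL Lv (volterra_lin _ vK Lu Lw)).
  by rewrite ip_linl//; exact: LK.
- move=> u Lu; apply: le_trans (ip_le (LK _ Lu) Lv) _.
  by rewrite mulrAC ler_wpM2r ?normL2_ge0// KC.
by exists z.
Qed.

Lemma L2_skew_part K u : volterra_HS K -> L2 u -> L2 (skew_part K u).
Proof.
move=> vK Lu; have [LK _] := vK; have [LK' _] := volterra_adjoint vK.
by apply: L2Z; apply: L2B; [exact: LK|exact: LK'].
Qed.

Lemma ip_skew_part K u v : volterra_HS K -> L2 u -> L2 v ->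
  ip (skew_part K u) v = 2^-1 * (ip (K u) v - ip (K v) u).
Proof.
move=> vK Lu Lv; have [LK _] := vK; have [LK' adj] := volterra_adjoint vK.
rewrite ipZl//; last by apply: L2B; [exact: LK|exact: LK'].
rewrite ipBl//; [|exact: LK|exact: LK'].
by rewrite (ipC (adjoint K u)) -adj.
Qed.

(** Rationals below t are what survives when only countably many null sets may be removed; they
    approach t from the left. The value at 0 settles t = 0, which has none below it in [0, 1]. *)
Lemma continuous_rat_eq0 (F : R -> R) (t : R) : {within I01, continuous F} ->
  I01 t -> F 0 = 0 -> (forall q : rat, 0 <= (ratr q : R) < t -> F (ratr q) = 0) ->
  F t = 0.
Proof.
move=> cF; rewrite /I01/= in_itv/= => /andP[t0 t1] F0 Fq.
have [->//|tn0] := eqVneq t 0; have {}t0 : 0 < t by rewrite lt_neqAle eq_sym tn0.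
apply: contrapT => /eqP Ft.
have cl : F s @[s --> t^'-] --> F t.
  have [c0 _ c1] := (continuous_within_itvP F (@ltr01 R)).1 cF.
  move: t1; rewrite le_eqVlt => /predU1P[->//|t1].
  by apply: cvg_at_left_filter; apply: c0; rewrite in_itv/= t0.
have Fp : 0 < `|F t| by rewrite normr_gt0.
have /cvgrPdist_lt/(_ _ Fp)/nbhs_ballP[e /= e0 He] := cl.
have : Num.max 0 (t - e) < t by rewrite gt_max t0 gtrBl.
move=> /rat_in_itvoo[q]; rewrite in_itv/= gt_max -andbA => /and3P[q0 qe qt].
have bq : ball t e (ratr q).
  by rewrite /ball/= gtr0_norm ?subr_gt0// ltrBlDr addrC -ltrBlDr.
by have := He _ bq qt; rewrite /= Fq ?(ltW q0)// subr0 ltxx.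
Qed.

(* If the form <Du, v> is symmetric, then D maps functions supported in [0, a]
   to functions vanishing on ]a, 1]: test against functions supported there.
   Letting a increase to t gives (Dv)(t) = 0. *)
Lemma volterra_unique K1 K2 : volterra_HS K1 -> volterra_HS K2 ->
  (forall u v, L2 u -> L2 v ->
    ip (K1 u) v - ip (K1 v) u = ip (K2 u) v - ip (K2 v) u) ->
  forall v, L2 v -> ae_eq mu I01 (K1 v) (K2 v).
Proof.
move=> vK1 vK2 eqK v Lv; have [LK1 _] := vK1; have [LK2 _] := vK2.
have [r1 [m1 [_ Lr1 Kr1]]] := volterra_rows vK1.
have [r2 [m2 [_ Lr2 Kr2]]] := volterra_rows vK2.
pose D u := K1 u - K2 u.
have LD u : L2 u -> L2 (D u) by move=> Lu; apply: L2B; [exact: LK1|exact: LK2].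
have sym u w : L2 u -> L2 w -> ip (D u) w = ip (D w) u.
  move=> Lu Lw; have := eqK u w Lu Lw.
  rewrite !ipBl//; try exact: LK1; try exact: LK2; lra.
have mI (a b : itv_bound R) : measurable ([set` Interval a b] : set R) by exact: measurable_itv.
have D0 a : {ae mu, forall t, I01 t -> a < t -> K1 (cut `[0, a] v) t = K2 (cut `[0, a] v) t}.
  pose c := cut `[0, a] v; have Lc : L2 c by exact: L2_cut.
  pose w := D c; have Lw : L2 w by exact: LD.
  pose u := cut `]a, +oo[ w; have Lu : L2 u by exact: L2_cut.
  (* By symmetry <u, u> = <Dc, u> = <Du, c>. Since u vanishes up to a and the operators are causal,
     Du vanishes on [0, a], where c is supported. *)
  have uu : ip u u = 0.
    have -> : ip u u = ip (D u) c.
      by rewrite sym// -/w {1}/u ip_cut /u cut_cut.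
    rewrite -ip_cut -[RHS](ip0l v); apply: ip_ael => //.
    - by apply: L2_cut => //; exact: LD.
    - exact: L2_0.
    apply: ae_imply (ae_and (Kr1 _ Lu) (Kr2 _ Lu)) => t t01 [k1 k2].
    have [ta|ta] := pselect (`[0, a]%classic t); last by rewrite cut_out.
    rewrite cut_in// -[LHS]/(K1 u t - K2 u t) k1 k2 cut_disj.
      by apply/rowP => i; rewrite !mxE !ip0r subrr.
    move=> s /=; rewrite !in_itv/= => /andP[as_ _] /andP[_ st].
    move: ta; rewrite /= in_itv/= => /andP[_ ta].
    by have := lt_le_trans as_ (le_trans st ta); rewrite ltxx.
  apply: ae_imply (ip_eq0 Lu uu) => t _ + at_.
  rewrite /u cut_in; last by rewrite /= in_itv/= at_.
  by move/eqP; rewrite subr_eq0 => /eqP.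
(* An enumeration of the rationals, with 0 for the codes of no rational, so that one null set serves
   all truncations. *)
pose q n : R := ratr (odflt 0%R (unpickle n : option rat)).
have {}D0 := ae_forallnat (fun n => D0 (q n)).
have cK K r (Kr : forall v, L2 v -> {ae mu, forall t, I01 t ->
        K v t = \row_i ip (r t i) (cut `[0, t] v)}) :
    {ae mu, forall t, I01 t -> forall n, K (cut `[0, q n] v) t =
      \row_i ip (r t i) (cut `[0, t] (cut `[0, q n] v))}.
  by apply: ae_forallnat => n; apply: Kr; exact: L2_cut.
have := ae_and (ae_and D0 (ae_and (cK _ _ Kr1) (cK _ _ Kr2)))
  (ae_and (ae_and Lr1 Lr2) (ae_and (Kr1 v Lv) (Kr2 v Lv))).
apply: ae_imply => t t01 [[{}D0 [c1 c2]] [[[{}Lr1 _] [{}Lr2 _]] [-> ->]]].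
apply/rowP => i; rewrite !mxE; apply/eqP; rewrite -subr_eq0; apply/eqP.
have Lct : L2 (cut `[0, t] v) by exact: L2_cut.
have Lr := L2B (Lr1 i) (Lr2 i).
rewrite -ipBl// ip_cut_Rintegral//.
(* The difference of the i-th rows at the fixed time t, paired with v up to s. At a rational s < t
   it is the i-th coordinate of D applied to the truncation at s, which is 0. *)
pose F s := \int[mu]_(tau in `[0, s]) dot ((r1 t i - r2 t i) tau) (v tau).
apply: (@continuous_rat_eq0 F) => //.
- by apply: indefinite_continuous; exact: rint_dot.
- by rewrite /F set_itv1 Rintegral_set1.
move=> a /andP[a0 at_].
have s01 : I01 (ratr a : R).
  move: t01; rewrite /I01/= !in_itv/= a0 => /andP[_ t1].
  exact: le_trans (ltW at_) t1.
rewrite /F -ip_cut_Rintegral//.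
have qa : q (pickle a) = ratr a by rewrite /q pickleK.
have := D0 (pickle a); rewrite qa => /(_ at_); rewrite -qa c1 c2 qa.
have -> : cut `[0, t] (cut `[0, ratr a] v) = cut `[0, ratr a] v.
  apply: cut_cut => s /=; rewrite !in_itv/= => /andP[-> sa].
  exact: le_trans sa (ltW at_).
move=> /rowP/(_ i); rewrite !mxE => ra.
by rewrite ipBl ?ra ?subrr//; exact: L2_cut.
Qed.

End VolterraOperators.

(** * Volterra operators with separable kernel *)

Section SeparableKernels.
Set Implicit Arguments.
Unset Strict Implicit.
Context {R : realType} {k : nat}.
Notation mu := (@lebesgue_measure R).
Notation rint D f := (mu.-integrable D (EFin \o (f : R -> R))).
Implicit Types (u v w : R -> 'rV[R]_k).

Lemma integrable_tensor01 (f g : R -> R) : rint I01 f -> rint I01 g ->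
  (mu \x mu)%E.-integrable (I01 `*` I01)
    (EFin \o (fun z : R * R => f z.1 * g z.2)).
Proof.
move=> iF iG; have mQ : measurable (@I01 R `*` @I01 R) by exact: measurableX.
have h := integrable_tensor ((rint_patch f measurable_I01).1 iF)
  ((rint_patch g measurable_I01).1 iG).
have := @integrableS _ _ _ (mu \x mu)%E _ _ _ measurableT mQ (@subsetT _ _) h.
apply: eq_integrable => //.
by move=> z /set_mem[z1 z2] /=; rewrite !patchE !mem_set.
Qed.

Lemma measurable_fst01 (f : R -> R) : measurable_fun I01 f ->
  measurable_fun (I01 `*` I01) (fun z : R * R => f z.1).
Proof.
move=> mf; apply: (measurable_comp measurable_I01 _ mf).
  by move=> _ [z [z1 _] <-].
exact: measurable_funTS measurable_fst.
Qed.

Lemma measurable_snd01 (f : R -> R) : measurable_fun I01 f ->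
  measurable_fun (I01 `*` I01) (fun z : R * R => f z.2).
Proof.
move=> mf; apply: (measurable_comp measurable_I01 _ mf).
  by move=> _ [z [_ z2] <-].
exact: measurable_funTS measurable_snd.
Qed.

Variables (J : finType) (g h : J -> R -> 'rV[R]_k).
Hypotheses (Lg : forall j, L2 (g j)) (Lh : forall j, L2 (h j)).

(** The operator whose kernel has entries sum_j g_j(t)_i h_j(tau)_l on tau <= t: a finite rank
    kernel restricted to a triangle. *)
Definition sep_op u : R -> 'rV[R]_k := fun t =>
  \sum_j (\int[mu]_(tau in `[0, t]) dot (h j tau) (u tau)) *: g j t.

Lemma sep_op_volterra : volterra_HS sep_op.
Proof.
split=> [u Lu i|].
  have ih j := rint_dot (Lh j) Lu.
  pose c j t := \int[mu]_(tau in `[0, t]) dot (h j tau) (u tau).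
  have -> : (fun t => sep_op u t 0 i) = (fun t => \sum_j c j t * g j t 0 i).
    by apply/funext => t; rewrite summxE; apply: eq_bigr => j _; rewrite mxE.
  apply: sqint_sum => j.
  apply: (sqint_le _ (sqintZ (\int[mu]_(tau in I01) `|dot (h j tau) (u tau)|) (Lg j i))).
    apply: measurable_funM; first exact: indefinite_measurable.
    by case: (Lg j i).
  move=> t t01; rewrite !normrM ler_wpM2r//.
  by apply: le_trans (ler_norm _); exact: indefinite_le.
exists (fun t tau => \matrix_(i, l) \sum_j g j t 0 i * h j tau 0 l).
  move=> i l; split.
    under eq_fun do rewrite mxE.
    apply: measurable_sum => j; apply: measurable_funM.
      exact: (measurable_fst01 (Lg j i).1).
    exact: (measurable_snd01 (Lh j l).1).
  have mQ : measurable (@I01 R `*` @I01 R) by exact: measurableX.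
  (* The square of a kernel entry is a double sum, over J x J, of products of a function of t and a
     function of tau. *)
  have H (p : J * J) := integrable_tensor01 (sqint_mul (Lg p.1 i) (Lg p.2 i))
    (sqint_mul (Lh p.1 l) (Lh p.2 l)).
  have := @integrable_sum _ _ _ (mu \x mu)%E _ mQ _ (index_enum (J * J)%type)
    xpredT _ (fun p _ => H p).
  apply: eq_integrable => // z _; rewrite mxE expr2 mulr_suml.
  rewrite sumEFin; congr (_%:E); rewrite -(pair_bigA _ (fun a b =>
    g a z.1 0 i * g b z.1 0 i * (h a z.2 0 l * h b z.2 0 l)))/=.
  apply: eq_bigr => a _; rewrite mulr_sumr; apply: eq_bigr => b _.
  by rewrite mulrACA.
move=> u Lu; apply: aeT => t t01; apply/rowP => i; rewrite !mxE summxE.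
have mt : measurable (`[0, t]%classic : set R) by exact: measurable_itv.
have ih j : rint `[0, t] (fun tau => dot (h j tau) (u tau)).
  by apply: (rint_subset mt measurable_I01 (itv0_sub t01)); exact: rint_dot.
transitivity (\int[mu]_(tau in `[0, t])
    \sum_j (g j t 0 i * dot (h j tau) (u tau))).
  rewrite Rintegral_sum//; last by move=> j; exact: rintZ.
  by apply: eq_bigr => j _; rewrite mxE RintegralZ// mulrC.
apply: eq_Rintegral => tau _; rewrite mxE.
transitivity (\sum_j \sum_l g j t 0 i * h j tau 0 l * u tau 0 l).
  by apply: eq_bigr => j _; rewrite mulr_sumr; apply: eq_bigr => l _; rewrite mulrA.
rewrite exchange_big; apply: eq_bigr => l _; rewrite !mxE mulr_suml.
by apply: eq_bigr.
Qed.

Lemma rint_sep u v j : L2 u -> L2 v ->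
  rint I01 (fun t => dot (g j t) (v t) *
    \int[mu]_(tau in `[0, t]) dot (h j tau) (u tau)).
Proof.
move=> Lu Lv; have ig := rint_dot (Lg j) Lv; have ih := rint_dot (Lh j) Lu.
apply: (rint_le measurable_I01 _ _
     (rintZ measurable_I01 (\int[mu]_(tau in I01) `|dot (h j tau) (u tau)|) (rint_norm ig))).
  by apply: measurable_funM; [exact: rint_meas ig|exact: indefinite_measurable].
by move=> t t01; rewrite normrM mulrC ler_wpM2r// indefinite_le.
Qed.

Lemma ip_sep_op u v : L2 u -> L2 v ->
  ip (sep_op u) v = \sum_j \int[mu]_(t in I01) (dot (g j t) (v t) *
    \int[mu]_(tau in `[0, t]) dot (h j tau) (u tau)).
Proof.
move=> Lu Lv; rewrite -Rintegral_sum//; last by move=> j; exact: rint_sep.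
apply: eq_Rintegral => t _; rewrite dot_suml; apply: eq_bigr => j _.
by rewrite dotZl mulrC.
Qed.

Hypothesis antisym : forall t tau i l,
  \sum_j g j t 0 i * h j tau 0 l = - \sum_j g j tau 0 l * h j t 0 i.

Lemma antisym_dot t tau x y :
  \sum_j dot (g j t) x * dot (h j tau) y = - \sum_j dot (g j tau) y * dot (h j t) x.
Proof.
have E (a b : J -> 'rV[R]_k) x' y' : \sum_j dot (a j) x' * dot (b j) y' =
    \sum_i \sum_l (\sum_j a j 0 i * b j 0 l) * (x' 0 i * y' 0 l).
  transitivity (\sum_j \sum_i \sum_l a j 0 i * b j 0 l * (x' 0 i * y' 0 l)).
    apply: eq_bigr => j _; rewrite mulr_suml; apply: eq_bigr => i _.
    by rewrite mulr_sumr; apply: eq_bigr => l _; rewrite mulrACA.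
  rewrite exchange_big; apply: eq_bigr => i _; rewrite exchange_big.
  by apply: eq_bigr => l _; rewrite mulr_suml.
rewrite !E exchange_big -sumrN; apply: eq_bigr => l _; rewrite -sumrN.
by apply: eq_bigr => i _; rewrite antisym mulNr (mulrC (x _ _)).
Qed.

(** Antisymmetry of the full kernel rewrites - <Kv, u> with g and h exchanged. This is the integral
    over the complementary triangle, and [Rintegral_triangle] joins both into a product of integrals
    over [0, 1]. *)
Lemma ip_skew_sep_op u v : L2 u -> L2 v ->
  ip (skew_part sep_op u) v = 2^-1 * \sum_j ip (h j) u * ip (g j) v.
Proof.
move=> Lu Lv; rewrite ip_skew_part//; last exact: sep_op_volterra.
congr (_ * _).
have -> : ip (sep_op v) u = - \sum_j \int[mu]_(t in I01) (dot (h j t) (u t) *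
    \int[mu]_(tau in `[0, t]) dot (g j tau) (v tau)).
  have ihg j : rint I01 (fun t => dot (h j t) (u t) *
      \int[mu]_(tau in `[0, t]) dot (g j tau) (v tau)).
    have ig := rint_dot (Lg j) Lv; have ih := rint_dot (Lh j) Lu.
    apply: (rint_le measurable_I01 _ _ (rintZ measurable_I01
      (\int[mu]_(tau in I01) `|dot (g j tau) (v tau)|) (rint_norm ih))).
      by apply: measurable_funM; [exact: rint_meas ih|exact: indefinite_measurable].
    by move=> t t01; rewrite normrM mulrC ler_wpM2r// indefinite_le.
  rewrite ip_sep_op// -!Rintegral_sum//; last by move=> j; exact: rint_sep.
  rewrite -[RHS]mulN1r -RintegralZ//; last exact: rint_sum.
  apply: eq_Rintegral => t /set_mem t01; rewrite mulN1r.
  have mt : measurable (`[0, t]%classic : set R) by exact: measurable_itv.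
  have it f : L2 f -> rint `[0, t] (fun tau => dot (f tau) (v tau)).
    move=> Lf; apply: (rint_subset mt measurable_I01 (itv0_sub t01)).
    exact: rint_dot.
  transitivity (\int[mu]_(tau in `[0, t])
      \sum_j dot (g j t) (u t) * dot (h j tau) (v tau)).
    rewrite Rintegral_sum//; last by move=> j; apply: rintZ => //; exact: it.
    by apply: eq_bigr => j _; rewrite RintegralZ//; exact: it.
  transitivity (\int[mu]_(tau in `[0, t])
      (-1 * \sum_j dot (h j t) (u t) * dot (g j tau) (v tau))).
    apply: eq_Rintegral => tau _; rewrite antisym_dot mulN1r; congr (- _).
    by apply: eq_bigr => j _; rewrite mulrC.
  have ij j : rint `[0, t] (fun tau => dot (h j t) (u t) * dot (g j tau) (v tau)).
    by apply: rintZ => //; exact: it.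
  rewrite RintegralZ//; last exact: rint_sum.
  rewrite mulN1r Rintegral_sum//; congr (- _).
  by apply: eq_bigr => j _; rewrite RintegralZ//; exact: it.
rewrite opprK ip_sep_op// -big_split; apply: eq_bigr => j _ /=.
by rewrite Rintegral_triangle//; exact: rint_dot.
Qed.

End SeparableKernels.

(** * Triples *)

Section TripleUniqueness.
Set Implicit Arguments.
Unset Strict Implicit.
Context {R : realType} {k : nat}.
Implicit Types (u v w : R -> 'rV[R]_k).

Section Form.
Variable S : lagrangian_pair R.
Implicit Types x y z : S.

Lemma lformlr a x y z : lform z (a *: x + y) = a * lform z x + lform z y.
Proof. by have [H _ _ _] := lform_symplectic S; exact: H. Qed.

Lemma lformll a x y z : lform (a *: x + y) z = a * lform x z + lform y z.
Proof. by have [_ H _ _] := lform_symplectic S; exact: (H z). Qed.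

Lemma lformDr x y z : lform z (x + y) = lform z x + lform z y.
Proof. by rewrite -[x in LHS]scale1r lformlr mul1r. Qed.

Lemma lformDl x y z : lform (x + y) z = lform x z + lform y z.
Proof. by rewrite -[x in LHS]scale1r lformll mul1r. Qed.

Lemma lform0r x : lform x (0 : S) = 0.
Proof.
have := lformDr 0 0 x; rewrite addr0 -{1}[lform x 0]addr0.
by move=> /addrI/esym.
Qed.

Lemma lform0l x : lform (0 : S) x = 0.
Proof.
have := lformDl 0 0 x; rewrite addr0 -{1}[lform 0 x]addr0.
by move=> /addrI/esym.
Qed.

Lemma lformZr a x z : lform z (a *: x) = a * lform z x.
Proof. by rewrite -[_ *: _]addr0 lformlr lform0r addr0. Qed.

Lemma lformZl a x z : lform (a *: x) z = a * lform x z.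
Proof. by rewrite -[_ *: _]addr0 lformll lform0l addr0. Qed.

Lemma lform_sumr (I : Type) (s : seq I) (F : I -> S) z :
  lform z (\sum_(i <- s) F i) = \sum_(i <- s) lform z (F i).
Proof. by elim/big_rec2: _ => [|i a b _ <-]; rewrite ?lform0r ?lformDr. Qed.

Lemma lform_suml (I : Type) (s : seq I) (F : I -> S) z :
  lform (\sum_(i <- s) F i) z = \sum_(i <- s) lform (F i) z.
Proof. by elim/big_rec2: _ => [|i a b _ <-]; rewrite ?lform0l ?lformDl. Qed.

Lemma lform_alt x y : lform x y = - lform y x.
Proof.
have [_ _ alt _] := lform_symplectic S.
have := alt (x + y); rewrite lformDl !lformDr !alt add0r addr0 => /eqP.
by rewrite addr_eq0 => /eqP.
Qed.

Lemma lplane_isotropic x y : x \in lplane S -> y \in lplane S -> lform x y = 0.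
Proof. by move=> /(lplane_lagrangian x) H /H. Qed.

Lemma lform_nondeg x : (forall y, lform x y = 0) -> x = 0.
Proof. by have [_ _ _ H] := lform_symplectic S; exact: H. Qed.

Variable Z : (R -> 'rV[R]_k) -> S.
Hypothesis tZ : is_triple S Z.

Lemma triple_lin (a : R) u v : L2 u -> L2 v -> Z (a *: u + v) = a *: Z u + Z v.
Proof. by have [[+ _] _] := tZ; exact. Qed.

Lemma tripleD u v : L2 u -> L2 v -> Z (u + v) = Z u + Z v.
Proof. by move=> Lu Lv; rewrite -[u in LHS]scale1r triple_lin// scale1r. Qed.

Lemma triple0 : Z 0 = 0.
Proof.
have := tripleD (@L2_0 R k) (@L2_0 R k).
by rewrite addr0 -{1}[Z 0]addr0 => /addrI/esym.
Qed.

Lemma tripleZ a u : L2 u -> Z (a *: u) = a *: Z u.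
Proof.
by move=> Lu; rewrite -[_ *: _]addr0 triple_lin ?triple0 ?addr0//; exact: L2_0.
Qed.

Lemma tripleB u v : L2 u -> L2 v -> Z (u - v) = Z u - Z v.
Proof. by move=> Lu Lv; rewrite addrC -scaleN1r triple_lin// scaleN1r addrC. Qed.

Lemma triple_sum (I : Type) (s : seq I) (F : I -> R -> 'rV[R]_k) :
  (forall i, L2 (F i)) -> Z (\sum_(i <- s) F i) = \sum_(i <- s) Z (F i).
Proof.
move=> LF; elim: s => [|i s IH]; first by rewrite !big_nil triple0.
by rewrite !big_cons tripleD ?IH//; exact: L2_sum.
Qed.

(** Transversality lifts a basis of Sigma, modulo Pi, to functions w_i. They give the finite
    codimension of the preimage of Pi, and a finite family on which a pairing with Pi can be
    tested. *)
Lemma triple_span : exists (n : nat) (w : 'I_n -> R -> 'rV[R]_k),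
  (forall i, L2 (w i)) /\
  forall u, L2 u -> exists c : 'I_n -> R, Z (u - \sum_i c i *: w i) \in lplane S.
Proof.
pose e := vbasis {:S}.
have /choice[w wP] : forall i : 'I_(\dim {:S}), exists u, L2 u /\ e`_i - Z u \in lplane S.
  move=> i; have [u [p [Lu pP ->]]] := (proj2 tZ) e`_i.
  by exists u; rewrite addrC addKr.
have Lw i : L2 (w i) by have [] := wP i.
exists _, w; split => // u Lu; exists (fun i => coord e i (Z u)).
have Lcw i : L2 (coord e i (Z u) *: w i) by exact: L2Z.
rewrite tripleB ?triple_sum//; last exact: L2_sum.
rewrite {1}(coord_vbasis (memvf (Z u))) -sumrB; apply: memv_suml => i _.
by rewrite tripleZ// -scalerBr memvZ//; have [] := wP i.
Qed.

End Form.

Section Comparison.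
Variables (S S' : lagrangian_pair R)
  (Z : (R -> 'rV[R]_k) -> S) (Z' : (R -> 'rV[R]_k) -> S').
Hypotheses (tZ : is_triple S Z) (tZ' : is_triple S' Z')
  (formE : forall u v, L2 u -> L2 v -> lform (Z u) (Z v) = lform (Z' u) (Z' v))
  (planeE : forall u, L2 u -> (Z u \in lplane S) = (Z' u \in lplane S')).

(* The vector of the values of p on the [Z w_i] kills every relation
   [\sum_i a_i Z' w_i \in Pi'], so that it is attained on [Pi']. *)
Lemma lplane_transfer p : p \in lplane S ->
  exists2 p', p' \in lplane S' &
    forall v, L2 v -> lform p (Z v) = lform p' (Z' v).
Proof.
move=> pP; have [n [w [Lw wP]]] := triple_span tZ.
pose f := vbasis (lplane S').
pose B : 'M[R]_(\dim (lplane S'), n) := \matrix_(j, i) lform f`_j (Z' (w i)).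
pose y : 'rV[R]_n := \row_i lform p (Z (w i)).
(* Membership in the row space is tested against the cokernel, whose columns are the linear
   relations among the columns of B. *)
have /submxP[x yx] : (y <= B)%MS.
  rewrite submxE; apply/eqP/rowP => l; rewrite !mxE.
  pose a i := cokermx B i l.
  have Law i : L2 (a i *: w i) by exact: L2Z.
  (* Such a combination pairs to zero with all of Pi', hence lies in Pi' by maximality of a
     Lagrangian plane; then [planeE] carries it to Pi, where p pairs to zero with it. *)
  have : Z' (\sum_i a i *: w i) \in lplane S'.
    apply/(lplane_lagrangian (Z' _)) => q qP; rewrite lform_alt.
    rewrite (coord_vbasis qP) lform_suml big1 ?oppr0// => j _.
    rewrite lformZl (triple_sum tZ')// lform_sumr.
    have /matrixP/(_ j l) := mulmx_coker B.
    rewrite !mxE => BC; rewrite [X in _ * X](_ : _ = 0) ?mulr0// -[RHS]BC.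
    by apply: eq_bigr => i _; rewrite (tripleZ tZ')// lformZr [B j i]mxE mulrC.
  rewrite -planeE; last exact: L2_sum.
  move=> /(lplane_isotropic pP) E0; rewrite -[RHS]E0 (triple_sum tZ)// lform_sumr.
  by apply: eq_bigr => i _; rewrite (tripleZ tZ)// lformZr [y 0 i]mxE mulrC.
pose p' := \sum_j x 0 j *: f`_j.
have p'P : p' \in lplane S'.
  by apply: memv_suml => j _; apply: memvZ; apply: vbasis_mem; apply: mem_nth; rewrite size_tuple.
exists p' => // v Lv; have [c cP] := wP v Lv.
have Lcw i : L2 (c i *: w i) by exact: L2Z.
have Ls : L2 (\sum_i c i *: w i) by exact: L2_sum.
have := subrK (\sum_i c i *: w i) v; have := L2B Lv Ls.
(* v splits into d, whose images lie in both planes and pair to zero with p and p', and a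
   combination of the w_i. *)
move: cP; set d := v - _ => dP Ld <-.
rewrite (tripleD tZ)// (tripleD tZ')// !lformDr (lplane_isotropic pP)//.
rewrite (lplane_isotropic p'P) -?planeE//.
rewrite !add0r (triple_sum tZ)// (triple_sum tZ')// !lform_sumr.
apply: eq_bigr => i _; rewrite (tripleZ tZ)// (tripleZ tZ')// !lformZr; congr (_ * _).
have /rowP/(_ i) := yx; rewrite !mxE => ->; rewrite lform_suml.
by apply: eq_bigr => j _; rewrite lformZl !mxE.
Qed.

(** The graph of the isomorphism sought. It is first a relation because the decomposition x = Zu + p
    is not unique; that it is single valued follows from linearity and [triple_rel0]. *)
Definition triple_rel (x : S) (y : S') : Prop := exists u p p',
  [/\ L2 u, p \in lplane S, p' \in lplane S',
    x = Z u + p /\ y = Z' u + p'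
    & forall v, L2 v -> lform p (Z v) = lform p' (Z' v)].

Lemma triple_rel_total x : exists y, triple_rel x y.
Proof.
have [u [p [Lu pP ->]]] := (proj2 tZ) x.
by have [p' p'P pp'] := lplane_transfer pP; exists (Z' u + p'), u, p, p'.
Qed.

Lemma triple_rel_lin (a : R) x1 y1 x2 y2 : triple_rel x1 y1 -> triple_rel x2 y2 ->
  triple_rel (a *: x1 + x2) (a *: y1 + y2).
Proof.
move=> [u1 [p1 [q1 [Lu1 P1 Q1 [-> ->] E1]]]] [u2 [p2 [q2 [Lu2 P2 Q2 [-> ->] E2]]]].
exists (a *: u1 + u2), (a *: p1 + p2), (a *: q1 + q2); split.
- exact: L2_lin.
- by rewrite memvD// memvZ.
- by rewrite memvD// memvZ.
- by rewrite (triple_lin tZ)// (triple_lin tZ')// !scalerDr; split; rewrite addrACA.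
- by move=> v Lv; rewrite !lformll E1// E2.
Qed.

(** From Zu = - p in Pi, y lies in Pi', so it pairs to zero with Pi'; its pairing with Z'v equals
    that of 0 with Zv. Together these exhaust Sigma'. *)
Lemma triple_rel0 y : triple_rel 0 y -> y = 0.
Proof.
move=> [u [p [p' [Lu pP p'P [x0 yE] pp']]]].
have yP : y \in lplane S'.
  rewrite yE memvD// -planeE//.
  by rewrite -[Z u]subr0 [X in _ - X]x0 opprD addrA subrr add0r memvN.
apply: lform_nondeg => z; have [v [q [Lv qP ->]]] := (proj2 tZ') z.
rewrite lformDr (lplane_isotropic yP qP) addr0 yE lformDl -formE// -pp'//.
by rewrite -lformDl -x0 lform0l.
Qed.

Lemma triple_rel_fun x y1 y2 : triple_rel x y1 -> triple_rel x y2 -> y1 = y2.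
Proof.
move=> r1 r2; have := triple_rel_lin (-1) r1 r2.
by rewrite !scaleN1r addNr => /triple_rel0/eqP; rewrite addrC subr_eq0 => /eqP.
Qed.

Lemma triple_rel_form x1 y1 x2 y2 : triple_rel x1 y1 -> triple_rel x2 y2 ->
  lform y1 y2 = lform x1 x2.
Proof.
move=> [u1 [p1 [q1 [Lu1 P1 Q1 [-> ->] E1]]]] [u2 [p2 [q2 [Lu2 P2 Q2 [-> ->] E2]]]].
rewrite !lformDl !lformDr (lplane_isotropic P1 P2) (lplane_isotropic Q1 Q2).
by rewrite formE// E1// (lform_alt _ p2) (lform_alt _ q2) E2.
Qed.

Lemma triple_rel_plane x y : triple_rel x y -> x \in lplane S -> y \in lplane S'.
Proof.
move=> [u [p [p' [Lu pP p'P [-> ->] _]]]] xP.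
by rewrite memvD// -planeE// -[Z u](addrK p) memvB.
Qed.

End Comparison.

(** The relation is symmetric in the two triples, so the inverse comes from the same construction
    with the triples exchanged. *)
Lemma triple_rel_sym (S S' : lagrangian_pair R)
  (Z : (R -> 'rV[R]_k) -> S) (Z' : (R -> 'rV[R]_k) -> S') x y :
  triple_rel Z Z' x y -> triple_rel Z' Z y x.
Proof.
move=> [u [p [p' [Lu pP p'P [-> ->] E]]]]; exists u, p', p; split => // v Lv.
by rewrite E.
Qed.

Lemma triple_iso (S S' : lagrangian_pair R)
  (Z : (R -> 'rV[R]_k) -> S) (Z' : (R -> 'rV[R]_k) -> S') :
  is_triple S Z -> is_triple S' Z' ->
  (forall u v, L2 u -> L2 v -> lform (Z u) (Z v) = lform (Z' u) (Z' v)) ->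
  (forall u, L2 u -> (Z u \in lplane S) = (Z' u \in lplane S')) ->
  exists2 Phi : 'Hom(S, S'), pair_iso S S' Phi & forall u, L2 u -> Phi (Z u) = Z' u.
Proof.
move=> tZ tZ' fE pE.
have fE' u v : L2 u -> L2 v -> lform (Z' u) (Z' v) = lform (Z u) (Z v).
  by move=> ? ?; rewrite fE.
have pE' u : L2 u -> (Z' u \in lplane S') = (Z u \in lplane S).
  by move=> ?; rewrite pE.
have [f fP] := choice (triple_rel_total tZ tZ' pE).
have [g gP] := choice (triple_rel_total tZ' tZ pE').
have uniq := triple_rel_fun tZ tZ' fE pE.
have uniq' := triple_rel_fun tZ' tZ fE' pE'.
have flin : linear f.
  move=> a x1 x2; apply: uniq (fP _) _; exact: triple_rel_lin.
pose fl : {linear S -> S'} := HB.pack f (GRing.isLinear.Build R S S' _ f flin).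
pose Phi := linfun fl.
have PhiE x : Phi x = f x by rewrite lfunE.
have gK y : f (g y) = y by apply: uniq (fP _) _; exact/triple_rel_sym.
have fK x : g (f x) = x by apply: uniq' (gP _) _; exact/triple_rel_sym.
exists Phi; first split.
- by exists g => x; rewrite PhiE.
- by move=> x y; rewrite !PhiE; exact: (triple_rel_form fE (fP x) (fP y)).
- apply/vspaceP => y; apply/idP/idP.
    move=> /memv_imgP[x xP ->]; rewrite PhiE; exact: (triple_rel_plane pE (fP x) xP).
  move=> yP; apply/memv_imgP; exists (g y); last by rewrite PhiE gK.
  exact: (triple_rel_plane pE' (gP y) yP).
move=> u Lu; rewrite PhiE; apply: uniq (fP _) _; exists u, 0, 0.
by rewrite !mem0v !addr0; split => // v _; rewrite !lform0l.
Qed.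

Lemma triple_comp (S : lagrangian_pair R) (Z : (R -> 'rV[R]_k) -> S) K V
    (Phi : 'Hom(S, S)) : stab S Phi -> is_triple S Z -> represents S Z K V ->
  is_triple S (Phi \o Z) /\ represents S (Phi \o Z) K V.
Proof.
move=> [[g gK Kg] form plane] [[lin bnd] tr] [rep1 rep2].
have PP x : (Phi x \in lplane S) = (x \in lplane S).
  rewrite -{1}plane; apply/memv_imgP/idP => [[y yP /(can_inj gK) ->//]|xP].
  by exists x.
split; split.
- split=> [a u v Lu Lv|l lsc]; first by rewrite /= lin// linearP.
  by apply: (bnd (l \o Phi)) => a x y; rewrite /= linearP lsc.
- move=> x; have [u [p [Lu pP gx]]] := tr (g x).
  exists u, (Phi p); split=> //; first by rewrite PP.
  by rewrite -[LHS]Kg gx linearD.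
- by move=> u v Lu Lv; rewrite /= form rep1.
- by move=> u; rewrite /= PP.
Qed.

Lemma pair_iso_comp (S S' S'' : lagrangian_pair R)
    (Phi : 'Hom(S, S')) (Psi : 'Hom(S', S'')) :
  pair_iso S S' Phi -> pair_iso S' S'' Psi -> pair_iso S S'' (Psi \o Phi)%VF.
Proof.
move=> [bPhi fPhi pPhi] [bPsi fPsi pPsi]; split.
- by apply: (eq_bij (bij_comp bPsi bPhi)) => x; rewrite comp_lfunE.
- by move=> x y; rewrite !comp_lfunE fPsi.
- by rewrite limg_comp pPhi.
Qed.

(** An arbitrary identification Psi of the pairs, preceded by the isomorphism that sends Z to Z', is
    an automorphism of (Sigma, Pi): this is the required Phi. *)
Lemma triple_unique (S S' : lagrangian_pair R) (Z : (R -> 'rV[R]_k) -> S)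
    (Z' : (R -> 'rV[R]_k) -> S') K V :
  is_triple S Z -> represents S Z K V -> is_triple S' Z' -> represents S' Z' K V ->
  (exists Psi : 'Hom(S', S), pair_iso S' S Psi) /\
  (forall Psi : 'Hom(S', S), pair_iso S' S Psi ->
    exists2 Phi : 'Hom(S, S), stab S Phi & forall u, L2 u -> Psi (Z' u) = Phi (Z u)).
Proof.
move=> tZ [rf rp] tZ' [rf' rp'].
have fE u v : L2 u -> L2 v -> lform (Z u) (Z v) = lform (Z' u) (Z' v).
  by move=> Lu Lv; rewrite -rf// -rf'.
have pE u : L2 u -> (Z u \in lplane S) = (Z' u \in lplane S').
  move=> Lu; apply/idP/idP => H.
    by have [] := (rp' u).1 ((rp u).2 (conj Lu H)).
  by have [] := (rp u).1 ((rp' u).2 (conj Lu H)).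
split.
  have [u v Lu Lv|u Lu|Psi Pi _] := @triple_iso _ _ _ _ tZ' tZ.
  - by rewrite fE.
  - by rewrite pE.
  - by exists Psi.
move=> Psi PsiP; have [Phi PhiP PhiZ] := triple_iso tZ tZ' fE pE.
exists (Psi \o Phi)%VF; first exact: pair_iso_comp PhiP PsiP.
by move=> u Lu; rewrite comp_lfunE PhiZ.
Qed.

End TripleUniqueness.

(** * Normal form of the skew part *)

Section NormalForm.
Set Implicit Arguments.
Unset Strict Implicit.
Context {R : realType} {k : nat}.
Notation mu := (@lebesgue_measure R).
Implicit Types (u v w : R -> 'rV[R]_k) (V : set (R -> 'rV[R]_k))
  (K : (R -> 'rV[R]_k) -> (R -> 'rV[R]_k)).

Definition ip_orthonormal (m : nat) (w : 'I_m -> R -> 'rV[R]_k) : Prop :=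
  forall i j, ip (w i) (w j) = (i == j)%:R.

(** The conclusion compares annihilators and not spans: that is all that is used, and it is
    insensitive to null functions. *)
Lemma gram_schmidt (n : nat) (z : 'I_n -> R -> 'rV[R]_k) : (forall j, L2 (z j)) ->
  exists (m : nat) (w : 'I_m -> R -> 'rV[R]_k),
  [/\ forall i, L2 (w i), ip_orthonormal w
    & forall u, L2 u -> (forall j, ip (z j) u = 0) <-> (forall i, ip (w i) u = 0)].
Proof.
elim: n z => [|n IH] z Lz.
  exists 0%N, (fun=> 0); split; [move=> []//|move=> []//|].
  by move=> u Lu; split=> _ [].
have [m [w [Lw ow wP]]] := IH (fun j => z (lift ord_max j)) (fun j => Lz _).
pose zn := z ord_max.
have Lzn : L2 zn by exact: Lz.
have Lcw i : L2 (ip (w i) zn *: w i) by exact: L2Z.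
have Ls : L2 (\sum_i ip (w i) zn *: w i) by exact: L2_sum.
pose x := zn - \sum_i ip (w i) zn *: w i.
have Lx : L2 x by exact: L2B.
have xw i : ip (w i) x = 0.
  rewrite ipBr// ip_sumr// (bigD1 i)//= ipZr// ow eqxx mulr1 big1 ?addr0 ?subrr//.
  by move=> j ji; rewrite ipZr// ow eq_sym (negPf ji) mulr0.
have znE u : L2 u -> (forall i, ip (w i) u = 0) -> ip zn u = ip x u.
  move=> Lu wu; rewrite /x ipBl// ip_suml// big1 ?subr0// => i _.
  by rewrite ipZl// wu mulr0.
have ordP (P : 'I_n.+1 -> Prop) :
    (forall j, P j) <-> (forall j, P (lift ord_max j)) /\ P ord_max.
  by split=> [H|[H1 H2] j]; [split|case: (unliftP ord_max j) => [j' ->|->]].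
(* A null residue adds no condition and is dropped; otherwise it is normalized and appended. *)
have [x0|x0] := eqVneq (ip x x) 0.
  exists m, w; split => // u Lu; rewrite ordP wP//; split => [[//]|wu]; split => //.
  by rewrite -/zn znE// (ip_ael Lx (@L2_0 R k) Lu) ?ip0l//; exact: ip_eq0.
pose c := (Num.sqrt (ip x x))^-1.
have c0 : c != 0.
  by rewrite invr_eq0 sqrtr_eq0 -ltNge lt_neqAle eq_sym x0 ip_ge0.
pose w' (i : 'I_m.+1) := if unlift ord_max i is Some j then w j else c *: x.
have w'l j : w' (lift ord_max j) = w j by rewrite /w' liftK.
have w'm : w' ord_max = c *: x by rewrite /w' unlift_none.
exists m.+1, w'; split.
- by move=> i; case: (unliftP ord_max i) => [j ->|->]; rewrite ?w'l ?w'm//; exact: L2Z.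
- move=> i i'; case: (unliftP ord_max i) => [j ->|->]; rewrite ?w'l ?w'm;
    case: (unliftP ord_max i') => [j' ->|->]; rewrite ?w'l ?w'm.
  + by rewrite ow (inj_eq lift_inj).
  + by rewrite ipZr// xw mulr0 eq_sym (negPf (neq_lift _ _)).
  + by rewrite ipZl// ipC xw mulr0 (negPf (neq_lift _ _)).
  + rewrite ipZl// ?ipZr//; last exact: L2Z.
    rewrite eqxx mulrA -expr2 exprVn sqr_sqrtr ?ip_ge0//.
    by rewrite mulVf.
move=> u Lu; rewrite ordP wP//; split=> [[wu zu] i|wu].
  case: (unliftP ord_max i) => [j ->|->]; rewrite ?w'l ?w'm//.
  by rewrite ipZl// -znE// zu mulr0.
have wu' i : ip (w i) u = 0 by have := wu (lift ord_max i); rewrite w'l.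
split => //; have := wu ord_max; rewrite w'm ipZl// => /eqP.
by rewrite mulf_eq0 (negPf c0)/= -/zn znE// => /eqP.
Qed.

(** Subtracting from generators of a complement their projections on V yields generators of the
    orthogonal complement, which are then orthonormalized. *)
Lemma closed_fincodim_orthonormal V : closed_fincodim V ->
  exists (m : nat) (w : 'I_m -> R -> 'rV[R]_k),
  [/\ forall i, L2 (w i), ip_orthonormal w
    & forall u, V u <-> L2 u /\ forall i, ip (w i) u = 0].
Proof.
move=> [VL2 V0 Vlin Vcl [n [x [Lx xP]]]].
have /choice[p pP] : forall j, exists p, V p /\ forall v, V v -> ip (x j - p) v = 0.
  by move=> j; have [p] := projection VL2 V0 Vlin Vcl (Lx j); exists p.
have Vp j : V (p j) by have [] := pP j.
have Lp j : L2 (p j) := VL2 _ (Vp j).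
have Lz j : L2 (x j - p j) by exact: L2B.
have [m [w [Lw ow wP]]] := gram_schmidt Lz.
exists m, w; split => // u; split=> [Vu|[Lu /(wP u Lu) zu]].
  have Lu := VL2 _ Vu; split => //; apply/wP => // j.
  by have [_] := pP j; exact.
have [c cP] := xP u Lu.
(* The component of u orthogonal to V. Both u and u - s are orthogonal to every x_j - p_j, so s is
   null and u is in V almost everywhere, hence in V. *)
pose s := \sum_j c j *: (x j - p j).
have Lcz j : L2 (c j *: (x j - p j)) by exact: L2Z.
have Ls : L2 s by exact: L2_sum.
have Vus : V (u - s).
  have -> : u - s = (u - \sum_j c j *: x j) + \sum_j c j *: p j.
    have -> : s = \sum_j c j *: x j - \sum_j c j *: p j.
      by rewrite -sumrB; apply: eq_bigr => j _; rewrite scalerBr.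
    by rewrite opprB addrA addrAC.
  apply: (subspaceD Vlin) => //; apply: (subspace_sum V0 Vlin) => j.
  exact: (subspaceZ V0 Vlin).
have ss : ip s s = 0.
  have Lus := VL2 _ Vus.
  have -> : ip s s = ip s u - ip s (u - s) by rewrite ipBr// opprB addrC subrK.
  have s0 f : L2 f -> (forall j, ip (x j - p j) f = 0) -> ip s f = 0.
    by move=> Lf zf; rewrite /s ip_suml// big1// => j _; rewrite ipZl// zf mulr0.
  by rewrite !s0 ?subrr// => j; have [_] := pP j; exact.
apply: (subspace_ae VL2 Vcl Vus Lu).
have := ip_eq0 Ls ss; apply: ae_imply => t _ st.
by rewrite -[LHS]/(u t - s t) st subr0.
Qed.

(* The form <Au, v> vanishes on V x V: expand it along the decomposition
   u = (u - Pu) + Pu, where P projects onto the span of the [w i], and share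
   the term <A Pu, Pv> equally between both sums. *)
Lemma skew_part_normal_form K V : closed_fincodim V -> volterra_HS K ->
  symmetric_on V K ->
  exists (m : nat) (w y : 'I_m -> R -> 'rV[R]_k),
  [/\ forall i, L2 (w i), forall i, L2 (y i), ip_orthonormal w,
      forall u, V u <-> L2 u /\ forall i, ip (w i) u = 0
    & forall u v, L2 u -> L2 v -> ip (skew_part K u) v =
        \sum_i (ip (y i) u * ip (w i) v - ip (w i) u * ip (y i) v)].
Proof.
move=> cV vK sK; have [m [w [Lw ow wP]]] := closed_fincodim_orthonormal cV.
pose a u v := ip (skew_part K u) v.
have [LK _] := vK.
have aE u v : L2 u -> L2 v -> a u v = 2^-1 * (ip (K u) v - ip (K v) u).
  by move=> Lu Lv; rewrite /a ip_skew_part.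
have aN u v : L2 u -> L2 v -> a u v = - a v u.
  by move=> Lu Lv; rewrite !aE// -mulrN opprB.
have LA u : L2 u -> L2 (skew_part K u) by exact: L2_skew_part.
have aDr u v x : L2 u -> L2 v -> L2 x -> a u (v + x) = a u v + a u x.
  by move=> Lu Lv Lx; rewrite /a ipDr//; exact: LA.
have aBr u v x : L2 u -> L2 v -> L2 x -> a u (v - x) = a u v - a u x.
  by move=> Lu Lv Lx; rewrite /a ipBr//; exact: LA.
have aZr c u v : L2 u -> L2 v -> a u (c *: v) = c * a u v.
  by move=> Lu Lv; rewrite /a ipZr//; exact: LA.
have aBl u v x : L2 u -> L2 v -> L2 x -> a (u - v) x = a u x - a v x.
  move=> Lu Lv Lx; rewrite aN ?aBr//; last exact: L2B.
  by rewrite (aN x u)// (aN x v)// opprB opprK addrC.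
have aV u v : V u -> V v -> a u v = 0.
  move=> Vu Vv; have Lu := (cf_sub cV) _ Vu; have Lv := (cf_sub cV) _ Vv.
  by rewrite aE// -(sK _ _ Vu Vv) (ipC u) subrr mulr0.
have a_def u v : a u v = ip (skew_part K u) v by [].
clearbody a.
pose P u := \sum_j ip (w j) u *: w j.
have Lcw c j : L2 (c *: w j) by exact: L2Z.
have LP u : L2 (P u) by apply: L2_sum.
have VP u : L2 u -> V (u - P u).
  move=> Lu; apply/wP; split; first exact: L2B.
  move=> i; rewrite ipBr// ip_sumr// (bigD1 i)//= ipZr// ow eqxx mulr1.
  rewrite big1 ?addr0 ?subrr// => j ji.
  by rewrite ipZr// ow eq_sym (negPf ji) mulr0.
have aPr u v : L2 u -> a u (P v) = \sum_i ip (w i) v * a u (w i).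
  move=> Lu; rewrite a_def ip_sumr//; last exact: LA.
  by apply: eq_bigr => i _; rewrite a_def ipZr//; exact: LA.
have P_def u : P u = \sum_j ip (w j) u *: w j by [].
clearbody P.
(* Chosen so that <y_i, u> = a(u, w_i) - a(Pu, w_i) / 2: skewness accounts for the first sign, and
   the sum over j is the half of the shared term. *)
pose y i := - skew_part K (w i) - \sum_j (2^-1 * a (w j) (w i)) *: w j.
have Lsum i : L2 (\sum_j (2^-1 * a (w j) (w i)) *: w j) by exact: L2_sum.
have LNA i : L2 (- skew_part K (w i)) by apply: L2N; exact: LA.
have Ly i : L2 (y i) by exact: L2B.
have yE i u : L2 u -> ip (y i) u = a u (w i) - 2^-1 * a (P u) (w i).
  move=> Lu; rewrite /y ipBl// ipNl//; last exact: LA.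
  rewrite -a_def -(aN u)//; congr (_ - _).
  rewrite (aN (P u))// aPr// ip_suml// mulrN mulr_sumr -sumrN.
  apply: eq_bigr => j _; rewrite ipZl// (aN (w j))//; ring.
clearbody y; exists m, w, y; split => // u v Lu Lv; rewrite -a_def.
(* This is a(u - Pu, v - Pv) = 0, expanded. *)
have H : a u v = a u (P v) + a (P u) v - a (P u) (P v).
  have := aV _ _ (VP u Lu) (VP v Lv); have LPv := LP v; have LPu := LP u.
  by rewrite aBl ?aBr//; [lra|exact: L2B].
rewrite H sumrB.
have -> : \sum_i ip (y i) u * ip (w i) v = a u (P v) - 2^-1 * a (P u) (P v).
  rewrite !aPr// mulr_sumr -sumrB; apply: eq_bigr => i _; rewrite yE//; ring.
have -> : \sum_i ip (w i) u * ip (y i) v = a v (P u) - 2^-1 * a (P v) (P u).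
  rewrite !aPr// mulr_sumr -sumrB; apply: eq_bigr => i _; rewrite yE//; ring.
rewrite (aN v)// (aN (P v))//; lra.
Qed.

End NormalForm.

(** * The standard triple and existence *)

Section StandardTriple.
Set Implicit Arguments.
Unset Strict Implicit.
Context {R : realType}.

Section Pair.
Variable m : nat.
Let S : vectType R := ('rV[R]_m * 'rV[R]_m)%type.
Let form (X Y : S) : R := sigma X Y.

Lemma sigma_symplectic : symplectic_form form.
Proof.
split.
- move=> X a Y Z; rewrite /form /sigma /= dotDr dotZr dotDr dotZr; ring.
- move=> Y a X Z; rewrite /form /sigma /= dotDl dotZl dotDl dotZl; ring.
- by move=> X; rewrite /form /sigma dotC subrr.
- move=> [x1 x2] H.
  have := H (x2, 0); rewrite /form /sigma /= dot0r subr0 => /dot_eq0 ->.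
  by have := H (0, x1); rewrite /form /sigma /= dot0r sub0r => /eqP;
     rewrite oppr_eq0 => /eqP/dot_eq0 ->.
Qed.

Let plane : {vspace S} := lker (linfun (fst : S -> 'rV[R]_m)).

Lemma mem_sigma_plane (X : S) : (X \in plane) = (X.1 == 0).
Proof. by rewrite memv_ker lfunE. Qed.

Lemma sigma_lagrangian : lagrangian form plane.
Proof.
move=> X; split.
  rewrite mem_sigma_plane => /eqP X0 Y; rewrite mem_sigma_plane => /eqP Y0.
  by rewrite /form /sigma X0 Y0 dot0l dot0r subrr.
move=> H; have := H (0, X.1); rewrite mem_sigma_plane eqxx => /(_ isT).
rewrite /form /sigma /= dot0r sub0r => /eqP; rewrite oppr_eq0.
by move=> /eqP/dot_eq0 X0; rewrite mem_sigma_plane X0.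
Qed.

(** The model T_0(T^*R^m) with its vertical plane, in the sign convention of [sigma]. *)
Definition standard_pair : lagrangian_pair R :=
  LagrangianPair sigma_symplectic sigma_lagrangian.

End Pair.

Context {k : nat}.
Implicit Types (u v : R -> 'rV[R]_k).

Lemma row_scalar_sum (m : nat) (f : 'rV[R]_m -> R) :
  (forall a x y, f (a *: x + y) = a * f x + f y) ->
  forall x, f x = \sum_i x 0 i * f (delta_mx 0 i).
Proof.
move=> flin x.
have f0 : f 0 = 0.
  by have := flin 1 0 0; rewrite scaler0 addr0 mul1r -{1}[f 0]addr0 => /addrI/esym.
rewrite {1}(row_sum_delta x); elim/big_rec2: _ => // i a b _ <-.
by rewrite flin.
Qed.

(** Transversality rests on orthonormality: combinations of the w_i reach every first component, and
    Pi supplies any second one. *)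
Lemma standard_triple (m : nat) (w y : 'I_m -> R -> 'rV[R]_k) :
  (forall i, L2 (w i)) -> (forall i, L2 (y i)) -> ip_orthonormal w ->
  is_triple (standard_pair m)
    (fun u => (\row_i ip (w i) u, \row_i ip (y i) u) : 'rV[R]_m * 'rV[R]_m).
Proof.
move=> Lw Ly ow; split; first split.
- move=> a u v Lu Lv; congr pair; apply/rowP => i; rewrite !mxE.
    by rewrite ipDr ?ipZr//; exact: L2Z.
  by rewrite ipDr ?ipZr//; exact: L2Z.
- move=> l lsc.
  have l1 (a : R) (x z : 'rV[R]_m) : l (a *: x + z, 0) = a * l (x, 0) + l (z, 0).
    rewrite -lsc; congr l.
    by rewrite -[RHS]/(a *: x + z, a *: 0 + 0) scaler0 addr0.
  have l2 (a : R) (x z : 'rV[R]_m) : l (0, a *: x + z) = a * l (0, x) + l (0, z).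
    rewrite -lsc; congr l.
    by rewrite -[RHS]/(a *: 0 + 0, a *: x + z) scaler0 addr0.
  pose e1 i : R := l (delta_mx 0 i, 0); pose e2 i : R := l (0, delta_mx 0 i).
  exists (\sum_i (normL2 (w i) * `|e1 i| + normL2 (y i) * `|e2 i|)) => u Lu.
  have -> : l (\row_i ip (w i) u, \row_i ip (y i) u) =
      \sum_i (ip (w i) u * e1 i + ip (y i) u * e2 i).
    transitivity (l (\row_i ip (w i) u, 0) + l (0, \row_i ip (y i) u)).
      rewrite -[X in _ = X + _]mul1r -lsc; congr l; set x := \row_i _.
      set z := \row_i _; rewrite -[RHS]/(1 *: x + 0, 1 *: 0 + z).
      by rewrite scale1r scaler0 addr0 add0r.
    rewrite (row_scalar_sum l1) (row_scalar_sum l2) -big_split.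
    by apply: eq_bigr => i _; rewrite !mxE.
  rewrite mulr_suml; apply: le_trans (ler_norm_sum _ _ _) _; apply: ler_sum => i _.
  apply: le_trans (ler_normD _ _) _; rewrite mulrDl !normrM.
  rewrite ![_ * `|_| * normL2 u]mulrAC.
  by apply: lerD; rewrite ler_wpM2r// ip_le.
- move=> [x1 x2].
  pose u := \sum_i x1 0 i *: w i.
  have Lxw i : L2 (x1 0 i *: w i) by exact: L2Z.
  have Lu : L2 u by exact: L2_sum.
  exists u, ((0, x2 - \row_i ip (y i) u) : 'rV[R]_m * 'rV[R]_m); split => //.
    by rewrite mem_sigma_plane.
  congr pair; last by rewrite addrC subrK.
  rewrite addr0; apply/rowP => i; rewrite mxE ip_sumr// (bigD1 i)//= ipZr// ow.
  rewrite eqxx mulr1 big1 ?addr0// => j ji.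
  by rewrite ipZr// ow eq_sym (negPf ji) mulr0.
Qed.

Lemma standard_form (m : nat) (w y : 'I_m -> R -> 'rV[R]_k) u v :
  @lform _ (standard_pair m) (\row_i ip (w i) u, \row_i ip (y i) u)
    (\row_i ip (w i) v, \row_i ip (y i) v) =
  \sum_i (ip (y i) u * ip (w i) v - ip (w i) u * ip (y i) v).
Proof.
by rewrite /= /sigma /dot -sumrB; apply: eq_bigr => i _; rewrite !mxE.
Qed.

Lemma triple_exists K V : closed_fincodim V -> volterra_HS K -> symmetric_on V K ->
  exists (S : lagrangian_pair R) (Z : (R -> 'rV[R]_k) -> S),
    is_triple S Z /\ represents S Z K V.
Proof.
move=> cV vK sK; have [m [w [y [Lw Ly ow VP aE]]]] := skew_part_normal_form cV vK sK.
exists (standard_pair m), (fun u => (\row_i ip (w i) u, \row_i ip (y i) u)).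
split; first exact: standard_triple.
split=> [u v Lu Lv|u]; first by rewrite standard_form aE.
rewrite VP mem_sigma_plane; split=> [[Lu wu]|[Lu /eqP/rowP wu]]; split => //.
  by apply/eqP/rowP => i; rewrite !mxE.
by move=> i; have := wu i; rewrite !mxE.
Qed.

End StandardTriple.

(** * From a triple to its operator *)

Section OperatorOfTriple.
Set Implicit Arguments.
Unset Strict Implicit.
Context {R : realType} {k : nat}.
Notation mu := (@lebesgue_measure R).
Implicit Types (u v w : R -> 'rV[R]_k) (V : set (R -> 'rV[R]_k))
  (K : (R -> 'rV[R]_k) -> (R -> 'rV[R]_k)).

Lemma volterra_skew_determines K1 K2 : volterra_HS K1 -> volterra_HS K2 ->
  (forall u v, L2 u -> L2 v -> ip (skew_part K1 u) v = ip (skew_part K2 u) v) ->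
  forall u, L2 u -> ae_eq mu I01 (K1 u) (K2 u).
Proof.
move=> vK1 vK2 eqA; apply: volterra_unique => // u v Lu Lv.
have := etrans (esym (ip_skew_part vK1 Lu Lv))
  (etrans (eqA u v Lu Lv) (ip_skew_part vK2 Lu Lv)).
by apply: mulfI; rewrite invr_eq0 pnatr_eq0.
Qed.

(** Riesz applied to each coordinate writes Z as an integral against a square integrable density. *)
Lemma triple_coordinates (S : lagrangian_pair R) (Z : (R -> 'rV[R]_k) -> S) :
  is_triple S Z -> exists z : 'I_(\dim {:S}) -> R -> 'rV[R]_k,
    (forall a, L2 (z a)) /\
    forall u, L2 u -> Z u = \sum_a ip (z a) u *: (vbasis {:S})`_a.
Proof.
move=> [[lin bnd] _]; pose e := vbasis {:S}.
have /choice[z zP] : forall a : 'I_(\dim {:S}), exists z, L2 z /\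
    forall u, L2 u -> coord e a (Z u) = ip z u.
  move=> a; have [|C CP] := bnd (coord e a); first by move=> c x y; rewrite linearP.
  have [|z Lz zP] := @Riesz R k (fun u => coord e a (Z u)) C _ CP.
    by move=> c u v Lu Lv; rewrite lin// linearP.
  by exists z.
exists z; split=> [a|u Lu]; first by have [] := zP a.
rewrite {1}(coord_vbasis (memvf (Z u))); apply: eq_bigr => a _.
by have [_ ->] := zP a.
Qed.

(** Closedness: the Lagrangian plane is the common zero set of the forms sigma(., q) for q in Pi,
    each of which is bounded when composed with Z. *)
Lemma triple_closed_fincodim (S : lagrangian_pair R) (Z : (R -> 'rV[R]_k) -> S) :
  is_triple S Z -> closed_fincodim [set u | L2 u /\ Z u \in lplane S].
Proof.
move=> tZ; have [[lin bnd] _] := tZ; split.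
- by move=> u [].
- by split; [exact: L2_0|rewrite (triple0 tZ) mem0v].
- move=> a u v [Lu Zu] [Lv Zv]; split; first exact: L2_lin.
  by rewrite (triple_lin tZ)// memvD// memvZ.
- move=> w u wV Lu wu; split => //; apply/(lplane_lagrangian (Z u)) => q qP.
  have [|C CP] := bnd (fun x => lform x q).
    by move=> a x y; rewrite lformll.
  apply: (@cst_cvg0_eq0 _ _ (fun n => C * normL2 (w n - u))) => [n|].
    have [Lw Zw] := wV n; apply: le_trans (CP _ (L2B Lw Lu)).
    rewrite (tripleB tZ)// -scaleN1r addrC lformll (lplane_isotropic Zw qP).
    by rewrite addr0 mulN1r normrN.
  by rewrite -[X in _ --> X](mulr0 C); apply: cvgM => //; exact: cvg_cst.
- have [n [w [Lw wP]]] := triple_span tZ; exists n, w; split => // u Lu.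
  have [c cP] := wP u Lu; exists c; split => //.
  by apply: L2B => //; apply: L2_sum => i; exact: L2Z.
Qed.

Lemma triple_operator (S : lagrangian_pair R) (Z : (R -> 'rV[R]_k) -> S) :
  is_triple S Z ->
  exists K V, [/\ closed_fincodim V, volterra_HS K, symmetric_on V K,
    represents S Z K V
    & forall K' V', volterra_HS K' -> represents S Z K' V' ->
        V' = V /\ forall u, L2 u -> ae_eq mu I01 (K' u) (K u)].
Proof.
move=> tZ; have [z [Lz ZE]] := triple_coordinates tZ.
pose n := \dim {:S}; pose e := vbasis {:S}.
pose J := ('I_n * 'I_n)%type.
pose c (j : J) : R := lform e`_j.1 e`_j.2.
(* With c the matrix of sigma in the basis e, A has the kernel sum c_ab z_b(t) z_a(tau); the 2
   cancels the factor 2^-1 of [ip_skew_sep_op]. *)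
pose g (j : J) := (2 * c j) *: z j.2; pose h (j : J) := z j.1.
have Lg j : L2 (g j) by exact: L2Z.
have Lh j : L2 (h j) by exact: Lz.
have anti t tau i l :
    \sum_j g j t 0 i * h j tau 0 l = - \sum_j g j tau 0 l * h j t 0 i.
  pose swap (j : J) : J := (j.2, j.1).
  have swapK : involutive swap by case.
  rewrite (reindex_inj (inv_inj swapK)) -sumrN; apply: eq_bigr => -[a b] _.
  rewrite /g /h /c /swap /= !mxE lform_alt; ring.
pose K := sep_op g h.
have vK : volterra_HS K by exact: sep_op_volterra.
pose V := [set u | L2 u /\ Z u \in lplane S].
have AE u v : L2 u -> L2 v -> ip (skew_part K u) v = lform (Z u) (Z v).
  move=> Lu Lv; rewrite ip_skew_sep_op// !ZE// lform_suml mulr_sumr.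
  rewrite -(pair_bigA _ (fun a b => 2^-1 * (ip (h (a, b)) u * ip (g (a, b)) v)))/=.
  apply: eq_bigr => a _; rewrite lformZl lform_sumr mulr_sumr.
  by apply: eq_bigr => b _; rewrite lformZr /g /h /c ipZl//=; field.
clearbody K; have rep : represents S Z K V by split.
exists K, V; split => //.
- exact: triple_closed_fincodim.
(* Pi is isotropic, so the form of A vanishes on V x V, which is the symmetry of K there. *)
- move=> u v [Lu Zu] [Lv Zv]; have := AE u v Lu Lv.
  rewrite (lplane_isotropic Zu Zv) ip_skew_part// (ipC u) => /eqP.
  by rewrite mulf_eq0 invr_eq0 pnatr_eq0/= subr_eq0 => /eqP.
move=> K' V' vK' [rep1 rep2]; split.
  by apply/seteqP; split => u /rep2.
apply: (volterra_skew_determines vK' vK) => u v Lu Lv.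
exact: etrans (rep1 _ _ Lu Lv) (esym (AE _ _ Lu Lv)).
Qed.

End OperatorOfTriple.

(** * Realization by a linear-quadratic problem *)

Section SmoothFunctions.
Set Implicit Arguments.
Unset Strict Implicit.
Context {R : realType}.

(** An exact second order expansion along the line gives the derivative directly; the derivatives in
    b that define Z_t and H_t below are of this kind. *)
Lemma derive_quadratic (E F : normedModType R) (f : E -> F) (a v : E) (c d : F) :
  (forall h : R, f (h *: v + a) = f a + h *: c + (h ^+ 2) *: d) -> 'D_v f a = c.
Proof.
move=> fE; rewrite /derive; apply: cvg_lim; first exact: norm_hausdorff.
have H : (fun h : R => c + h *: d) @ (0 : R)^' --> c.
  rewrite -[X in _ --> X](addr0 c) -[X in _ --> _ + X](scale0r d).
  apply: cvgD; first exact: cvg_cst.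
  apply: cvgZl; apply: cvg_within_filter; exact: cvg_id.
apply: cvg_trans H; apply: near_eq_cvg; near=> h.
have h0 : h != 0 by near: h; exact: nbhs_dnbhs_neq.
rewrite [(f \o _) _]fE -[f a + _ + _]addrA [f a + _]addrC addrK.
by rewrite scalerDr !scalerA mulVf// scale1r expr2 mulrA mulVf// mul1r.
Unshelve. all: by end_near. Qed.

Lemma derive_affine (E F : normedModType R) (f : E -> F) (a v : E) (c : F) :
  (forall h : R, f (h *: v + a) = f a + h *: c) -> 'D_v f a = c.
Proof.
by move=> fE; apply: (@derive_quadratic _ _ _ _ _ _ 0) => h; rewrite fE scaler0 addr0.
Qed.

Section OnE.
Variable E : normedModType R.

Lemma smooth_derive (F : normedModType R) (f : E -> F) v :
  smooth_on setT f -> smooth_on setT ('D_v f).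
Proof. by move=> sf m; have [_] := sf m.+1; exact. Qed.

Lemma smooth_differentiable (F : normedModType R) (f : E -> F) x :
  smooth_on setT f -> differentiable f x.
Proof. by move=> sf; have [+ _] := sf 1%N; exact. Qed.

Lemma smooth_continuous (F : normedModType R) (f : E -> F) :
  smooth_on setT f -> continuous f.
Proof. by move=> sf x; exact: (sf 0%N x). Qed.

Lemma smooth_derivable (F : normedModType R) (f : E -> F) x v :
  smooth_on setT f -> derivable f x v.
Proof. by move=> sf; apply: diff_derivable; exact: smooth_differentiable. Qed.

Lemma smooth_cst (F : normedModType R) (c : F) : smooth_on setT (cst c : E -> F).
Proof.
move=> m; elim: m c => [|m IH] c; first by move=> x _; exact: cvg_cst.
split=> [x _|v]; first exact: differentiable_cst.
have -> : 'D_v (cst c) = cst 0 :> (E -> F) by apply/funext => x; rewrite derive_cst.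
exact: IH.
Qed.

Lemma smooth_linear (F : normedModType R) (f : {linear E -> F}) :
  continuous f -> smooth_on setT f.
Proof.
move=> cf [|m]; first by move=> x _; exact: cf.
split=> [x _|v]; first exact: linear_differentiable.
have -> : 'D_v f = cst (f v).
  by apply/funext => x; apply: derive_affine => h; rewrite linearP addrC.
exact: smooth_cst.
Qed.

Lemma CmD (F : normedModType R) n (f g : E -> F) :
  Cm n setT f -> Cm n setT g -> Cm n setT (f + g).
Proof.
elim: n f g => [|n IH] f g Cf Cg.
  by move=> x xT; apply: cvgD; [exact: Cf|exact: Cg].
have [df Df] := Cf; have [dg Dg] := Cg; split=> [x xT|v].
  by apply: differentiableD; [exact: df|exact: dg].
have -> : 'D_v (f + g) = 'D_v f + 'D_v g.
  apply/funext => x; rewrite deriveD//; apply: diff_derivable.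
    exact: df.
  exact: dg.
by apply: IH; [exact: Df|exact: Dg].
Qed.

Lemma smoothD (F : normedModType R) (f g : E -> F) :
  smooth_on setT f -> smooth_on setT g -> smooth_on setT (f + g).
Proof. by move=> sf sg n; apply: CmD; [exact: sf|exact: sg]. Qed.

Lemma smoothM (f g : E -> R) :
  smooth_on setT f -> smooth_on setT g -> smooth_on setT (f * g).
Proof.
(* Smoothness at all orders is kept in the induction, because the Leibniz rule multiplies one factor
   by a derivative of the other. *)
suff H n : forall f g : E -> R, smooth_on setT f -> smooth_on setT g -> Cm n setT (f * g).
  by move=> sf sg n; exact: H.
elim: n => [|n IH] {}f {}g sf sg.
  move=> x _; apply: cvgM; exact: smooth_continuous.
split=> [x _|v]; first by apply: differentiableM; exact: smooth_differentiable.
have -> : 'D_v (f * g) = f * 'D_v g + g * 'D_v f.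
  by apply/funext => x; rewrite deriveM//; exact: smooth_derivable.
by apply: CmD; apply: IH => //; exact: smooth_derive.
Qed.

Lemma smoothZ (c : R) (f : E -> R) : smooth_on setT f -> smooth_on setT (c *: f).
Proof.
move=> sf; have -> : c *: f = cst c * f by apply/funext.
by apply: smoothM => //; exact: smooth_cst.
Qed.

Lemma smooth_sum (I : Type) (s : seq I) (f : I -> E -> R) :
  (forall i, smooth_on setT (f i)) -> smooth_on setT (\sum_(i <- s) f i).
Proof.
move=> sf; elim/big_ind: _ => //; [exact: (smooth_cst (0 : R))|exact: smoothD].
Qed.

Lemma derive_comb (I : Type) (s : seq I) (c : I -> R) (f : I -> E -> R) v :
  (forall i, smooth_on setT (f i)) ->
  'D_v (\sum_(i <- s) c i *: f i) = \sum_(i <- s) c i *: 'D_v (f i).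
Proof.
move=> sf; elim: s => [|i s IH].
  by rewrite !big_nil; apply/funext => x; rewrite (derive_cst (0 : R)).
rewrite !big_cons -IH; apply/funext => x.
have si : derivable (c i *: f i) x v.
  by apply: smooth_derivable; exact: smoothZ.
have ss : derivable (\sum_(j <- s) c j *: f j) x v.
  by apply: smooth_derivable; apply: smooth_sum => j; exact: smoothZ.
rewrite deriveD//; congr (_ + _); apply: deriveZ; exact: smooth_derivable.
Qed.

Lemma smooth_iter_derive (s : seq E) (f : E -> R) :
  smooth_on setT f -> smooth_on setT (iter_derive s f).
Proof. by move=> sf; elim: s => //= v s IH; exact: smooth_derive. Qed.

Lemma iter_derive_comb (I : finType) (c : I -> R) (f : I -> E -> R) (s : seq E) :
  (forall i, smooth_on setT (f i)) ->
  iter_derive s (\sum_i c i *: f i) = \sum_i c i *: iter_derive s (f i).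
Proof.
move=> sf; elim: s => //= v s ->.
by rewrite derive_comb// => i; exact: smooth_iter_derive.
Qed.

(** When time enters only through square integrable coefficients, space derivatives fall on the f_i
    alone, and continuity bounds each near x by its norm there plus 1. *)
Lemma L2_smooth_comb (I : finType) (c : I -> R -> R) (f : I -> E -> R) :
  (forall i, sqint (c i)) -> (forall i, smooth_on setT (f i)) ->
  L2_smooth setT (fun t => \sum_i c i t *: f i).
Proof.
move=> sc sf.
have appE (a : I -> R) (g : I -> E -> R) x : (\sum_i a i *: g i) x = \sum_i a i * g i x.
  by rewrite fct_sumE.
split.
- by move=> t _; apply: smooth_sum => i; exact: smoothZ.
- move=> x _; under eq_fun do rewrite appE.
  apply: measurable_sum => i; apply: measurable_funM => //; exact: (sc i).1.
move=> s x _; pose B i := `|iter_derive s (f i) x| + 1.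
exists (fun t => \sum_i B i * `|c i t|).
  by apply: sqint_sum => i; apply: sqintZ; exact: sqint_norm.
have : \forall y \near x, forall i, `|iter_derive s (f i) y| <= B i.
  apply: filter_forall => i.
  have cs : continuous (iter_derive s (f i)).
    by apply: smooth_continuous; exact: smooth_iter_derive.
  by move: (cs x) => /cvgr_norm_le; apply; rewrite ltrDl.
apply: filterS => y yB t t01; rewrite iter_derive_comb// appE.
apply: le_trans (ler_norm_sum _ _ _) _; apply: ler_sum => i _.
by rewrite normrM mulrC ler_wpM2r.
Qed.

End OnE.

Lemma smooth_fst_coord (k m : nat) l :
  smooth_on setT (fun y : 'rV[R]_k * 'rV[R]_m => y.1 0 l).
Proof.
pose f (y : 'rV[R]_k * 'rV[R]_m) : R := y.1 0 l.
have lf : linear f by move=> a x y; rewrite /f /= !mxE.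
pose fl : {linear _ -> R} := HB.pack f (GRing.isLinear.Build R _ _ _ f lf).
apply: (@smooth_linear _ _ fl) => x.
apply: (@continuous_comp _ _ _ fst (fun y : 'rV[R]_k => y 0 l)); first exact: cvg_fst.
exact: coord_continuous.
Qed.

Lemma smooth_snd_coord (k m : nat) l :
  smooth_on setT (fun y : 'rV[R]_k * 'rV[R]_m => y.2 0 l).
Proof.
pose f (y : 'rV[R]_k * 'rV[R]_m) : R := y.2 0 l.
have lf : linear f by move=> a x y; rewrite /f /= !mxE.
pose fl : {linear _ -> R} := HB.pack f (GRing.isLinear.Build R _ _ _ f lf).
apply: (@smooth_linear _ _ fl) => x.
apply: (@continuous_comp _ _ _ snd (fun y : 'rV[R]_m => y 0 l)); first exact: cvg_snd.
exact: coord_continuous.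
Qed.

End SmoothFunctions.

(** * R^m as a manifold with one chart *)

Section FlatManifold.
Set Implicit Arguments.
Unset Strict Implicit.
Context {R : realType}.
Variable m : nat.

Lemma row_cvg (T : Type) (F : set_system T) (FF : Filter F) (f : T -> 'rV[R]_m)
    (l : 'rV[R]_m) :
  (forall i, f t 0 i @[t --> F] --> l 0 i) -> f @ F --> l.
Proof.
move=> fl A [P Pl PA]; have : \forall t \near F, forall i, P 0 i (f t 0 i).
  by apply: filter_forall => i; apply: fl; exact: Pl.
apply: filterS => t ft; apply: PA => i j; rewrite (ord1 i); exact: ft.
Qed.

Lemma row_second_countable : @second_countable 'rV[R]_m.
Proof.
pose b (z : 'rV[rat]_m * nat) : set 'rV[R]_m :=
  ball (map_mx ratr z.1 : 'rV[R]_m) (z.2.+1%:R^-1 : R).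
exists (range b); first exact: card_le_trans (card_image_le _ _) (countableP _).
split; first by move=> _ [z _ <-]; exact: ball_open.
move=> x A /nbhs_ballP[e /= e0 eA].
have e20 : 0 < e / 2 by rewrite divr_gt0.
have [n ne] := ltr_add_invr e20; rewrite add0r in ne.
have n0 : 0 < n.+1%:R^-1 :> R by rewrite invr_gt0.
have /choice[q qP] : forall i, exists q : rat, `|x 0 i - ratr q| < n.+1%:R^-1.
  move=> i; have [|q] := @rat_in_itvoo R (x 0 i - n.+1%:R^-1) (x 0 i).
    by rewrite gtrBl.
  rewrite in_itv/= => /andP[q1 q2]; exists q.
  by rewrite gtr0_norm ?subr_gt0// ltrBlDr addrC -ltrBlDr.
have bx : ball (map_mx ratr (\row_i q i) : 'rV[R]_m) (n.+1%:R^-1 : R) x.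
  by split=> // i j; apply/ball_sym; rewrite (ord1 i) !mxE; exact: qP.
exists (b (\row_i q i, n)); first by split => //; exists (\row_i q i, n).
move=> z bz; apply: eA; rewrite [e]splitr.
exact: ball_triangle (ball_sym (le_ball (ltW ne) bx)) (le_ball (ltW ne) bz).
Qed.

Lemma smooth_id : smooth_on setT (id : 'rV[R]_m -> 'rV[R]_m).
Proof.
pose f (y : 'rV[R]_m) : 'rV[R]_m := y.
have lf : linear f by [].
pose fl : {linear _ -> _} := HB.pack f (GRing.isLinear.Build R _ _ _ f lf).
by apply: (@smooth_linear _ _ _ fl) => x; exact: cvg_id.
Qed.

Lemma flat_transition (i j : unit) :
  smooth_on (id @` (setT `&` setT : set 'rV[R]_m)) ((id : 'rV[R]_m -> _) \o id).
Proof. by rewrite setIT image_id; exact: smooth_id. Qed.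

Lemma flat_img_open (i : unit) : open (id @` (setT : set 'rV[R]_m)).
Proof. by rewrite image_id; exact: openT. Qed.

Definition flat_manifold : manifold R m :=
  @Manifold R m 'rV[R]_m unit (fun=> setT) (fun=> id) (fun=> id) (fun=> tt)
    (fun=> I) (fun=> openT) flat_img_open (fun _ _ _ => erefl)
    (fun _ q _ => cvg_id) (fun _ q _ => cvg_id) flat_transition
    (@norm_hausdorff _ _) row_second_countable.

Lemma jacobian_id (q : 'rV[R]_m) : 'J ((id : 'rV[R]_m -> 'rV[R]_m) \o id) q = 1%:M.
Proof.
apply/row_matrixP => i; rewrite rowE.
rewrite -(@deriveEjacobian _ _ _ id q (delta_mx 0 i)) ?derive_id ?row1//.
Qed.

Lemma flat_vec_coord i q (v : 'rV[R]_m) : @vec_coord R m flat_manifold i q v = v.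
Proof. by rewrite /vec_coord/= jacobian_id mulmx1. Qed.

Lemma flat_ct_coord i l : @ct_coord R m flat_manifold i l = l.
Proof. by rewrite /ct_coord/= jacobian_id trmx1 mulmx1; case: l. Qed.

Lemma flat_ct_par i x : @ct_par R m flat_manifold i x = x.
Proof. by rewrite /ct_par/= jacobian_id trmx1 mulmx1; case: x. Qed.

End FlatManifold.

(** * The linear-quadratic problem *)

Section LinearQuadratic.
Set Implicit Arguments.
Unset Strict Implicit.
Context {R : realType} {k m : nat}.
Notation mu := (@lebesgue_measure R).
Notation rint D f := (mu.-integrable D (EFin \o (f : R -> R))).
Implicit Types (u v : R -> 'rV[R]_k).

Definition rows (x : 'I_m -> R -> 'rV[R]_k) (t : R) (v : 'rV[R]_k) : 'rV[R]_m :=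
  \row_i dot (x i t) v.

Lemma rows_lin x t (a : R) (v1 v2 : 'rV[R]_k) :
  rows x t (a *: v1 + v2) = a *: rows x t v1 + rows x t v2.
Proof. by apply/rowP => i; rewrite !mxE dotDr dotZr. Qed.

Lemma rows0 x t : rows x t 0 = 0.
Proof. by apply/rowP => i; rewrite !mxE /dot big1// => j _; rewrite mxE mulr0. Qed.

Variables x y : 'I_m -> R -> 'rV[R]_k.
Hypotheses (Lx : forall i, L2 (x i)) (Ly : forall i, L2 (y i)).

Notation M := (@flat_manifold R m).

Definition lq_field (t : R) (u : 'rV[R]_k) (q : M) : 'rV[R]_m := rows x t u.

Definition lq_lagrangian (t : R) (u : 'rV[R]_k) (q : M) : R :=
  2^-1 * dot u u + dot (q : 'rV[R]_m) (rows y t u).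

Lemma flat_domain (i : mchart M) :
  [set: 'rV[R]_k] `*` (mcoord i @` mdom i) = [set: 'rV[R]_k * 'rV[R]_m].
Proof. by rewrite /= image_id setXTT. Qed.

Lemma lq_field_smooth (i : mchart M) (a : 'I_m) :
  L2_smooth ([set: 'rV[R]_k] `*` (mcoord i @` mdom i))
    (fun t (z : 'rV[R]_k * 'rV[R]_m) =>
      vec_coord i (mpar i z.2) (lq_field t z.1 (mpar i z.2)) 0 a).
Proof.
rewrite flat_domain.
have -> : (fun t (z : 'rV[R]_k * 'rV[R]_m) =>
      vec_coord i (mpar i z.2) (lq_field t z.1 (mpar i z.2)) 0 a) =
    (fun t => \sum_l x a t 0 l *: (fun z : 'rV[R]_k * 'rV[R]_m => z.1 0 l)).
  apply/funext => t; apply/funext => z; rewrite flat_vec_coord mxE fct_sumE.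
  by apply: eq_bigr.
by apply: L2_smooth_comb => l; [exact: Lx|exact: smooth_fst_coord].
Qed.

Lemma lq_lagrangian_smooth (i : mchart M) :
  L2_smooth ([set: 'rV[R]_k] `*` (mcoord i @` mdom i))
    (fun t (z : 'rV[R]_k * 'rV[R]_m) => lq_lagrangian t z.1 (mpar i z.2)).
Proof.
rewrite flat_domain.
pose f1 (l : 'I_k) (z : 'rV[R]_k * 'rV[R]_m) : R := z.1 0 l.
pose f2 (a : 'I_m) (z : 'rV[R]_k * 'rV[R]_m) : R := z.2 0 a.
(* The left summand indexes the terms of |u|^2 / 2, the right one the products q_a u_l of the cross
   term. *)
pose c (j : 'I_k + 'I_m * 'I_k) (t : R) : R :=
  match j with inl _ => 2^-1 | inr p => y p.1 t 0 p.2 end.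
pose f (j : 'I_k + 'I_m * 'I_k) : 'rV[R]_k * 'rV[R]_m -> R :=
  match j with inl l => f1 l * f1 l | inr p => f2 p.1 * f1 p.2 end.
have -> : (fun t (z : 'rV[R]_k * 'rV[R]_m) => lq_lagrangian t z.1 (mpar i z.2)) =
    (fun t => \sum_j c j t *: f j).
  apply/funext => t; apply/funext => z; rewrite fct_sumE big_sumType/=.
  congr (_ + _); first by rewrite mulr_sumr; apply: eq_bigr.
  rewrite -(pair_bigA _ (fun a l => (y a t 0 l *: (f2 a * f1 l)) z))/=.
  apply: eq_bigr => a _; rewrite mxE mulr_sumr; apply: eq_bigr => l _.
  by rewrite mulrCA.
apply: L2_smooth_comb => [[l|p]|[l|p]] /=.
- exact: sqint_cst.
- exact: Ly.
- by apply: smoothM; exact: smooth_fst_coord.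
- by apply: smoothM; [exact: smooth_snd_coord|exact: smooth_fst_coord].
Qed.

Definition lq_problem : control_problem R k :=
  @ControlProblem R k m M setT lq_field lq_lagrangian (0 : 'rV[R]_m) (0 : 'rV[R]_m)
    openT lq_field_smooth lq_lagrangian_smooth.

Notation P := lq_problem.

Lemma lq_hamE t (u : 'rV[R]_k) (l : cotangent (cman P)) :
  ham t u l = dot l.2 (rows x t u) - (2^-1 * dot u u + dot (l.1 : 'rV[R]_m) (rows y t u)).
Proof. by []. Qed.

(** The zero control has zero Hamiltonian everywhere: constant curves are solutions, the flow is the
    identity, and b_w is h_w itself. *)
Lemma lq_ham0 t (l : cotangent (cman P)) : ham t 0 l = 0.
Proof. by rewrite lq_hamE !rows0 !dot0r mulr0 addr0 subrr. Qed.

Lemma ham_vec_cst (c : R) z : ham_vec (fun _ : 'rV[R]_m * 'rV[R]_m => c) z = 0.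
Proof.
have D0 (v : 'rV[R]_m * 'rV[R]_m) : 'D_v (fun _ : 'rV[R]_m * 'rV[R]_m => c) z = 0.
  exact: derive_cst.
by congr pair; [|rewrite -[RHS]oppr0; congr (- _)]; apply/rowP => i; rewrite !mxE D0.
Qed.

Lemma primitive_on_cst (n : nat) (a b : R) (q : 'rV[R]_n) :
  primitive_on a b (fun=> 0) (fun=> q).
Proof.
have i0 : rint `[a, b] (fun=> 0) by exact: integrable0.
move=> j; split=> [|c cab].
  by move: i0; apply: eq_integrable => // t _; rewrite /= mxE.
rewrite subrr (_ : (fun t : R => _) = fun=> 0); last by apply/funext => t; rewrite mxE.
by rewrite Rintegral_cst ?mul0r//; exact: measurable_itv.
Qed.

Lemma lq_ham_curve (l : cotangent (cman P)) :
  ham_curve (fun t => @ham R k P t 0) (fun=> l).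
Proof.
split=> [|i a b a0 ab b1 ldom X0 X].
  by apply: continuous_subspaceT => t; exact: cvg_cst.
have XE t : X t = 0.
  rewrite /X (_ : ham t 0 \o ct_par i = fun=> 0) ?ham_vec_cst//.
  by apply/funext => z; exact: lq_ham0.
split.
  rewrite (_ : (fun t => (X t).1) = fun=> 0); last by apply/funext => t; rewrite XE.
  exact: primitive_on_cst.
rewrite (_ : (fun t => (X t).2) = fun=> 0); last by apply/funext => t; rewrite XE.
exact: primitive_on_cst.
Qed.

Lemma coord_norm_le (n : nat) (z : 'rV[R]_n) i : `|z 0 i| <= `|z|.
Proof.
rewrite [leRHS]/Num.norm/= mx_normrE.
exact: (le_bigmax _ (fun ij : 'I_1 * 'I_n => `|z ij.1 ij.2|) (0, i)).
Qed.

Lemma row_norm_le (n : nat) (z : 'rV[R]_n) (C : R) : 0 <= C ->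
  (forall i, `|z 0 i| <= C) -> `|z| <= C.
Proof.
move=> C0 zC; rewrite [leLHS]/Num.norm/= mx_normrE.
by apply: bigmax_le => // -[i j] _; rewrite (ord1 i); exact: zC.
Qed.

(** The constant (k + 1)^2 is a perfect square above k, ready for [normL2_le]. *)
Lemma Linfty_L2 v (r : R) : Linfty v -> ess_le v r ->
  L2 v /\ ip v v <= (k%:R + 1) ^+ 2 * r ^+ 2 /\ 0 <= r.
Proof.
move=> [mv _] vr; have ir := @rint01_cst R r; have i0 := @rint01_cst R 0.
have r0 : 0 <= r.
  (* An essential bound is nonnegative since [0, 1] has positive measure, as integration shows. *)
  have : \int[mu]_(t in I01) (0 : R) <= \int[mu]_(t in I01) r.
    apply: ae_le_Rintegral => //.
    by apply: ae_imply vr => t _; apply: le_trans.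
  by rewrite !Rintegral_cst// ![X in fine X]mu_I01 mul0r mulr1.
have sq t i : `|v t| <= r -> v t 0 i ^+ 2 <= r ^+ 2.
  move=> vtr; rewrite -(real_normK (num_real (v t 0 i))).
  by rewrite lerXn2r ?nnegrE// (le_trans (coord_norm_le _ _)).
have Lv : L2 v.
  move=> i; split => //; pose h t := Num.min (v t 0 i ^+ 2) (r ^+ 2).
  have ms : measurable_fun I01 (fun t => v t 0 i ^+ 2) by exact: measurable_funX.
  apply: (rint_ae measurable_I01 (f := h) ms).
    by apply: ae_imply vr => t _ vtr; rewrite /h min_l// sq.
  apply: (rint_le measurable_I01 _ _ (@rint01_cst R (r ^+ 2))).
    exact: measurable_minr.
  move=> t _; rewrite ger0_norm; first by rewrite /h ge_min lexx orbT.
  by rewrite /h le_min !sqr_ge0.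
split => //; split => //.
have kr : k%:R * r ^+ 2 <= (k%:R + 1) ^+ 2 * r ^+ 2.
  rewrite ler_wpM2r ?sqr_ge0//; have := ler0n R k; nra.
apply: le_trans kr.
have <- : \int[mu]_(t in @I01 R) (k%:R * r ^+ 2 : R) = k%:R * r ^+ 2.
  by rewrite Rintegral_cst// [X in fine X]mu_I01 mulr1.
apply: ae_le_Rintegral => //.
- exact: rint_dot.
- exact: rint01_cst.
apply: ae_imply vr => t _ vtr.
rewrite mulr_natl -[k in leRHS]card_ord -sumr_const; apply: ler_sum => i _.
by rewrite -expr2 sq.
Qed.

Definition lq_diff v : 'rV[R]_m := \row_i ip (x i) v.

Lemma lq_endpoint v q : @endpoint R k P v q -> L2 v -> q = lq_diff v.
Proof.
move=> [_ [gam [g0 _ gP] <-]] Lv.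
have := gP tt 0 1 (lexx _) ler01 (lexx _) (fun _ _ => I) => H.
apply/rowP => j; have [_ /(_ 1)] := H j.
rewrite ler01 lexx => /(_ isT); rewrite /= g0 mxE subr0 => ->.
by rewrite [RHS]mxE; apply: eq_Rintegral => t _; rewrite flat_vec_coord mxE.
Qed.

Lemma lq_endpoint_exists v : Linfty v -> L2 v -> @endpoint R k P v (lq_diff v).
Proof.
move=> Iv Lv; split; first by split => //; apply: aeW.
pose gam t : 'rV[R]_m := \row_i \int[mu]_(tau in `[0, t]) dot (x i tau) (v tau).
have ixv i := rint_dot (Lx i) Lv.
exists gam; last by apply/rowP => i; rewrite !mxE.
split.
- by apply/rowP => i; rewrite !mxE set_itv1 Rintegral_set1.
- move=> t; apply: row_cvg => i.
  have := indefinite_continuous (ixv i); move=> /(_ t) ct.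
  rewrite mxE; move: ct; apply: cvg_trans; apply: near_eq_cvg; near=> s.
  by rewrite mxE.
move=> i a b a0 ab b1 _ j.
have abI : `[a, b]%classic `<=` I01.
  move=> s /=; rewrite /I01/= !in_itv/= => /andP[as_ sb].
  by rewrite (le_trans a0 as_) (le_trans sb b1).
have mI (c d : itv_bound R) : measurable ([set` Interval c d] : set R).
  exact: measurable_itv.
split.
  apply: (rint_eq (mI _ _) _ (rint_subset (mI _ _) measurable_I01 abI (ixv j))) => t _.
  by rewrite flat_vec_coord mxE.
move=> c /andP[ac cb]; rewrite /= !mxE.
have c1 : c <= 1 by exact: le_trans cb b1.
have c0 : 0 <= c by exact: le_trans a0 ac.
have c01 : I01 c by rewrite /I01/= in_itv/= c0.
have i0c := rint_subset (mI _ _) measurable_I01 (itv0_sub c01) (ixv j).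
rewrite Rintegral_itvB ?bnd_simp//.
rewrite Rintegral_itv_obnd_cbnd ?bnd_simp; last first.
  apply: (rint_subset (mI _ _) measurable_I01 _ (ixv j)).
  move=> s /=; rewrite /I01/= !in_itv/= => /andP[as_ sc].
  by rewrite (le_trans a0 (ltW as_)) (le_trans sc c1).
by apply: eq_Rintegral => t _; rewrite flat_vec_coord mxE.
Unshelve. all: by end_near. Qed.

Lemma lq_diff_lin (a : R) v w : L2 v -> L2 w ->
  lq_diff (a *: v + w) = a *: lq_diff v + lq_diff w.
Proof.
by move=> Lv Lw; apply/rowP => i; rewrite !mxE ipDr ?ipZr//; exact: L2Z.
Qed.

(** The field does not depend on q and the start is 0, so the endpoint map is linear: it is its own
    differential, with zero remainder, and any radius works. *)
Lemma lq_endpoint_differential : @endpoint_differential R k P 0 lq_diff.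
Proof.
have I0 : Linfty (0 : R -> 'rV[R]_k).
  split=> [i|]; last by exists 0; apply: aeW => t _; rewrite normr0.
  by under eq_fun do rewrite mxE; exact: measurable_cst.
split.
- rewrite (_ : cend P = lq_diff 0); first exact: lq_endpoint_exists I0 L2_0.
  by apply/rowP => i; rewrite !mxE ip0r.
- move=> a v w Iv Iw; have [_ [r rv]] := Iv; have [_ [s sw]] := Iw.
  by apply: lq_diff_lin; [have [] := Linfty_L2 Iv rv|have [] := Linfty_L2 Iw sw].
- exists (\sum_i normL2 (x i) * (k%:R + 1)) => v r Iv rv.
  have [Lv [vr r0]] := Linfty_L2 Iv rv.
  apply: row_norm_le => [|i].
    by rewrite mulr_ge0// sumr_ge0// => i _; rewrite mulr_ge0 ?normL2_ge0 ?addr_ge0.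
  rewrite mxE; apply: le_trans (ip_le (Lx i) Lv) _.
  rewrite mulr_suml (bigD1 i)//= -[leLHS]addr0; apply: lerD.
    rewrite -mulrA ler_wpM2l ?normL2_ge0//; apply: normL2_le.
      by rewrite mulr_ge0// addr_ge0.
    by rewrite exprMn.
  by apply: sumr_ge0 => j _; rewrite !mulr_ge0 ?normL2_ge0 ?addr_ge0.
- move=> e e0; exists 1 => // v r Iv rv _; have [Lv [_ r0]] := Linfty_L2 Iv rv.
  rewrite add0r; split; first by exists (lq_diff v); exact: lq_endpoint_exists.
  move=> q /lq_endpoint/(_ Lv) ->; split => //=.
  by rewrite subr0 subrr normr0 mulr_ge0// ltW.
Qed.

(* The bounded functions x_j / (1 + sum_i |x_i|^2) already span the image: their
   Gram matrix against the x_i is positive definite. *)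
Lemma lq_diff_surjective : ip_orthonormal x ->
  forall z : 'rV[R]_m, exists2 v, Linfty v & lq_diff v = z.
Proof.
move=> ox z; pose N t := 1 + \sum_i dot (x i t) (x i t).
have N1 t : 1 <= N t by rewrite lerDl; apply: sumr_ge0 => i _; exact: dot_ge0.
have N0 t : 0 < N t := lt_le_trans ltr01 (N1 t).
have mN : measurable_fun I01 N.
  apply: measurable_funD => //; apply: measurable_sum => i.
  by apply: measurable_dot => // l; exact: L2_measurable.
pose b j t := (N t)^-1 *: x j t.
have bb j t : `|b j t| <= 1.
  apply: row_norm_le => // l; rewrite mxE normrM gtr0_norm ?invr_gt0//.
  (* A coordinate c of x_j satisfies |c| <= 1 + c^2 <= N. *)
  rewrite ler_pdivrMl// mulr1; apply: (@le_trans _ _ (1 + x j t 0 l ^+ 2)).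
    rewrite -(real_normK (num_real (x j t 0 l))).
    have := normr_ge0 (x j t 0 l); have := sqr_ge0 (`|x j t 0 l| - 1); nra.
  rewrite lerD2l (bigD1 j)//= -[leLHS]addr0; apply: lerD; last first.
    by apply: sumr_ge0 => i _; exact: dot_ge0.
  rewrite /dot (bigD1 l)//= -expr2 lerDl; apply: sumr_ge0 => i _.
  by rewrite -expr2 sqr_ge0.
have mb j l : measurable_fun I01 (fun t => b j t 0 l).
  under eq_fun do rewrite mxE; apply: measurable_funM; last exact: L2_measurable.
  (* As N is positive, its inverse is a composition of measurable functions. *)
  have -> : (fun t => (N t)^-1) = (fun t => expR (- ln (N t))).
    by apply/funext => t; rewrite expRN lnK// posrE.
  apply: measurableT_comp => //; apply: measurableT_comp => //.
  exact: measurableT_comp mN.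
have Linf_sum (a : 'rV[R]_m) : Linfty (\sum_j a 0 j *: b j).
  split=> [l|].
    under eq_fun do rewrite fct_sumE summxE.
    apply: measurable_sum => j; under eq_fun do rewrite mxE.
    exact: measurable_funM.
  exists (\sum_j `|a 0 j|); apply: aeW => t _; rewrite fct_sumE.
  apply: le_trans (ler_norm_sum _ _ _) _; apply: ler_sum => j _.
  by rewrite normrZ -[leRHS]mulr1 ler_wpM2l.
have Lb j : L2 (b j).
  have bj : Linfty (b j) by split => //; exists 1; apply: aeW => t _.
  have ej : ess_le (b j) 1 by apply: aeW => t _.
  by have [] := Linfty_L2 bj ej.
pose G : 'M[R]_m := \matrix_(j, i) ip (x i) (b j).
have GE (a : 'rV[R]_m) : lq_diff (\sum_j a 0 j *: b j) = a *m G.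
  apply/rowP => i; rewrite !mxE ip_sumr//; last by move=> j; exact: L2Z.
  by apply: eq_bigr => j _; rewrite ipZr// !mxE.
have /mulmxKV GK : G \in unitmx.
  rewrite -row_free_unit; apply: inj_row_free => a aG0.
  pose s := \sum_i a 0 i *: x i.
  have Lax i : L2 (a 0 i *: x i) by exact: L2Z.
  have Ls : L2 s by exact: L2_sum.
  have Lab : L2 (\sum_j a 0 j *: b j) by apply: L2_sum => j; exact: L2Z.
  (* If a G = 0, the integral of |s|^2 / N vanishes, so s is null and orthonormality of the x_i
     gives a = 0. *)
  have ss t : dot (s t) ((\sum_j a 0 j *: b j) t) = (N t)^-1 * dot (s t) (s t).
    rewrite -dotZr; congr (dot _ _); rewrite /s !fct_sumE scaler_sumr.
    by apply: eq_bigr => j _; rewrite -[LHS]/(a 0 j *: ((N t)^-1 *: x j t)) scalerA mulrC -scalerA.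
  have s0 : ip s (\sum_j a 0 j *: b j) = 0.
    rewrite ip_suml// big1// => i _; rewrite ipZl//.
    have /rowP/(_ i) := GE a; rewrite aG0 !mxE => ->.
    by rewrite mulr0.
  have sae : ae_eq mu I01 s 0.
    have sb0 t : I01 t -> 0 <= dot (s t) ((\sum_j a 0 j *: b j) t).
      by move=> _; rewrite ss mulr_ge0 ?dot_ge0// invr_ge0 ltW.
    have := Rintegral_ge0_eq0 measurable_I01 (rint_dot Ls Lab) sb0 s0.
    apply: ae_imply => t _; rewrite ss => /eqP.
    by rewrite mulf_eq0 invr_eq0 (gt_eqF (N0 t))/= => /eqP/dot_eq0.
  apply/rowP => i; rewrite mxE; have := ip_ael Ls (@L2_0 R k) (Lx i) sae.
  rewrite ip0l /s ip_suml// (bigD1 i)//= ipZl// ox eqxx mulr1 big1 ?addr0//.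
  by move=> j ji; rewrite ipZl// ox (negPf ji) mulr0.
by exists (\sum_j (z *m invmx G) 0 j *: b j) => //; rewrite GE GK.
Qed.

Lemma lq_strictly_normal : ip_orthonormal x -> strictly_normal P 0.
Proof.
move=> ox; exists lq_diff; first exact: lq_endpoint_differential.
exact: lq_diff_surjective.
Qed.

Definition lq_covector : cotangent (cman P) := ((0 : 'rV[R]_m), 0).

Lemma lq_normal_extremal : @normal_extremal R k P 0 (fun=> lq_covector).
Proof.
have [[c0 [gam tr g1]] _ _ _] := lq_endpoint_differential.
split; [exact: c0| |by []| |].
- split; [by []|by apply: continuous_subspaceT => t; exact: cvg_cst|].
  move=> i a b a0 ab b1 _.
  rewrite (_ : (fun t => vec_coord _ _ _) = fun=> 0); first exact: primitive_on_cst.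
  by apply/funext => t; rewrite flat_vec_coord; exact: rows0.
- exact: lq_ham_curve.
(* At the zero covector over the origin h_w = - |w|^2 / 2, maximal at w = 0. *)
- apply: aeW => t _ w _; rewrite lq_ham0 lq_hamE !dot0l addr0 sub0r oppr_le0.
  by rewrite mulr_ge0 ?dot_ge0// invr_ge0.
Qed.

Notation Phi := (fun (_ : R) (l : cotangent (cman P)) => l).

Lemma lq_flow : ham_flow_near (fun t => @ham R k P t 0) lq_covector Phi.
Proof.
have FF := @nbhs_filter ('rV[R]_m * 'rV[R]_m)%type (ct_coord (chart_at lq_covector.1) lq_covector).
by apply: (@filterE _ _ FF) => z; split; [exact: lq_ham_curve|].
Qed.

Lemma lq_b_fun t (w : 'rV[R]_k) (z : 'rV[R]_m * 'rV[R]_m) :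
  @b_fun R k P 0 lq_covector Phi t w z =
  dot z.2 (rows x t w) - (2^-1 * dot w w + dot z.1 (rows y t w)).
Proof. by rewrite /b_fun flat_ct_par lq_ham0 subr0 lq_hamE. Qed.

(** The term |w|^2 / 2 does not depend on (q, p), so the field of b_w is linear in w and is its own
    derivative. The minus sign before the Lagrangian cancels that of - dh/dq. *)
Lemma lq_Z_map t (v : 'rV[R]_k) : @Z_map R k P 0 lq_covector Phi t v = (rows x t v, rows y t v).
Proof.
have hv w z : ham_vec (@b_fun R k P 0 lq_covector Phi t w) z = (rows x t w, rows y t w).
  rewrite /ham_vec; congr pair.
    apply/rowP => a; rewrite mxE; apply: derive_affine => h.
    rewrite !lq_b_fun /= dotDl dotZl dotDl dotZl dot0l.
    rewrite dotC dot_delta -[_ *: _]/(_ * _); ring.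
  apply/rowP => a; rewrite !mxE.
  rewrite -[dot (y a t) w]opprK; congr (- _); apply: derive_affine => h.
  rewrite !lq_b_fun /= dotDl dotZl dotDl dotZl dot0l.
  rewrite (dotC (delta_mx _ _)) dot_delta mxE -[_ *: _]/(_ * _); ring.
apply: derive_affine => h; rewrite !hv !rows_lin.
have -> : (0 : R -> 'rV[R]_k) t = 0 by [].
by rewrite !rows0 !addr0 -[RHS]/(0 + h *: _, 0 + h *: _) !add0r.
Qed.

Lemma lq_H_mx t : @H_mx R k P 0 lq_covector Phi t = -1%:M.
Proof.
apply/matrixP => a b; rewrite !mxE.
have D w : 'D_(delta_mx 0 b) (fun w => @b_fun R k P 0 lq_covector Phi t w
    (ct_coord (chart_at lq_covector.1) lq_covector)) w = - w 0 b.
  apply: (@derive_quadratic R _ _ _ _ _ _ (- 2^-1 : R)) => h.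
  rewrite flat_ct_coord !lq_b_fun /= !dot0l !addr0 !sub0r.
  rewrite dotDl !dotDr !dotZl !dotZr (dotC _ w) !dot_delta mxE !eqxx.
  rewrite -[h *: - w 0 b]/(h * - w 0 b) -[h ^+ 2 *: _]/(h ^+ 2 * - 2^-1).
  by rewrite /= mulr1; field.
have -> : 'D_(delta_mx 0 b) (fun w => @b_fun R k P 0 lq_covector Phi t w
    (ct_coord (chart_at lq_covector.1) lq_covector)) = fun w : 'rV[R]_k => - w 0 b.
  by apply/funext => w; exact: D.
apply: derive_affine => h; rewrite !mxE eqxx /= -[_ *: _]/(_ * _) (eq_sym a b).
by case: (b == a); rewrite ?mulr1n ?mulr0n; ring.
Qed.

Lemma lq_regular : @regular R k P 0 lq_covector Phi.
Proof.
exists `|invmx (-1%:M : 'M[R]_k)|; apply: aeW => t _; rewrite lq_H_mx; split => //.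
move=> v v0; rewrite mulmxN mulmx1 dotNl oppr_lt0 lt_neqAle dot_ge0 andbT eq_sym.
by apply/eqP => /dot_eq0 v0'; rewrite v0' eqxx in v0.
Qed.

Lemma lq_Z_int v : (@Z_int R k P 0 lq_covector Phi v).1 = lq_diff v.
Proof.
by apply/rowP => a; rewrite !mxE; apply: eq_Rintegral => t _; rewrite lq_Z_map mxE.
Qed.

End LinearQuadratic.

(** * Realization of an arbitrary couple *)

Section Realization.
Set Implicit Arguments.
Unset Strict Implicit.
Context {R : realType} {k : nat}.
Notation mu := (@lebesgue_measure R).

Lemma volterra_realized (V : set (R -> 'rV[R]_k)) K :
  closed_fincodim V -> volterra_HS K -> symmetric_on V K -> realized K V.
Proof.
move=> cV vK sK.
have [m [w [y [Lw Ly ow VP aE]]]] := skew_part_normal_form cV vK sK.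
(* The compact part of the problem has skew form - sigma / 2 evaluated on the integrals of Z; the
   factor - 2 makes it the normal form of A. *)
pose z i := (- 2) *: y i; have Lz i : L2 (z i) by exact: L2Z.
exists (lq_problem Lw Lz), 0, (fun=> lq_covector Lw Lz), (fun _ l => l).
split; first split.
- exact: lq_normal_extremal.
- exact: lq_strictly_normal.
- exact: lq_flow.
- exact: lq_regular.
split=> [v|v u Lv Lu].
  have vE : vertical (@Z_int _ _ (lq_problem Lw Lz) 0 (lq_covector Lw Lz) (fun _ l => l) v) =
      (lq_diff w v = 0) by rewrite -(lq_Z_int Lw Lz v).
  rewrite VP vE; split=> [[Lv wv]|[Lv /rowP wv]]; split => //.
    by apply/rowP => i; rewrite !mxE.
  by move=> i; have := wv i; rewrite !mxE.
(* The two families of terms of - sigma(Z_tau v, Z_t u), the factor at time t in g and the one at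
   time tau in h. *)
pose g (j : 'I_m + 'I_m) := match j with inl i => 2 *: w i | inr i => z i end.
pose h (j : 'I_m + 'I_m) := match j with inl i => y i | inr i => w i end.
have Lg j : L2 (g j) by case: j => i; [exact: L2Z|exact: Lz].
have Lh j : L2 (h j) by case: j.
have anti t tau i l :
    \sum_j g j t 0 i * h j tau 0 l = - \sum_j g j tau 0 l * h j t 0 i.
  rewrite !big_sumType /= -!big_split /= -sumrN; apply: eq_bigr => j _.
  by rewrite /z !mxE; ring.
have vK0 := sep_op_volterra Lg Lh.
have skewE v1 v2 : L2 v1 -> L2 v2 ->
    ip (skew_part K v1) v2 = ip (skew_part (sep_op g h) v1) v2.
  move=> L1 L3; apply: (etrans (aE _ _ L1 L3)).
  apply: (etrans _ (esym (ip_skew_sep_op Lg Lh anti L1 L3))).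
  rewrite big_sumType /= -big_split mulr_sumr; apply: eq_bigr => j _ /=.
  by rewrite /z !ipZl//; field.
(* K is only given through its skew part; here uniqueness provides its kernel. *)
have KE := volterra_skew_determines vK vK0 skewE.
rewrite (ip_ael (vK.1 _ Lv) (vK0.1 _ Lv) Lu (KE v Lv)) ip_sep_op//.
rewrite -Rintegral_sum//; last by move=> j; exact: rint_sep.
rewrite -[RHS]mulN1r.
have tE t : I01 t -> \sum_j dot (g j t) (u t) *
      \int[mu]_(tau in `[0, t]) dot (h j tau) (v tau) =
    -1 * \int[mu]_(tau in `[0, t]) sigma
      (@Z_map _ _ (lq_problem Lw Lz) 0 (lq_covector Lw Lz) (fun _ l => l) tau (v tau))
      (@Z_map _ _ (lq_problem Lw Lz) 0 (lq_covector Lw Lz) (fun _ l => l) t (u t)).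
  move=> t01; have mt : measurable (`[0, t]%classic : set R) by exact: measurable_itv.
  have it j : mu.-integrable `[0, t] (EFin \o (fun tau => dot (h j tau) (v tau))).
    by apply: (rint_subset mt measurable_I01 (itv0_sub t01)); exact: rint_dot.
  under eq_bigr => j _ do rewrite -RintegralZ//.
  have igh j : mu.-integrable `[0, t] (EFin \o
      (fun tau => dot (g j t) (u t) * dot (h j tau) (v tau))) by exact: rintZ.
  rewrite -Rintegral_sum//.
  have E tau : sigma
      (@Z_map _ _ (lq_problem Lw Lz) 0 (lq_covector Lw Lz) (fun _ l => l) tau (v tau))
      (@Z_map _ _ (lq_problem Lw Lz) 0 (lq_covector Lw Lz) (fun _ l => l) t (u t)) =
      -1 * \sum_j dot (g j t) (u t) * dot (h j tau) (v tau).
    rewrite !lq_Z_map /sigma /= big_sumType /= -big_split -sumrB mulr_sumr.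
    apply: eq_bigr => i _ /=; rewrite !mxE /z !dotZl; ring.
  under [in RHS]eq_Rintegral do rewrite E.
  by rewrite RintegralZ ?mulrA ?mulrNN ?mul1r//; exact: rint_sum.
have isum : mu.-integrable I01 (EFin \o (fun t => \sum_j dot (g j t) (u t) *
      \int[mu]_(tau in `[0, t]) dot (h j tau) (v tau))).
  by apply: rint_sum => // j; exact: rint_sep.
rewrite -RintegralZ//.
  by apply: eq_Rintegral => t /set_mem; exact: tE.
apply: (rint_eq measurable_I01 _ (rintZ measurable_I01 (-1) isum)) => t /tE ->.
by rewrite mulrA mulrNN !mul1r.
Qed.

End Realization.

Theorem theorem3 (R : realType) (k : nat) :
  (forall (V : set (R -> 'rV[R]_k)) (K : (R -> 'rV[R]_k) -> (R -> 'rV[R]_k)),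
    closed_fincodim V -> volterra_HS K -> symmetric_on V K ->
    [/\ realized K V,
        exists (S : lagrangian_pair R) (Z : (R -> 'rV[R]_k) -> S),
          is_triple S Z /\ represents S Z K V
      & forall (S : lagrangian_pair R) (Z : (R -> 'rV[R]_k) -> S),
          is_triple S Z -> represents S Z K V ->
          (forall Phi : 'Hom(S, S), stab S Phi ->
            is_triple S (Phi \o Z) /\ represents S (Phi \o Z) K V) /\
          (forall (S' : lagrangian_pair R) (Z' : (R -> 'rV[R]_k) -> S'),
            is_triple S' Z' -> represents S' Z' K V ->
            (exists Psi : 'Hom(S', S), pair_iso S' S Psi) /\
            (forall Psi : 'Hom(S', S), pair_iso S' S Psi ->
              exists2 Phi : 'Hom(S, S), stab S Phi &
                forall u, L2 u -> Psi (Z' u) = Phi (Z u)))]) /\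
  (forall (S : lagrangian_pair R) (Z : (R -> 'rV[R]_k) -> S),
    is_triple S Z ->
    exists (K : (R -> 'rV[R]_k) -> (R -> 'rV[R]_k)) (V : set (R -> 'rV[R]_k)),
      [/\ closed_fincodim V, volterra_HS K, symmetric_on V K, represents S Z K V
        & forall (K' : (R -> 'rV[R]_k) -> (R -> 'rV[R]_k))
                 (V' : set (R -> 'rV[R]_k)),
            volterra_HS K' -> represents S Z K' V' ->
            V' = V /\
            forall u, L2 u -> ae_eq (@lebesgue_measure R) I01 (K' u) (K u)]) /\
  (forall K1 K2 : (R -> 'rV[R]_k) -> (R -> 'rV[R]_k),
    volterra_HS K1 -> volterra_HS K2 ->
    (forall u, L2 u ->
      ae_eq (@lebesgue_measure R) I01 (skew_part K1 u) (skew_part K2 u)) ->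
    forall u, L2 u -> ae_eq (@lebesgue_measure R) I01 (K1 u) (K2 u)).
Proof.
split=> [V K cV vK sK|]; last split.
- split; first exact: volterra_realized.
    exact: triple_exists.
  move=> S Z tZ rZ; split=> [Phi sPhi|S' Z' tZ' rZ']; first exact: triple_comp.
  exact: triple_unique tZ rZ tZ' rZ'.
- exact: triple_operator.
- move=> K1 K2 vK1 vK2 eqA; apply: (volterra_skew_determines vK1 vK2) => u v Lu Lv.
  exact: ip_ael (L2_skew_part vK1 Lu) (L2_skew_part vK2 Lu) Lv (eqA u Lu).
Qed.
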